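(* Let $p\ge 3$, let $a$ satisfy $p/2+a+1>0$, and let $L:[1,\infty)\to[0,\infty)$ satisfy (L1)–(L3) (given in the context). Let $Z\sim N_p(\mu,I_p)$ and consider estimation of $\mu$ under quadratic loss $\|\hat\mu-\mu\|^2$, with the prior density $\pi(\mu)=G(\|\mu\|;a,L)$. (1) Suppose $a>-2$. Then the generalized Bayes estimator with respect to $\pi$ is admissible. (2) Suppose $a=-2$ and $\log(y)/L(y)$ is ultimately monotone non-decreasing. Then the generalized Bayes estimator with respect to $\pi$ is admissible.
   Context: The prior is $$G(\|\mu\|;a,L)=\int_0^1\Big\{\frac{\lambda}{1-\lambda}\Big\}^{p/2}\exp\Big(-\frac{\lambda}{1-\lambda}\frac{\|\mu\|^2}{2}\Big)\lambda^aL(1/\lambda)\,d\lambda .$$ Assumptions on $L$: (L1) $L$ is slowly varying at infinity: $\lim_{y\to\infty}L(cy)/L(y)=1$ for all $c>0$; (L2) $L$ is ultimately monotone; (L3) $L$ is differentiable with ultimately monotone derivative $L'$. ''Ultimately'' means on $[y_0,\infty)$ for some $y_0$. The generalized Bayes estimator is the posterior mean of $\mu$ given $Z$ (the prior may be improper). An estimator is admissible if no other estimator has risk (expected loss) no larger for all $\mu$ and strictly smaller for some $\mu$. *)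

(* Defs.v *)
From HB Require Import structures.
From mathcomp Require Import all_boot all_order all_algebra.
From mathcomp Require Import all_classical all_reals all_analysis.

Set Implicit Arguments.
Unset Strict Implicit.
Unset Printing Implicit Defensive.

Import Order.TTheory GRing.Theory Num.Theory.
Import numFieldNormedType.Exports.

Local Open Scope classical_set_scope.
Local Open Scope ring_scope.

(* A point of R^n is an n-tuple; the sigma-algebra is the one that the library
   puts on tuples, i.e., the product of the Borel sigma-algebras of R. *)
Notation vect R n := (n.-tuple (measurableTypeR R)).

Section vcons.
Context {R : realType} (n : nat).

Definition vcons (u : measurableTypeR R * vect R n) : vect R n.+1 :=
  [tuple of u.1 :: u.2].

Definition vuncons (x : vect R n.+1) : measurableTypeR R * vect R n :=
  (thead x, [tuple of behead x]).

Lemma vconsK : cancel vcons vuncons.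
Proof. by case=> a x; congr (_, _); exact/val_inj. Qed.

Lemma measurable_vcons : measurable_fun [set: _] vcons.
Proof. exact: measurable_cons. Qed.

Lemma measurable_vuncons : measurable_fun [set: _] vuncons.
Proof.
apply/measurable_fun_pairP; split; first exact: (measurable_tnth ord0).
exact: measurable_behead.
Qed.

Lemma measurable_vcons_preimage (A : set (vect R n.+1)) :
  measurable A -> measurable (vcons @^-1` A).
Proof. by move=> mA; rewrite -[X in measurable X]setTI; exact: measurable_vcons. Qed.

End vcons.

Section lebesgue_step.
Local Open Scope ereal_scope.
Context {R : realType} (n : nat).
Variable m : {sigma_finite_measure set (vect R n) -> \bar R}.

Definition lebesgue_step : set (vect R n.+1) -> \bar R :=
  pushforward (lebesgue_measure \x m) (@vcons R n).

Let lebesgue_step0 : lebesgue_step set0 = 0.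
Proof. by rewrite /lebesgue_step /pushforward preimage_set0 measure0. Qed.

Let lebesgue_step_ge0 A : 0 <= lebesgue_step A.
Proof. by rewrite /lebesgue_step /pushforward measure_ge0. Qed.

Let lebesgue_step_sigma_additive : semi_sigma_additive lebesgue_step.
Proof.
move=> F mF tF mUF; rewrite /lebesgue_step /pushforward preimage_bigcup.
apply: measure_semi_sigma_additive.
- by move=> k; exact: measurable_vcons_preimage.
- apply/trivIsetP => /= i j _ _ ij; rewrite -preimage_setI.
  by move/trivIsetP : tF => /(_ _ _ _ _ ij) ->//; rewrite preimage_set0.
- by rewrite -preimage_bigcup; exact: measurable_vcons_preimage.
Qed.

HB.instance Definition _ := isMeasure.Build _ _ _ lebesgue_step
  lebesgue_step0 lebesgue_step_ge0 lebesgue_step_sigma_additive.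

Let lebesgue_step_sigma_finite : sigma_finite [set: _] lebesgue_step.
Proof.
have /sigma_finiteP[F [TF ndF Foo]] := sigma_finiteT (@lebesgue_measure R).
have /sigma_finiteP[G [TG ndG Goo]] := sigma_finiteT m.
exists (fun k => @vuncons R n @^-1` (F k `*` G k)).
  rewrite -preimage_bigcup (_ : \bigcup_k _ = setT) ?preimage_setT//.
  apply/seteqP; split=> // -[x y] _.
  have [i _ Fix] : (\bigcup_i F i) x by rewrite -TF.
  have [j _ Gjy] : (\bigcup_i G i) y by rewrite -TG.
  exists (maxn i j) => //; split => /=.
    by move: x Fix; exact/subsetPset/ndF/leq_maxl.
  by move: y Gjy; exact/subsetPset/ndG/leq_maxr.
move=> k; have [mF Fk] := Foo k; have [mG Gk] := Goo k; split.
  rewrite -[X in measurable X]setTI; apply: measurable_vuncons => //.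
  exact: measurableX.
rewrite /lebesgue_step /pushforward -comp_preimage.
rewrite (_ : @vuncons R n \o @vcons R n = id) ?preimage_id; last first.
  by apply/funext => u /=; rewrite vconsK.
by rewrite product_measure1E// lte_mul_pinfty// ge0_fin_numE.
Qed.

HB.instance Definition _ := Measure_isSigmaFinite.Build _ _ _ lebesgue_step
  lebesgue_step_sigma_finite.

End lebesgue_step.

(* Lebesgue measure on R^n: the n-fold product of the one-dimensional one. *)
Fixpoint lebesgue_vect (R : realType) (n : nat) :
    {sigma_finite_measure set (vect R n) -> \bar R} :=
  if n is n'.+1 then lebesgue_step (lebesgue_vect R n')
  else \d_([tuple] : vect R 0).

Section normal_location.
Context {R : realType} (p : nat).
Implicit Types (x y z mu : vect R p) (delta : vect R p -> vect R p).

Definition vnorm x : R := Num.sqrt (\sum_(i < p) (tnth x i : R) ^+ 2).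

Definition vsub x y : vect R p := [tuple (tnth x i : R) - tnth y i | i < p].

(* density of N_p(mu, I_p) with respect to Lebesgue measure *)
Definition normal_density mu z : R :=
  (2 * pi) `^ (- (p%:R / 2)) * expR (- (vnorm (vsub z mu) ^+ 2 / 2)).

(* expected quadratic loss of delta(Z) when Z ~ N_p(mu, I_p); it may be +oo *)
Definition risk delta mu : \bar R :=
  (\int[lebesgue_vect R p]_z
     (vnorm (vsub (delta z) mu) ^+ 2 * normal_density mu z)%:E)%E.

Definition estimator delta := measurable_fun [set: vect R p] delta.

Definition dominates delta' delta :=
  (forall mu, (risk delta' mu <= risk delta mu)%E) /\
  (exists mu, (risk delta' mu < risk delta mu)%E).

Definition admissible delta :=
  estimator delta /\
  ~ exists delta', estimator delta' /\ dominates delta' delta.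

(* Posterior mean of mu given Z = z.  The prior density prior may be improper
   and is extended-real valued, since it may be infinite at some points. *)
Definition generalized_bayes (prior : vect R p -> \bar R) z : vect R p :=
  [tuple
     fine (\int[lebesgue_vect R p]_mu
             (((tnth mu i : R) * normal_density mu z)%:E * prior mu))%E /
     fine (\int[lebesgue_vect R p]_mu ((normal_density mu z)%:E * prior mu))%E
   | i < p].

End normal_location.

Section prior.
Context {R : realType}.

(* G(r; a, L) in dimension p; it is +oo at r = 0 when the integral diverges. *)
Definition G (p : nat) (r a : R) (L : R -> R) : \bar R :=
  (\int[lebesgue_measure]_(l in `]0%R, 1%R[)
     ((l / (1 - l)) `^ (p%:R / 2) * expR (- (l / (1 - l) * (r ^+ 2 / 2)))
      * l `^ a * L l^-1)%:E)%E.

(* Functions on [1, +oo[ are represented by functions on R whose values outside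
   [1, +oo[ are irrelevant. *)
Definition slowly_varying (L : R -> R) :=
  forall c : R, 0 < c -> (L (c * y) / L y) @[y --> +oo] --> (1 : R).

Definition ultimately_nondecreasing (f : R -> R) :=
  exists y0 : R, forall x y, y0 <= x -> x <= y -> f x <= f y.

Definition ultimately_nonincreasing (f : R -> R) :=
  exists y0 : R, forall x y, y0 <= x -> x <= y -> f y <= f x.

Definition ultimately_monotone (f : R -> R) :=
  ultimately_nondecreasing f \/ ultimately_nonincreasing f.

(* differentiability at the end point 1 is one-sided *)
Definition differentiable_on_1oo (L : R -> R) :=
  (forall y : R, 1 < y -> derivable L y 1) /\
  cvg (h^-1 * (L (1 + h) - L 1) @[h --> 0^'+]).

End prior.

(* Main.v *)
Require Import Defs.
From HB Require Import structures.
From mathcomp Require Import all_boot all_order all_algebra.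
From mathcomp Require Import all_classical all_reals all_analysis.
From mathcomp Require Import measurable_realfun.
From mathcomp Require Import ring lra.

Set Implicit Arguments.
Unset Strict Implicit.
Unset Printing Implicit Defensive.

Import Order.TTheory GRing.Theory Num.Theory.
Import numFieldNormedType.Exports.

Local Open Scope classical_set_scope.
Local Open Scope ring_scope.

(* The prior is a mixture over l in ]0, 1[ of the centred normal densities with
   covariance (1 - l) / l times the identity, so the Bayes estimator is
   (1 - E(l | z)) z, the posterior density of l being proportional to
   w(l) exp(- l |z|^2 / 2) with w(l) = l^(p/2 + a) L(1/l).  Admissibility follows
   by Blyth's method: w is multiplied by q_n = h_n^2, where h_n vanishes near 0, is
   1 away from 0 and is affine in ln (- ln l) in between.  If d' dominates d, then
   integrating the risks against the (proper) truncated priors gives, by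
   Pythagoras, int m_n |d' - d_n|^2 <= int m_n |d - d_n|^2, where d_n is the Bayes
   estimator for w q_n and m_n the marginal density of z.  The right-hand side is
   O(1/n): d - d_n is governed by the posterior covariance of l and q_n, that is
   int q_n'(s) K(s) ds with K(s) the integral of (l - E(l | z)) over {l > s}, and
   0 <= K(s) <= (C / |z|^2) s w(s) exp(- s |z|^2 / 2); integrating over z then
   leaves a multiple of int l (- ln l) h_n'(l)^2 dl = 1/n, because
   L(y) = O(y^(a + 2) ln y).  Hence d' = d almost everywhere, and the risks agree. *)

(** Both cases on [a] reduce to one growth bound on L: for a > -2 it comes from Potter's bounds, for
    a = -2 from the monotonicity of ln / L. It is the critical rate for the cutoff. The integral of
    |z|^-2 exp(- x |z|^2 / 2), finite because p >= 3, leaves x^(1 - p/2), and w(x) x^(1 - p/2) is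
    then at most a multiple of (- ln x) / x; multiplied by (x h_n')^2 = 1 / (n ln x)^2 this is 1 /
    (n^2 x (- ln x)), where 1 / (x (- ln x)) is the derivative of - ln (- ln x). The condition p/2 +
    a + 1 > 0 makes w integrable at 0. The estimates on the posterior of l see w only through two
    inequalities that compare its values at different scales. The bound on K holds because l - E(l |
    z) has posterior mean 0: K(s) can be computed from either side of s, and in each regime of s
    |z|^2 one side is easy to estimate. Risks may be infinite, so they are never subtracted:
    inequalities are integrated in the extended reals, and a term is cancelled only once it is known
    to be finite. *)

Section ge0_integral_EFin.
Context d (T : measurableType d) (R : realType) (mu : {measure set T -> \bar R}).
Variables (D : set T) (mD : measurable D).
Implicit Types f g : T -> R.

Lemma ge0_integral_EFinD f g : measurable_fun D f -> measurable_fun D g ->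
  (forall x, D x -> 0 <= f x) -> (forall x, D x -> 0 <= g x) ->
  (\int[mu]_(x in D) (f x + g x)%:E =
   \int[mu]_(x in D) (f x)%:E + \int[mu]_(x in D) (g x)%:E)%E.
Proof.
move=> mf mg f0 g0; under eq_integral do rewrite EFinD.
by apply: ge0_integralD => //; try exact/measurable_EFinP; move=> x Dx; rewrite lee_fin ?f0 ?g0.
Qed.

Lemma ge0_integral_EFinZ k f : 0 <= k -> measurable_fun D f ->
  (forall x, D x -> 0 <= f x) ->
  (\int[mu]_(x in D) (k * f x)%:E = k%:E * \int[mu]_(x in D) (f x)%:E)%E.
Proof.
move=> k0 mf f0; under eq_integral do rewrite EFinM.
apply: ge0_integralZl; [exact: mD|exact/measurable_EFinP| |by rewrite lee_fin].
by move=> x Dx; rewrite lee_fin f0.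
Qed.

Lemma ge0_le_integral_EFin f g : measurable_fun D f -> measurable_fun D g ->
  (forall x, D x -> 0 <= f x) -> (forall x, D x -> f x <= g x) ->
  (\int[mu]_(x in D) (f x)%:E <= \int[mu]_(x in D) (g x)%:E)%E.
Proof.
move=> mf mg f0 fg; apply: ge0_le_integral => //.
- exact/measurable_EFinP.
- exact/measurable_EFinP.
Qed.

End ge0_integral_EFin.

Lemma ereal_half (R : realDomainType) (x : \bar R) (r : R) :
  (0 <= x)%E -> (x + x = (2 * r)%:E)%E -> x = r%:E.
Proof. by case: x => [s| |]//= _ [] h; congr (_%:E); lra. Qed.

(** * Gaussian integrals *)

Section gauss1.
Context {R : realType}.
Implicit Types b c d e x : R.
Local Notation leb := (@lebesgue_measure R).

Lemma continuous_gaussian c b : continuous (fun x => expR (- (c / 2 * (x - b) ^+ 2))).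
Proof.
move=> x; apply: (cvg_comp _ expR); last exact: continuous_expR.
apply: (@cvgN _ R^o); apply: cvgM; first exact: cvg_cst.
apply: (cvg_comp (fun x => x - b) (fun x => x ^+ 2)); last exact: sqr_continuous.
by apply: (@cvgB _ R^o); [exact: cvg_id|exact: cvg_cst].
Qed.

Lemma integral_gaussian c b : 0 < c ->
  (\int[leb]_x (expR (- (c / 2 * (x - b) ^+ 2)))%:E = ((2 * pi / c) `^ 2^-1)%:E)%E.
Proof.
move=> c0; have s0 : Num.sqrt c^-1 != 0 by rewrite gt_eqF// sqrtr_gt0 invr_gt0.
have s2 : Num.sqrt c^-1 ^+ 2 = c^-1 by rewrite sqr_sqrtr// invr_ge0 ltW.
have p0 := normal_peak_gt0 s0.
have := integral_normal_pdf b (Num.sqrt c^-1).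
have mf : measurable_fun [set: R] (EFin \o normal_fun b (Num.sqrt c^-1)).
  by apply/measurable_EFinP; exact: measurable_normal_fun.
rewrite normal_pdfE//; under eq_integral do rewrite EFinM.
rewrite ge0_integralZl//=; last 2 first.
  by move=> x _; rewrite lee_fin normal_fun_ge0.
  by rewrite lee_fin ltW.
rewrite [X in (_ * X)%E](_ : _ =
    (\int[leb]_x (expR (- (c / 2 * (x - b) ^+ 2)))%:E)%E); last first.
  apply: eq_integral => x _; congr (expR _)%:E.
  by rewrite s2; field; rewrite gt_eqF.
set I := (\int[leb]_x _)%E => h.
have -> : I = ((normal_peak (Num.sqrt c^-1))^-1%:E * (normal_peak (Num.sqrt c^-1))%:E * I)%E.
  by rewrite -EFinM mulVf ?mul1e// gt_eqF.
rewrite -muleA h mule1; congr (_%:E).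
rewrite /normal_peak invrK powR12_sqrt; last by rewrite divr_ge0 ?(ltW c0)// mulr_ge0// pi_ge0.
by congr Num.sqrt; rewrite s2; field; rewrite gt_eqF.
Qed.

Lemma ge0_integral_shift (f : R -> R) b : continuous f -> (forall x, 0 <= f x) ->
  (\int[leb]_x (f x)%:E = \int[leb]_x (f (x + b))%:E)%E.
Proof.
move=> cf f0.
have dF x : is_derive x (1:R) (fun x : R => x + b) 1.
  by apply: is_derive_eq; rewrite addr0.
have F'E : (fun x : R => x + b)^`()%classic = cst 1.
  by apply/funext => x; rewrite derive1E derive_val.
rewrite (@increasing_ge0_integration_by_substitutionT _ (fun x => x + b))//.
- by apply: eq_integral => x _; rewrite /= F'E /= mulr1.
- by move=> x y xy; rewrite ltrD2r.
- by rewrite F'E => ?; exact: cvg_cst.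
- by rewrite F'E; exact: is_cvg_cst.
- by rewrite F'E; exact: is_cvg_cst.
- exact: cvg_addrr_Ny.
- exact: cvg_addrr.
Qed.

Lemma ge0_integral_oppr (f : R -> R) : measurable_fun [set: R] f -> (forall x, 0 <= f x) ->
  (\int[leb]_x (f x)%:E = \int[leb]_x (f (- x))%:E)%E.
Proof.
move=> mf f0.
rewrite -[in RHS](@preimage_setT _ _ (-%R : measurableTypeR R -> measurableTypeR R)).
rewrite -(@ge0_integral_pushforward _ _ _ _ R (-%R : measurableTypeR R -> measurableTypeR R) _ leb setT (EFin \o f))//=.
- apply: eq_measure_integral => A mA _; apply/esym.
  exact: lebesgue_measureN.
- exact/measurable_EFinP.
- by move=> y _; rewrite lee_fin.
Qed.

(** Left unevaluated: it cancels when two risks are compared, and elsewhere finiteness and a bound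
    suffice. *)
Definition gauss_moment2 c : R :=
  fine (\int[leb]_x (x ^+ 2 * expR (- (c / 2 * x ^+ 2)))%:E)%E.

(** Half of the exponent absorbs the square: 1 + u <= exp u at u = c x^2 / 4 gives x^2 <= (4 / c)
    exp(c x^2 / 4). *)
Lemma integral_gauss_moment2_le c : 0 < c ->
  (\int[leb]_x (x ^+ 2 * expR (- (c / 2 * x ^+ 2)))%:E <=
   (4 / c * (2 * pi / (c / 2)) `^ 2^-1)%:E)%E.
Proof.
move=> c0; have c2 : 0 < c / 2 by rewrite divr_gt0.
have mg : measurable_fun [set: R] (fun x => expR (- (c / 2 / 2 * (x - 0) ^+ 2))).
  exact: (continuous_measurable_fun (@continuous_gaussian _ _)).
apply: (@le_trans _ _ (\int[leb]_x (4 / c * (expR (- (c / 2 / 2 * (x - 0) ^+ 2))))%:E)%E).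
  apply: ge0_le_integral_EFin => //.
  - apply: measurable_funM; first exact: measurable_funX.
    apply: measurableT_comp => //; apply: measurableT_comp => //.
    by apply: measurable_funM => //; exact: measurable_funX.
  - exact: measurable_funM.
  - by move=> x _; rewrite mulr_ge0// ?sqr_ge0 ?expR_ge0.
  - move=> x _; rewrite subr0.
    have -> : - (c / 2 * x ^+ 2) = - (c / 2 / 2 * x ^+ 2) + - (c / 2 / 2 * x ^+ 2) by field.
    rewrite expRD mulrA ler_pM2r ?expR_gt0// expRN ler_pdivrMr ?expR_gt0//.
    rewrite mulrAC ler_pdivlMr// [leRHS]mulrC.
    apply: le_trans (ler_wpM2r _ (expR_ge1Dx _)); last by [].
    by nra.
rewrite ge0_integral_EFinZ//.
- by rewrite integral_gaussian// -EFinM.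
- by rewrite divr_ge0// ltW.
Qed.

Lemma integral_gauss_moment2 c : 0 < c ->
  (\int[leb]_x (x ^+ 2 * expR (- (c / 2 * x ^+ 2)))%:E = (gauss_moment2 c)%:E)%E.
Proof.
move=> c0; rewrite fineK// ge0_fin_numE; last first.
  by apply: integral_ge0 => x _; rewrite lee_fin mulr_ge0// ?sqr_ge0 ?expR_ge0.
by apply: le_lt_trans (integral_gauss_moment2_le c0) _; exact: ltry.
Qed.

Lemma gauss_moment2_le c : 0 < c ->
  gauss_moment2 c <= 4 / c * (2 * pi / (c / 2)) `^ 2^-1.
Proof.
by move=> c0; rewrite -lee_fin -integral_gauss_moment2//; exact: integral_gauss_moment2_le.
Qed.

Lemma gauss_moment2_ge0 c : 0 <= gauss_moment2 c.
Proof.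
by apply/fine_ge0/integral_ge0 => x _; rewrite lee_fin mulr_ge0// ?sqr_ge0 ?expR_ge0.
Qed.

Lemma measurable_gauss_quad c d b :
  measurable_fun [set: R] (fun x => (d - x) ^+ 2 * expR (- (c / 2 * (x - b) ^+ 2))).
Proof.
apply: measurable_funM.
  by apply: measurable_funX; exact: measurable_funB.
exact: (continuous_measurable_fun (@continuous_gaussian _ _)).
Qed.

(** The cross term of the expanded square is odd. To stay with nonnegative integrands, the integral
    is added to its reflection, where (e - x)^2 + (e + x)^2 = 2 (e^2 + x^2), and the sum is
    halved. *)
Lemma integral_gauss_quad c d b : 0 < c ->
  (\int[leb]_x ((d - x) ^+ 2 * expR (- (c / 2 * (x - b) ^+ 2)))%:E =
   ((d - b) ^+ 2 * (2 * pi / c) `^ 2^-1 + gauss_moment2 c)%:E)%E.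
Proof.
move=> c0.
have shift : (\int[leb]_x ((d - x) ^+ 2 * expR (- (c / 2 * (x - b) ^+ 2)))%:E =
   \int[leb]_x ((d - b - x) ^+ 2 * expR (- (c / 2 * (x - 0) ^+ 2)))%:E)%E.
  rewrite (@ge0_integral_shift _ b).
  - apply: eq_integral => x _; congr (_ ^+ 2 * expR _)%:E; first by ring.
    by congr (- (_ * _ ^+ 2)); ring.
  - move=> x; apply: cvgM; last exact: continuous_gaussian.
    apply: (cvg_comp (fun x => d - x) (fun x => x ^+ 2)); last exact: sqr_continuous.
    by apply: (@cvgB _ R^o); [exact: cvg_cst|exact: cvg_id].
  - by move=> x; rewrite mulr_ge0// ?sqr_ge0 ?expR_ge0.
rewrite shift; set e := d - b.
set S := (\int[leb]_x _)%E.
have S0 : (0 <= S)%E.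
  by apply: integral_ge0 => x _; rewrite lee_fin mulr_ge0// ?sqr_ge0 ?expR_ge0.
have SN : (S = \int[leb]_x ((e + x) ^+ 2 * expR (- (c / 2 * (x - 0) ^+ 2)))%:E)%E.
  rewrite /S ge0_integral_oppr.
  - apply: eq_integral => x _; rewrite opprK; congr (_ * expR _)%:E; ring.
  - exact: measurable_gauss_quad.
  - by move=> x; rewrite mulr_ge0// ?sqr_ge0 ?expR_ge0.
pose g x := expR (- (c / 2 * (x - 0) ^+ 2)).
have mg : measurable_fun [set: R] g.
  exact: (continuous_measurable_fun (@continuous_gaussian _ _)).
have g0 x : [set: R] x -> 0 <= g x by move=> _; exact: expR_ge0.
have mx2 : measurable_fun [set: R] (fun x : R => x ^+ 2) by exact: measurable_funX.
have mg1 : measurable_fun [set: R] (fun x => e ^+ 2 * g x) by exact: measurable_funM.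
have mg2 : measurable_fun [set: R] (fun x => x ^+ 2 * g x) by exact: measurable_funM.
have g10 x : [set: R] x -> 0 <= e ^+ 2 * g x by move=> _; rewrite mulr_ge0 ?sqr_ge0 ?g0.
have g20 x : [set: R] x -> 0 <= x ^+ 2 * g x by move=> _; rewrite mulr_ge0 ?sqr_ge0 ?g0.
have g30 x : [set: R] x -> 0 <= e ^+ 2 * g x + x ^+ 2 * g x.
  by move=> _; rewrite addr_ge0 ?g10 ?g20.
have mg3 : measurable_fun [set: R] (fun x => e ^+ 2 * g x + x ^+ 2 * g x).
  exact: measurable_funD.
have mg4 : measurable_fun [set: R] (fun x => (e + x) ^+ 2 * g x).
  by apply: measurable_funM => //; apply: measurable_funX; exact: measurable_funD.
have g40 x : [set: R] x -> 0 <= (e - x) ^+ 2 * g x by move=> _; rewrite mulr_ge0 ?sqr_ge0 ?g0.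
have g50 x : [set: R] x -> 0 <= (e + x) ^+ 2 * g x by move=> _; rewrite mulr_ge0 ?sqr_ge0 ?g0.
have : (S + S = (2 * (e ^+ 2 * (2 * pi / c) `^ 2^-1 + gauss_moment2 c))%:E)%E.
  rewrite {2}SN /S.
  rewrite -(ge0_integral_EFinD leb measurableT (@measurable_gauss_quad _ _ _) mg4 g40 g50).
  transitivity (\int[leb]_x (2 * (e ^+ 2 * g x + x ^+ 2 * g x))%:E)%E.
    by apply: eq_integral => x _; congr (_%:E); rewrite /g; ring.
  rewrite (ge0_integral_EFinZ leb measurableT (ler0n R 2) mg3 g30).
  rewrite (ge0_integral_EFinD leb measurableT mg1 mg2 g10 g20).
  rewrite (ge0_integral_EFinZ leb measurableT (sqr_ge0 e) mg g0).
  rewrite integral_gaussian// [X in (_ + X)%E](_ : _ = (gauss_moment2 c)%:E)%E//.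
  by rewrite -(integral_gauss_moment2 c0); apply: eq_integral => x _; rewrite /g subr0.
exact: ereal_half.
Qed.

End gauss1.

(** * Product integrals and Gaussian integrals on R^n *)

Section vect_integral.
Context {R : realType}.
Local Notation leb := (@lebesgue_measure R).

Lemma measurable_vect_prod n (f : 'I_n -> R -> R) :
  (forall i, measurable_fun [set: R] (f i)) ->
  measurable_fun [set: vect R n] (fun x : vect R n => \prod_(i < n) f i (tnth x i)).
Proof.
move=> mf; apply: measurable_prod => i _.
by apply: (measurableT_comp (mf i)); exact: measurable_tnth.
Qed.

Lemma integral_vectS n (f : vect R n.+1 -> \bar R) :
  measurable_fun [set: vect R n.+1] f -> (forall x, 0 <= f x)%E ->
  (\int[lebesgue_vect R n.+1]_x f x =
   \int[leb]_a \int[lebesgue_vect R n]_x f (vcons (a, x)))%E.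
Proof.
move=> mf f0.
transitivity (\int[leb \x lebesgue_vect R n]_u (f (vcons u)))%E.
  rewrite -[in RHS](@preimage_setT _ _ (@vcons R n)).
  rewrite -(@ge0_integral_pushforward _ _ _ _ R (@vcons R n) (@measurable_vcons R n) (leb \x lebesgue_vect R n)%E setT f)//.
rewrite (fubini_tonelli1 (f \o @vcons R n))//.
- exact: measurableT_comp (@measurable_vcons R n).
- by move=> x; exact: f0.
Qed.

Lemma integral_vect_prod n (f : 'I_n -> R -> R) (r : 'I_n -> R) :
  (forall i, measurable_fun [set: R] (f i)) ->
  (forall i x, 0 <= f i x) ->
  (forall i, \int[leb]_x (f i x)%:E = (r i)%:E)%E ->
  (\int[lebesgue_vect R n]_x (\prod_(i < n) f i (tnth x i))%:E = (\prod_(i < n) r i)%:E)%E.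
Proof.
elim: n f r => [|n ih] f r mf f0 fr.
  rewrite /= big_ord0 (eq_integral (cst 1%:E)); last by move=> x _; rewrite big_ord0.
  by rewrite integral_cst//= diracT mule1.
rewrite integral_vectS; last 2 first.
  - by apply/measurable_EFinP; exact: measurable_vect_prod.
  - by move=> x; rewrite lee_fin prodr_ge0.
have step a : (\int[lebesgue_vect R n]_x (\prod_(i < n.+1) f i (tnth (vcons (a, x)) i))%:E =
    (f ord0 a * \prod_(i < n) r (lift ord0 i))%:E)%E.
  rewrite EFinM -(ih (fun i => f (lift ord0 i)))//.
  rewrite -(ge0_integral_EFinZ (lebesgue_vect R n) measurableT (f0 _ a))//.
  - apply: eq_integral => x _; rewrite big_ord_recl tnth0.
    by congr (_ * _)%:E; apply: eq_bigr => i _; rewrite tnthS.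
  - exact: (@measurable_vect_prod n (fun i => f (lift ord0 i))).
  - by move=> x _; rewrite prodr_ge0.
under eq_integral do rewrite step.
have r0 i : 0 <= r i.
  by rewrite -lee_fin -fr; apply: integral_ge0 => x _; rewrite lee_fin.
rewrite big_ord_recl mulrC EFinM -(fr ord0).
rewrite -(ge0_integral_EFinZ leb measurableT _ (mf ord0))//.
- by apply: eq_integral => x _; rewrite mulrC.
- exact: prodr_ge0.
Qed.

(** Squared distance without the square root of [vnorm]: being a sum over coordinates, it has a
    product as exponential, which is integrated coordinate by coordinate. *)
Definition vsqd n (x y : vect R n) : R := \sum_(i < n) ((tnth x i : R) - tnth y i) ^+ 2.

Lemma vsqd_ge0 n (x y : vect R n) : 0 <= vsqd x y.
Proof. by apply: sumr_ge0 => i _; exact: sqr_ge0. Qed.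

Lemma measurable_vsqd d (T : measurableType d) n (f g : T -> vect R n) D :
  measurable_fun D f -> measurable_fun D g -> measurable_fun D (fun x => vsqd (f x) (g x)).
Proof.
move=> mf mg; apply: measurable_sum => i; apply: measurable_funX.
by apply: measurable_funB; apply: (measurableT_comp (measurable_tnth i)).
Qed.

Lemma expR_vsqd n c (x y : vect R n) :
  expR (- (c / 2 * vsqd x y)) =
  \prod_(i < n) expR (- (c / 2 * ((tnth x i : R) - tnth y i) ^+ 2)).
Proof. by rewrite /vsqd mulr_sumr -sumrN expR_sum. Qed.

Lemma measurable_expR_vsqd n c (b : vect R n) :
  measurable_fun [set: vect R n] (fun x => expR (- (c / 2 * vsqd x b))).
Proof.
apply: measurableT_comp => //; apply: measurableT_comp => //.
by apply: measurable_funM => //; exact: measurable_vsqd.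
Qed.

Lemma integral_vgauss n c (b : vect R n) : 0 < c ->
  (\int[lebesgue_vect R n]_x (expR (- (c / 2 * vsqd x b)))%:E =
   ((2 * pi / c) `^ (n%:R / 2))%:E)%E.
Proof.
move=> c0; under eq_integral do rewrite expR_vsqd.
rewrite (@integral_vect_prod n (fun i a => expR (- (c / 2 * (a - tnth b i) ^+ 2)))
  (fun=> (2 * pi / c) `^ 2^-1)).
- by rewrite prodr_const card_ord -powR_mulrn ?powR_ge0// -powRrM [2^-1 * _]mulrC.
- by move=> i; exact: (continuous_measurable_fun (@continuous_gaussian _ _ _)).
- by move=> i x; exact: expR_ge0.
- by move=> i; exact: integral_gaussian.
Qed.

Lemma integral_vgauss_quad n c (d b : vect R n) : 0 < c ->
  (\int[lebesgue_vect R n]_x (vsqd d x * expR (- (c / 2 * vsqd x b)))%:E =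
   ((2 * pi / c) `^ (n%:R / 2) *
    (vsqd d b + n%:R * (gauss_moment2 c / (2 * pi / c) `^ 2^-1)))%:E)%E.
Proof.
move=> c0; set I := (2 * pi / c) `^ 2^-1.
have I0 : 0 < I by rewrite powR_gt0// divr_gt0// mulr_gt0// pi_gt0.
have In : (2 * pi / c) `^ (n%:R / 2) = I ^+ n.
  by rewrite /I -powR_mulrn ?powR_ge0// -powRrM [2^-1 * _]mulrC.
(* The j-th term of [vsqd d x] times the Gaussian is a product over the coordinates whose quadratic
   factor sits at position j. *)
pose F j (i : 'I_n) (a : R) := (if i == j then (tnth d i - a) ^+ 2 else 1) *
  expR (- (c / 2 * (a - tnth b i) ^+ 2)).
have mF j i : measurable_fun [set: R] (F j i).
  apply: measurable_funM; last exact: (continuous_measurable_fun (@continuous_gaussian _ _ _)).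
  by case: eqP => // _; apply: measurable_funX; exact: measurable_funB.
have F0 j i a : 0 <= F j i a.
  by rewrite mulr_ge0 ?expR_ge0//; case: eqP => // _; exact: sqr_ge0.
have E j : (\int[lebesgue_vect R n]_x (\prod_(i < n) F j i (tnth x i))%:E =
   (I ^+ n * ((tnth d j - tnth b j) ^+ 2 + gauss_moment2 c / I))%:E)%E.
  rewrite (@integral_vect_prod n (F j)
    (fun i => if i == j then (tnth d j - tnth b j) ^+ 2 * I + gauss_moment2 c else I))//.
    congr (_%:E); rewrite (bigD1 j)//= eqxx (eq_bigr (fun=> I)); last first.
      by move=> i /negbTE ->.
    have -> : I ^+ n = I * \prod_(i < n | i != j) I.
      transitivity (\prod_(i < n) I); first by rewrite prodr_const card_ord.
      by rewrite (bigD1 j).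
    by field; rewrite gt_eqF.
  move=> i; rewrite /F; case: eqP => [->|_]; first exact: integral_gauss_quad.
  by under eq_integral do rewrite mul1r; exact: integral_gaussian.
transitivity (\int[lebesgue_vect R n]_x (\sum_(j < n) (\prod_(i < n) F j i (tnth x i))%:E))%E.
  apply: eq_integral => x _; rewrite sumEFin /vsqd mulr_suml; congr (_%:E).
  apply: eq_bigr => j _; rewrite big_split/= -expR_vsqd; congr (_ * _).
  by rewrite (bigD1 j)//= eqxx big1 ?mulr1// => i /negbTE ->.
rewrite ge0_integral_sum//.
- under eq_bigr do rewrite E.
  rewrite sumEFin In; congr (_%:E).
  by rewrite -mulr_sumr big_split/= sumr_const card_ord mulr_natl.
- by move=> j; apply/measurable_EFinP; exact: (measurable_vect_prod (mF j)).
- by move=> j x _; rewrite lee_fin prodr_ge0.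
Qed.

End vect_integral.

(** * Risk averaged over one component of the mixture *)

Section gauss_mixture.
Context {R : realType} (p : nat).
Local Notation leb := (@lebesgue_measure R).
Local Notation lebv := (lebesgue_vect R p).
Implicit Types (z mu : vect R p) (l : R).

Definition vsqn z : R := \sum_(i < p) (tnth z i : R) ^+ 2.

Definition vscale (k : R) z : vect R p := [tuple k * (tnth z i : R) | i < p].

Lemma vsqn_ge0 z : 0 <= vsqn z.
Proof. by apply: sumr_ge0 => i _; exact: sqr_ge0. Qed.

Lemma vnorm_sqr z : vnorm z ^+ 2 = vsqn z.
Proof. by rewrite /vnorm sqr_sqrtr// vsqn_ge0. Qed.

Lemma vnorm_vsub_sqr (x y : vect R p) : vnorm (vsub x y) ^+ 2 = vsqd x y.
Proof. by rewrite vnorm_sqr; apply: eq_bigr => i _; rewrite tnth_mktuple. Qed.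

Lemma vsqd_scale k k' z : vsqd (vscale k z) (vscale k' z) = (k - k') ^+ 2 * vsqn z.
Proof.
rewrite /vsqd /vsqn mulr_sumr; apply: eq_bigr => i _.
by rewrite !tnth_mktuple; ring.
Qed.

Lemma measurable_vsqn : measurable_fun [set: vect R p] vsqn.
Proof.
by apply: measurable_sum => i; apply: measurable_funX; exact: measurable_tnth.
Qed.

Lemma measurable_vscale d (T : measurableType d) (k : T -> R) (f : T -> vect R p) :
  measurable_fun setT k -> measurable_fun setT f ->
  measurable_fun setT (fun x => vscale (k x) (f x)).
Proof.
move=> mk mf; apply/measurable_fun_tnthP => i.
rewrite (_ : _ \o _ = fun x => k x * (tnth (f x) i : R)).
  by apply: measurable_funM => //; apply: (measurableT_comp (measurable_tnth i)).
by apply/funext => x /=; rewrite tnth_mktuple.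
Qed.

Lemma normal_density_mix l mu z : l < 1 ->
  normal_density mu z * expR (- (l / (1 - l) * (vnorm mu ^+ 2 / 2))) =
  (2 * pi) `^ (- (p%:R / 2)) * expR (- (l / 2 * vsqn z)) *
  expR (- ((1 - l)^-1 / 2 * vsqd mu (vscale (1 - l) z))).
Proof.
move=> l1; rewrite /normal_density vnorm_vsub_sqr vnorm_sqr -!mulrA; congr (_ * _).
rewrite -!expRD; congr expR; rewrite -!opprD; congr (- _).
rewrite /vsqd /vsqn !mulr_suml !mulr_sumr -!big_split/=; apply: eq_bigr => i _.
by rewrite tnth_mktuple; field; rewrite subr_eq0 gt_eqF.
Qed.

Lemma normal_density_ge0 mu z : 0 <= normal_density mu z.
Proof. by rewrite mulr_ge0 ?powR_ge0 ?expR_ge0. Qed.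

Lemma measurable_normal_density d (T : measurableType d) D (f g : T -> vect R p) :
  measurable_fun D f -> measurable_fun D g ->
  measurable_fun D (fun x => normal_density (f x) (g x)).
Proof.
move=> mf mg; apply: measurable_funM => //; apply: measurableT_comp => //.
apply: measurableT_comp => //; apply: measurable_funM => //.
under eq_fun do rewrite vnorm_vsub_sqr; exact: measurable_vsqd.
Qed.

(** Trace of the covariance of mu given z and l, that is p (1 - l) for l < 1, written with the
    normalised second moment of a Gaussian. *)
Definition post_var l : R :=
  p%:R * (gauss_moment2 (1 - l)^-1 / (2 * pi / (1 - l)^-1) `^ 2^-1).

Lemma post_var_ge0 l : 0 <= post_var l.
Proof. by rewrite mulr_ge0// divr_ge0 ?gauss_moment2_ge0 ?powR_ge0. Qed.

Lemma gauss_const l : l < 1 ->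
  (2 * pi) `^ (- (p%:R / 2)) * (2 * pi / (1 - l)^-1) `^ (p%:R / 2) = (1 - l) `^ (p%:R / 2).
Proof.
move=> l1; have l0 : 0 <= 1 - l by rewrite subr_ge0 ltW.
have pi2 : 0 < 2 * pi :> R by rewrite mulr_gt0// pi_gt0.
rewrite invrK [X in _ * X]powRM ?(ltW pi2)// mulrA -powRD; last by rewrite (gt_eqF pi2) implybT.
by rewrite addNr powRr0 mul1r.
Qed.

(** Squared bias plus variance under the normal law found in [normal_density_mix]. *)
Lemma integral_mix_quad l (d z : vect R p) : l < 1 ->
  (\int[lebv]_mu (vsqd d mu * (normal_density mu z *
     expR (- (l / (1 - l) * (vnorm mu ^+ 2 / 2)))))%:E =
  ((1 - l) `^ (p%:R / 2) * expR (- (l / 2 * vsqn z)) *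
    (vsqd d (vscale (1 - l) z) + post_var l))%:E)%E.
Proof.
move=> l1; have l0 : 0 < (1 - l)^-1 by rewrite invr_gt0 subr_gt0.
transitivity (\int[lebv]_mu ((2 * pi) `^ (- (p%:R / 2)) * expR (- (l / 2 * vsqn z)) *
   (vsqd d mu * expR (- ((1 - l)^-1 / 2 * vsqd mu (vscale (1 - l) z)))))%:E)%E.
  by apply: eq_integral => mu _; rewrite normal_density_mix//; congr (_%:E); ring.
rewrite ge0_integral_EFinZ//.
- rewrite integral_vgauss_quad// -EFinM -gauss_const// /post_var; congr (_%:E); ring.
- by rewrite mulr_ge0 ?powR_ge0 ?expR_ge0.
- apply: measurable_funM; last exact: measurable_expR_vsqd.
  exact: measurable_vsqd.
- by move=> mu _; rewrite mulr_ge0 ?expR_ge0 ?vsqd_ge0.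
Qed.

Lemma integral_mix l z : l < 1 ->
  (\int[lebv]_mu (normal_density mu z *
     expR (- (l / (1 - l) * (vnorm mu ^+ 2 / 2))))%:E =
  ((1 - l) `^ (p%:R / 2) * expR (- (l / 2 * vsqn z)))%:E)%E.
Proof.
move=> l1; have l0 : 0 < (1 - l)^-1 by rewrite invr_gt0 subr_gt0.
under eq_integral do rewrite normal_density_mix//.
rewrite ge0_integral_EFinZ//.
- rewrite integral_vgauss// -EFinM -gauss_const//; congr (_%:E); ring.
- by rewrite mulr_ge0 ?powR_ge0 ?expR_ge0.
- exact: measurable_expR_vsqd.
Qed.

Lemma integral_expR_vsqn c : 0 < c ->
  (\int[lebv]_z (expR (- (c / 2 * vsqn z)))%:E = ((2 * pi / c) `^ (p%:R / 2))%:E)%E.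
Proof.
move=> c0; rewrite -(integral_vgauss (vscale 0 point) c0).
apply: eq_integral => z _; congr (expR (- (_ * _)))%:E.
by apply: eq_bigr => i _; rewrite tnth_mktuple mul0r subr0.
Qed.

Lemma integral_vsqn_expR c : 0 < c ->
  (\int[lebv]_z (vsqn z * expR (- (c / 2 * vsqn z)))%:E < +oo)%E.
Proof.
move=> c0; have E z : vsqn z = vsqd z (vscale 0 point).
  by apply: eq_bigr => i _; rewrite tnth_mktuple mul0r subr0.
have E' z : vsqn z = vsqd (vscale 0 point) z.
  by apply: eq_bigr => i _; rewrite tnth_mktuple mul0r sub0r sqrrN.
under eq_integral do rewrite {1}E' E.
by rewrite integral_vgauss_quad// ltry.
Qed.

Lemma measurable_expR_vsqn c :
  measurable_fun [set: vect R p] (fun z => expR (- (c / 2 * vsqn z))).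
Proof.
apply: measurableT_comp => //; apply: measurableT_comp => //.
by apply: measurable_funM => //; exact: measurable_vsqn.
Qed.

(** Tonelli integrates mu out first, which leaves the loss at the component posterior mean (1 - l) z
    and a term free of [d]. The identity lives in the extended reals, since the risk may be
    infinite. *)
Lemma bayes_risk_mix (d : vect R p -> vect R p) l : measurable_fun setT d -> 0 < l < 1 ->
  (\int[lebv]_mu ((expR (- (l / (1 - l) * (vnorm mu ^+ 2 / 2))))%:E * risk d mu) =
   ((1 - l) `^ (p%:R / 2))%:E *
   (\int[lebv]_z (expR (- (l / 2 * vsqn z)) * vsqd (d z) (vscale (1 - l) z))%:E +
    ((2 * pi / l) `^ (p%:R / 2) * post_var l)%:E))%E.
Proof.
move=> md /andP[l0 l1].
pose F (u : vect R p * vect R p) : \bar R := (vsqd (d u.2) u.1 * (normal_density u.1 u.2 *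
     expR (- (l / (1 - l) * (vnorm u.1 ^+ 2 / 2)))))%:E.
have me d' (T : measurableType d') (f : T -> vect R p) : measurable_fun setT f ->
   measurable_fun setT (fun u => expR (- (l / (1 - l) * (vnorm (f u) ^+ 2 / 2)))).
  move=> mf; apply: measurableT_comp => //; apply: measurableT_comp => //.
  apply: measurable_funM => //; apply: measurable_funM => //.
  under eq_fun do rewrite vnorm_sqr; exact: (measurableT_comp measurable_vsqn).
have F0 u : (0 <= F u)%E.
  by rewrite lee_fin mulr_ge0 ?vsqd_ge0// mulr_ge0 ?normal_density_ge0 ?expR_ge0.
have mF : measurable_fun setT F.
  apply/measurable_EFinP; apply: measurable_funM.
    by apply: measurable_vsqd => //; apply: measurableT_comp.
  apply: measurable_funM; last exact: me.
  exact: measurable_normal_density.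
transitivity (\int[lebv]_mu \int[lebv]_z F (mu, z))%E.
  apply: eq_integral => mu _; rewrite /risk /F/= -ge0_integralZl//.
  - by apply: eq_integral => z _; rewrite vnorm_vsub_sqr -EFinM; congr (_%:E); ring.
  - apply/measurable_EFinP; apply: measurable_funM.
      by under eq_fun do rewrite vnorm_vsub_sqr; exact: measurable_vsqd.
    exact: measurable_normal_density.
  - by move=> z _; rewrite lee_fin mulr_ge0 ?sqr_ge0 ?normal_density_ge0.
rewrite fubini_tonelli//.
transitivity (\int[lebv]_z ((1 - l) `^ (p%:R / 2) *
  (expR (- (l / 2 * vsqn z)) * vsqd (d z) (vscale (1 - l) z) +
   post_var l * expR (- (l / 2 * vsqn z))))%:E)%E.
  by apply: eq_integral => z _; rewrite /F/= integral_mix_quad//; congr (_%:E); ring.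
have ml : measurable_fun setT (fun z : vect R p => vscale (1 - l) z).
  exact: measurable_vscale.
have m1 : measurable_fun setT (fun z : vect R p =>
    expR (- (l / 2 * vsqn z)) * vsqd (d z) (vscale (1 - l) z)).
  by apply: measurable_funM; [exact: measurable_expR_vsqn|exact: measurable_vsqd].
have m2 : measurable_fun setT (fun z : vect R p => post_var l * expR (- (l / 2 * vsqn z))).
  by apply: measurable_funM => //; exact: measurable_expR_vsqn.
have f1 z : [set: vect R p] z -> 0 <= expR (- (l / 2 * vsqn z)) * vsqd (d z) (vscale (1 - l) z).
  by rewrite mulr_ge0 ?vsqd_ge0 ?expR_ge0.
have f2 z : [set: vect R p] z -> 0 <= post_var l * expR (- (l / 2 * vsqn z)).
  by rewrite mulr_ge0 ?post_var_ge0 ?expR_ge0.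
rewrite (ge0_integral_EFinZ lebv measurableT (powR_ge0 _ _) (measurable_funD m1 m2)); last first.
  by move=> z _; rewrite addr_ge0 ?f1 ?f2.
rewrite (ge0_integral_EFinD lebv measurableT m1 m2 f1 f2); congr (_ * (_ + _))%E.
rewrite (ge0_integral_EFinZ lebv measurableT (post_var_ge0 l) (measurable_expR_vsqn l)).
  by rewrite integral_expR_vsqn// -EFinM mulrC.
by move=> z _; exact: expR_ge0.
Qed.

Lemma measurable_risk (d : vect R p -> vect R p) : measurable_fun setT d ->
  measurable_fun setT (risk d).
Proof.
move=> md; pose F (u : vect R p * vect R p) : \bar R :=
  (vsqd (d u.2) u.1 * normal_density u.1 u.2)%:E.
rewrite (_ : risk d = fun mu => \int[lebv]_z F (mu, z))%E; last first.
  by apply/funext => mu; apply: eq_integral => z _; rewrite vnorm_vsub_sqr.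
apply: measurable_fun_fubini_tonelli_F.
  apply/measurable_EFinP; apply: measurable_funM.
    by apply: measurable_vsqd => //; apply: measurableT_comp.
  exact: measurable_normal_density.
by move=> u; rewrite lee_fin mulr_ge0 ?vsqd_ge0 ?normal_density_ge0.
Qed.

Lemma risk_ge0 (d : vect R p -> vect R p) mu : (0 <= risk d mu)%E.
Proof.
by apply: integral_ge0 => z _; rewrite lee_fin mulr_ge0 ?sqr_ge0 ?normal_density_ge0.
Qed.

(* The posterior variance of mu given z and l does not involve the estimator and
   its integral over z is finite, so it cancels. *)
Lemma le_risk_mix (d d' : vect R p -> vect R p) l :
  measurable_fun setT d -> measurable_fun setT d' ->
  (forall mu, risk d' mu <= risk d mu)%E -> 0 < l < 1 ->
  (\int[lebv]_z (expR (- (l / 2 * vsqn z)) * vsqd (d' z) (vscale (1 - l) z))%:E <=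
   \int[lebv]_z (expR (- (l / 2 * vsqn z)) * vsqd (d z) (vscale (1 - l) z))%:E)%E.
Proof.
move=> md md' dd l01.
have K0 : 0 < (1 - l) `^ (p%:R / 2) by rewrite powR_gt0// subr_gt0; case/andP: l01.
have : (\int[lebv]_mu ((expR (- (l / (1 - l) * (vnorm mu ^+ 2 / 2))))%:E * risk d' mu) <=
  \int[lebv]_mu ((expR (- (l / (1 - l) * (vnorm mu ^+ 2 / 2))))%:E * risk d mu))%E.
  have me : measurable_fun setT (fun mu : vect R p =>
      (expR (- (l / (1 - l) * (vnorm mu ^+ 2 / 2))))%:E).
    apply/measurable_EFinP; apply: measurableT_comp => //; apply: measurableT_comp => //.
    apply: measurable_funM => //; apply: measurable_funM => //.
    by under eq_fun do rewrite vnorm_sqr; exact: measurable_vsqn.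
  apply: ge0_le_integral => //.
  - by move=> mu _; rewrite mule_ge0 ?risk_ge0// lee_fin expR_ge0.
  - by apply: emeasurable_funM => //; exact: measurable_risk.
  - by apply: emeasurable_funM => //; exact: measurable_risk.
  - by move=> mu _; rewrite lee_pmul2l// lte_fin expR_gt0.
rewrite !bayes_risk_mix// lee_pmul2l//.
by rewrite leeD2rE.
Qed.

End gauss_mixture.

(** * Integrals on the line *)

Section ftc_is_derive.
Context {R : realType}.
Local Notation leb := (@lebesgue_measure R).
Implicit Types (f F : R -> R) (a b x : R).

Lemma is_derive_continuous F x (dF : R) : is_derive x 1 F dF -> {for x, continuous F}.
Proof.
by move=> h; apply: differentiable_continuous; apply/derivable1_diffP; exact: ex_derive.
Qed.

Lemma integral_is_derive f F a b : a <= b ->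
  (forall x, a <= x <= b -> is_derive x 1 F (f x)) ->
  (forall x, a <= x <= b -> {for x, continuous f}) ->
  (\int[leb]_(x in `[a, b]) (f x)%:E = (F b - F a)%:E)%E.
Proof.
rewrite le_eqVlt => /predU1P[<- _ _|ab dF cf].
  by rewrite set_itv1 integral_set1 subrr.
have ala : a <= a <= b by rewrite lexx ltW.
have alb : a <= b <= b by rewrite lexx ltW.
rewrite (@continuous_FTC2 _ f F)// ?EFinB//.
- by apply: continuous_in_subspaceT => x; rewrite inE/= in_itv/= => /cf.
- split.
  + move=> x; rewrite in_itv/= => /andP[ax xb].
    by have /dF : a <= x <= b by rewrite !ltW.
  + apply: cvg_at_right_filter; exact: is_derive_continuous (dF a ala).
  + apply: cvg_at_left_filter; exact: is_derive_continuous (dF b alb).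
- move=> x; rewrite in_itv/= => /andP[ax xb].
  have axb : a <= x <= b by rewrite !ltW.
  by rewrite derive1E; have := dF x axb => h; rewrite derive_val.
Qed.

Lemma ge0_integral_is_derivey f F a l :
  (forall x, a <= x -> 0 <= f x) ->
  (forall x, a <= x -> is_derive x 1 F (f x)) ->
  (forall x, a <= x -> {for x, continuous f}) ->
  F x @[x --> +oo] --> l ->
  (\int[leb]_(x in `[a, +oo[) (f x)%:E = (l - F a)%:E)%E.
Proof.
move=> f0 dF cf Fl; rewrite (@ge0_continuous_FTC2y _ f F a l)//.
- by apply: continuous_in_subspaceT => x; rewrite inE/= in_itv/= andbT => /cf.
- by move=> x /ltW /dF.
- by apply: cvg_at_right_filter; exact: is_derive_continuous (dF a (lexx a)).
- move=> x; rewrite in_itv/= andbT => /ltW ax.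
  by rewrite derive1E; have := dF x ax => h; rewrite derive_val.
Qed.

(** End points are null sets: both sides are reduced to the open interval. *)
Lemma integral_natr_itv f a b : measurable_fun `]a, b[ f ->
  (\int[leb]_x ((a < x <= b)%R%:R * f x)%:E = \int[leb]_(x in `[a, b]) (f x)%:E)%E.
Proof.
move=> mf; have mE : measurable_fun `]a, b[ (EFin \o f) by exact/measurable_EFinP.
rewrite (integral_itv_bndoo true false mE) -(integral_itv_bndoo false false mE).
rewrite [RHS]integral_mkcond; apply: eq_integral => x _.
by rewrite patchE mem_setE in_itv/=; case: ifP => _; rewrite ?mul1r ?mul0r.
Qed.

Lemma integral_expR_tail (c s : R) : 0 < c ->
  (\int[leb]_(x in `[s, +oo[) (expR (- (c * x)))%:E = (c^-1 * expR (- (c * s)))%:E)%E.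
Proof.
move=> c0.
have dF x : s <= x ->
    is_derive x (1:R) (fun x : R => - (c^-1 * expR (- (c * x)))) (expR (- (c * x))).
  by move=> _; apply: is_derive_eq; rewrite /GRing.scale/=; field; rewrite gt_eqF.
have cf x : s <= x -> {for x, continuous (fun x : R => expR (- (c * x)))}.
  move=> _; apply: (cvg_comp _ expR); last exact: continuous_expR.
  by apply: (@cvgN _ R^o); apply: cvgM; [exact: cvg_cst|exact: cvg_id].
have Fl : - (c^-1 * expR (- (c * x))) @[x --> +oo] --> (0:R).
  rewrite -[X in _ --> X]oppr0 -[X in - X](mulr0 c^-1); apply: (@cvgN _ R^o).
  apply: cvgM; first exact: cvg_cst.
  apply: (cvg_comp (fun x => c * x) (fun x => expR (- x))); last exact: cvgr_expR.
  by apply: gt0_cvgMry => //; exact: cvg_id.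
rewrite (ge0_integral_is_derivey _ dF cf Fl) ?sub0r ?opprK//.
Qed.

Lemma cvgr_ln : ln x @[x --> +oo] --> (+oo : set_system R).
Proof.
apply/cvgryPge => A; near=> x; rewrite -[leLHS]expRK ler_ln ?posrE ?expR_gt0//.
Unshelve. all: by end_near. Qed.

Lemma cvg_powRN r : 0 < r -> (x `^ (- r) @[x --> +oo] --> (0:R)).
Proof.
move=> r0; have : (fun x : R => expR (- (r * ln x))) @ +oo --> (0:R).
  apply: (cvg_comp (fun x => r * ln x) (fun x => expR (- x))); last exact: cvgr_expR.
  by apply: gt0_cvgMry => //; exact: cvgr_ln.
apply: cvg_trans; apply: near_eq_cvg; near=> x.
by rewrite /powR gt_eqF ?mulNr.
Unshelve. all: by end_near. Qed.

Lemma integral_powR_tail x r : 0 < x -> 0 < r ->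
  (\int[leb]_(u in `[0%R, +oo[) ((x + u) `^ (- (r + 1)))%:E = (x `^ (- r) / r)%:E)%E.
Proof.
move=> x0 r0.
have xu u : 0 <= u -> 0 < x + u by move=> u0; rewrite ltr_pwDl.
have dP (u s : R) : 0 <= u -> is_derive u (1:R) (fun u => (x + u) `^ s) (s * (x + u) `^ (s - 1)).
  move=> u0; have h := is_derive1_powR s (xu u u0).
  apply: is_derive_eq; first exact: (@is_derive1_comp _ (fun y => y `^ s) (fun u => x + u)).
  by rewrite add0r !mulr1.
have dF (u : R) : 0 <= u ->
    is_derive u (1:R) (fun u => - ((x + u) `^ (- r) / r)) ((x + u) `^ (- (r + 1))).
  move=> u0; have h := dP u (- r) u0.
  by apply: is_derive_eq; rewrite /GRing.scale/= -opprD; field; rewrite gt_eqF.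
have cf (u : R) : 0 <= u -> {for u, continuous (fun u => (x + u) `^ (- (r + 1)))}.
  by move=> u0; exact: is_derive_continuous (dP u _ u0).
have Fl : - ((x + u) `^ (- r) / r) @[u --> +oo] --> (0:R).
  rewrite [X in _ --> X](_ : _ = - (0 * r^-1)); last by rewrite mul0r oppr0.
  apply: (@cvgN _ R^o).
  apply: cvgM; last exact: cvg_cst.
  apply: (cvg_comp (fun u => x + u) (fun y => y `^ (- r))); last exact: cvg_powRN.
  exact: cvg_addrl.
rewrite (ge0_integral_is_derivey _ dF cf Fl) ?sub0r ?opprK ?addr0//.
by move=> u _; exact: powR_ge0.
Qed.

End ftc_is_derive.

Section indicator_integral.
Context {R : realType}.
Local Notation leb := (@lebesgue_measure R).

Lemma integral_indic_le (c s s' : R) : 0 <= c -> s <= s' ->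
  (\int[leb]_x ((s < x <= s')%R%:R * c)%:E = (c * (s' - s))%:E)%E.
Proof.
move=> c0 ss'; transitivity (\int[leb]_x (c * (\1_`]s, s'] x))%:E)%E.
  by apply: eq_integral => x _; rewrite mulrC indicE mem_setE in_itv.
rewrite ge0_integral_EFinZ//.
rewrite integral_indic//= setIT lebesgue_measure_itv/= lte_fin.
case: ltP => [_|h]; first by rewrite -EFinB -EFinM.
by rewrite mule0 (_ : s' - s = 0) ?mulr0//; apply/eqP; rewrite subr_eq0 eq_le ss' h.
Qed.

End indicator_integral.

(** * Measurability of indicators, powers and inverses *)

Section measurable_bool.
Context d (T : measurableType d) (R : realType).

Lemma measurable_natr (b : T -> bool) : measurable_fun setT b ->
  measurable_fun setT (fun x => (b x)%:R : R).
Proof.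
move=> mb; rewrite (_ : (fun x => _) = fun x => if b x then 1 else 0 : R).
  exact: measurable_fun_ifT.
by apply/funext => x; case: (b x).
Qed.

Lemma measurable_lt_natr (f g : T -> R) : measurable_fun setT f -> measurable_fun setT g ->
  measurable_fun setT (fun x => (f x < g x)%R%:R : R).
Proof. by move=> mf mg; apply: measurable_natr; exact: measurable_fun_ltr. Qed.

Lemma measurable_le_natr (f g : T -> R) : measurable_fun setT f -> measurable_fun setT g ->
  measurable_fun setT (fun x => (f x <= g x)%R%:R : R).
Proof. by move=> mf mg; apply: measurable_natr; exact: measurable_fun_ler. Qed.

Lemma measurable_powRT (f : T -> R) r : measurable_fun setT f ->
  measurable_fun setT (fun x => f x `^ r).
Proof. by move=> mf; exact: (measurableT_comp (measurable_powR r) mf). Qed.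

(** The inverse of y is y times the power -1 of y^2, also at y = 0, where inverses are 0 by
    convention. *)
Lemma measurable_invr (f : T -> R) : measurable_fun setT f ->
  measurable_fun setT (fun x => (f x)^-1).
Proof.
move=> mf; rewrite (_ : (fun x => _) = fun x => f x * (f x ^+ 2) `^ (-1)).
  by apply: measurable_funM => //; apply: measurable_powRT; exact: measurable_funX.
apply/funext => x; rewrite powR_inv1 ?sqr_ge0//.
by have [->|fx0] := eqVneq (f x) 0; [rewrite mul0r invr0|field].
Qed.

End measurable_bool.

(** * Bounded measurable functions on the unit interval *)

Section bdd_meas.
Context {R : realType}.

(* Bounded on ]0, 1[ only: the weights w vanish elsewhere. *)
Definition bdd_meas (g : R -> R) := measurable_fun setT g /\
  exists B, forall x, 0 < x < 1 -> `|g x| <= B.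

Lemma bdd_measM f g : bdd_meas f -> bdd_meas g -> bdd_meas (fun x => f x * g x).
Proof.
move=> [mf [B fB]] [mg [B' gB]]; split; first exact: measurable_funM.
exists (B * B') => x x01; rewrite normrM ler_pM//; [exact: fB|exact: gB].
Qed.

Lemma bdd_measD f g : bdd_meas f -> bdd_meas g -> bdd_meas (fun x => f x + g x).
Proof.
move=> [mf [B fB]] [mg [B' gB]]; split; first exact: measurable_funD.
exists (B + B') => x x01; rewrite (le_trans (ler_normD _ _))// lerD//; [exact: fB|exact: gB].
Qed.

Lemma bdd_meas_cst c : bdd_meas (fun=> c).
Proof. by split => //; exists `|c|. Qed.

Lemma bdd_meas_id : bdd_meas id.
Proof.
split => //; exists 1 => x /andP[x0 x1].
by rewrite gtr0_norm// ltW.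
Qed.

Lemma bdd_measB f g : bdd_meas f -> bdd_meas g -> bdd_meas (fun x => f x - g x).
Proof.
move=> [mf [B fB]] [mg [B' gB]]; split; first exact: measurable_funB.
exists (B + B') => x x01; rewrite (le_trans (ler_normB _ _))// lerD//; [exact: fB|exact: gB].
Qed.

Lemma bdd_meas_natr (b : R -> bool) : measurable_fun [set: R] b -> bdd_meas (fun x => (b x)%:R).
Proof.
by move=> mb; split; [exact: measurable_natr|exists 1 => x _; case: (b x); rewrite ?normr1 ?normr0].
Qed.

Lemma bdd_meas_gt s : bdd_meas (fun x => (s < x)%R%:R).
Proof. by apply: bdd_meas_natr; exact: measurable_fun_ltr. Qed.

Lemma bdd_meas_le s : bdd_meas (fun x => (x <= s)%R%:R).
Proof. by apply: bdd_meas_natr; exact: measurable_fun_ler. Qed.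

Lemma bdd_meas_expR t : bdd_meas (fun x => expR (- (t * x))).
Proof.
split.
  by apply: measurableT_comp => //; apply: measurableT_comp => //; exact: measurable_funM.
exists (expR `|t|) => x /andP[x0 x1]; rewrite ger0_norm ?expR_ge0// ler_expR.
by rewrite -mulNr (le_trans (ler_norm _))// normrM normrN ler_piMr// gtr0_norm// ltW.
Qed.

End bdd_meas.

(** * The log-log cutoff *)

Section cutoff.
Context {R : realType}.
Local Notation leb := (@lebesgue_measure R).
Variables (l1 : R) (n : nat).
Hypothesis l1_gt0 : 0 < l1.
Hypothesis l1_lt1 : l1 < 1.
Hypothesis n_gt0 : (0 < n)%N.

Let nR : 0 < n%:R :> R. Proof. by rewrite ltr0n. Qed.

Let lnn (x : R) : 0 < x < 1 -> 0 < - ln x.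
Proof. by move=> x01; rewrite oppr_gt0 ln_lt0. Qed.

(* qcut is the square of the cutoff function, kcut the derivative of qcut, and
   kapcut = (x kcut)^2 / qcut = 4 (x hcut')^2. *)
Definition lnln x : R := ln (- ln x).
(** Solution of lnln x = lnln l1 + n, so that [hcut] runs from 0 at [xcut] to 1 at [l1]. *)
Definition xcut : R := expR (- expR (lnln l1 + n%:R)).
Definition hcut x : R := (lnln l1 + n%:R - lnln x) / n%:R.
Definition qcut x : R := if x <= xcut then 0 else if x <= l1 then hcut x ^+ 2 else 1.
Definition kcut x : R := (xcut < x <= l1)%R%:R * (2 * hcut x / (n%:R * (x * - ln x))).
Definition kapcut x : R := (xcut < x <= l1)%R%:R * (4 / (n%:R ^+ 2 * (- ln x) ^+ 2)).

Let xcut_gt0 : 0 < xcut. Proof. exact: expR_gt0. Qed.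

Let lnln_xcut : lnln xcut = lnln l1 + n%:R.
Proof. by rewrite /lnln /xcut expRK opprK expRK. Qed.

Let lnln_le x y : 0 < x -> x <= y -> y < 1 -> lnln y <= lnln x.
Proof.
move=> x0 xy y1; have y0 : 0 < y by exact: lt_le_trans xy.
rewrite /lnln ler_ln ?posrE ?lnn ?x0 ?y0 ?y1 ?(le_lt_trans xy)//.
by rewrite lerN2 ler_ln.
Qed.

Let xcut_lt : xcut < l1.
Proof.
rewrite -[ltRHS]lnK ?posrE// /xcut ltr_expR -[ltRHS]opprK ltrN2.
rewrite -[ltLHS]lnK ?posrE ?lnn ?l1_gt0 ?l1_lt1// -/(lnln l1) ltr_expR.
by rewrite ltrDl.
Qed.

Let hcut01 x : xcut <= x <= l1 -> 0 <= hcut x <= 1.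
Proof.
move=> /andP[cx xl]; have x1 : x < 1 by exact: le_lt_trans l1_lt1.
have x0 : 0 < x by exact: lt_le_trans cx.
rewrite /hcut divr_ge0 ?ler_pdivrMr ?mul1r//= ?(ltW nR)//.
  by rewrite lerBlDr addrC lerD2l lnln_le.
by rewrite subr_ge0 -lnln_xcut lnln_le.
Qed.

Lemma measurable_cut : measurable_fun [set: R] (fun x => xcut < x <= l1).
Proof. by apply: measurable_and; [exact: measurable_fun_ltr|exact: measurable_fun_ler]. Qed.

Let lnln_meas : measurable_fun [set: R] lnln.
Proof.
by apply: measurableT_comp => //; apply: measurableT_comp => //.
Qed.

Let hcut_meas : measurable_fun [set: R] hcut.
Proof. by apply: measurable_funM => //; exact: measurable_funB. Qed.

Lemma bdd_qcut : bdd_meas qcut.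
Proof.
split.
  apply: measurable_fun_ifT => //; first exact: measurable_fun_ler.
  apply: measurable_fun_ifT => //; first exact: measurable_fun_ler.
  exact: measurable_funX.
exists 1 => x _; rewrite /qcut; case: (leP x xcut) => [_|cx]; first by rewrite normr0.
case: (leP x l1) => [xl|_]; last by rewrite normr1.
have /hcut01/andP[h0 h1] : xcut <= x <= l1 by rewrite ltW.
by rewrite ger0_norm ?sqr_ge0// expr_le1.
Qed.

Lemma qcut_ge0 x : 0 <= qcut x.
Proof. by rewrite /qcut; case: ifP => // _; case: ifP => // _; exact: sqr_ge0. Qed.

Lemma qcut_out x : x <= xcut -> qcut x = 0.
Proof. by rewrite /qcut => ->. Qed.

Lemma qcut_ge l0 x : (l1 < x <= l0)%R%:R <= qcut x.
Proof.
case: (boolP (l1 < x <= l0)) => [/andP[lx _]|_]; last by rewrite qcut_ge0.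
by rewrite /qcut (lt_geF (lt_trans xcut_lt lx)) (lt_geF lx).
Qed.

Lemma kcut_ge0 x : 0 <= kcut x.
Proof.
rewrite /kcut; case: (boolP (xcut < x <= l1)) => [/andP[cx xl]|_]; last by rewrite mul0r.
have /hcut01/andP[h0 h1] : xcut <= x <= l1 by rewrite ltW.
have x0 : 0 < x by exact: lt_trans cx.
have /lnn/ltW l0' : 0 < x < 1 by rewrite x0 (le_lt_trans xl).
have nx : 0 <= n%:R * (x * - ln x) by exact: mulr_ge0 (ltW nR) (mulr_ge0 (ltW x0) l0').
have h2 : 0 <= 2 * hcut x by exact: mulr_ge0.
by rewrite mul1r divr_ge0.
Qed.

Lemma kcut_out x : ~~ (0 < x <= l1) -> kcut x = 0.
Proof.
rewrite /kcut; case: (boolP (xcut < x <= l1)) => [/andP[cx xl]|_]; last by rewrite mul0r.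
by rewrite (lt_trans xcut_gt0 cx) xl.
Qed.

Lemma kapcut_ge0 x : 0 <= kapcut x.
Proof. by rewrite /kapcut mulr_ge0// divr_ge0// mulr_ge0 ?sqr_ge0. Qed.

(** An equality on the cut, while both sides vanish outside it. It feeds a Cauchy-Schwarz inequality
    and avoids dividing by [qcut], which is 0 up to [xcut]. *)
Lemma kq_cut x : 0 < x < 1 -> (kcut x * x) ^+ 2 <= qcut x * kapcut x.
Proof.
move=> x01; have /andP[x0 x1] := x01; have lx := lnn x01.
rewrite /kcut /kapcut /qcut.
case: (boolP (xcut < x <= l1)) => [/andP[cx xl]|_]; last by rewrite !(mul0r, mulr0) expr0n.
rewrite (lt_geF cx) xl !mul1r le_eqVlt; apply/orP; left; apply/eqP.
by field; rewrite -oppr_eq0 !gt_eqF.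
Qed.

Let bound_cut x : xcut < x <= l1 -> - ln l1 <= - ln x.
Proof.
move=> /andP[cx xl]; rewrite lerN2 ler_ln ?posrE//.
exact: lt_trans cx.
Qed.

Lemma bdd_kapcut : bdd_meas kapcut.
Proof.
split.
  apply: measurable_funM; first by apply: measurable_natr; exact: measurable_cut.
  apply: measurable_funM => //; apply: measurable_invr.
  apply: measurable_funM => //; apply: measurable_funX; exact: measurableT_comp.
exists (4 / (n%:R ^+ 2 * (- ln l1) ^+ 2)) => x _; rewrite ger0_norm ?kapcut_ge0// /kapcut.
have ll : 0 < - ln l1 by rewrite lnn// l1_gt0.
case: (boolP (xcut < x <= l1)) => [cx|_]; last first.
  by rewrite mul0r divr_ge0// mulr_ge0 ?sqr_ge0.
have b := bound_cut cx.
have bx : 0 < - ln x by exact: lt_le_trans b.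
rewrite mul1r ler_pM2l// lef_pV2 ?posrE ?mulr_gt0 ?exprn_gt0//.
by rewrite ler_pM2l ?exprn_gt0//; apply: lerXn2r => //; rewrite nnegrE ltW.
Qed.

Lemma bdd_kcut : bdd_meas kcut.
Proof.
split.
  apply: measurable_funM; first by apply: measurable_natr; exact: measurable_cut.
  apply: measurable_funM; first exact: measurable_funM.
  apply: measurable_invr; apply: measurable_funM => //; apply: measurable_funM => //.
  exact: measurableT_comp.
have ll : 0 < - ln l1 by rewrite lnn// l1_gt0.
exists (2 / (n%:R * (xcut * - ln l1))) => x _; rewrite ger0_norm ?kcut_ge0// /kcut.
case: (boolP (xcut < x <= l1)) => [cx|_]; last first.
  by rewrite mul0r divr_ge0// !mulr_ge0 ?(ltW ll) ?(ltW xcut_gt0) ?(ltW nR).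
have b := bound_cut cx; have /andP[cx' xl] := cx.
have x0 : 0 < x by exact: lt_trans cx'.
have /hcut01/andP[h0 h1] : xcut <= x <= l1 by rewrite ltW.
have bx : 0 < - ln x by exact: lt_le_trans b.
have nx : 0 < n%:R * (x * - ln x) by rewrite mulr_gt0// mulr_gt0.
rewrite mul1r; apply: ler_pM.
- exact: mulr_ge0.
- by rewrite invr_ge0 ltW.
- by rewrite ler_piMr.
rewrite lef_pV2 ?posrE ?mulr_gt0// ler_pM2l//.
by apply: ler_pM; rewrite ?(ltW xcut_gt0) ?(ltW ll) ?(ltW cx').
Qed.

Lemma is_derive_lnln (x : R) : 0 < x < 1 -> is_derive x (1:R) lnln (- (x * - ln x)^-1).
Proof.
move=> x01; have lx := lnn x01; have /andP[x0 _] := x01.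
have h1 := is_derive1_ln x0; have h2 := is_derive1_ln lx.
rewrite (_ : lnln = (@ln R) \o (fun x => - ln x))//.
apply: is_derive_eq.
by field; rewrite -oppr_eq0 !gt_eqF.
Qed.

Let cont_inv (x : R) : 0 < x < 1 -> {for x, continuous (fun x : R => (x * - ln x)^-1)}.
Proof.
move=> x01; have lx := lnn x01; have /andP[x0 _] := x01.
apply: cvgV; first by rewrite mulf_neq0// gt_eqF.
apply: cvgM; first exact: cvg_id.
by apply: (@cvgN _ R^o); exact: continuous_ln.
Qed.

(** Fundamental theorem of calculus on the cut. No jump occurs at its ends, where [hcut] is 0 and 1,
    and nothing is added beyond [l1]. *)
Lemma qcut_int x : 0 < x < 1 -> (qcut x)%:E = (\int[leb]_s ((s < x)%R%:R * kcut s)%:E)%E.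
Proof.
move=> x01; have /andP[x0 x1] := x01.
rewrite /qcut; case: (leP x xcut) => [xc|cx].
  rewrite integral0_eq// => s _; rewrite /kcut.
  by case: (ltP s x) => sx; rewrite ?mul0r// (ltNge xcut) (ltW (lt_le_trans sx xc))/= mul0r mulr0.
pose m := Num.min x l1.
have cm : xcut < m by rewrite lt_min cx xcut_lt.
have m1 : m < 1 by rewrite gt_min x1.
pose f s := 2 * hcut s / (n%:R * (s * - ln s)).
have mf : measurable_fun [set: R] (fun s => (xcut < s <= l1)%R%:R * f s) := bdd_kcut.1.
have sub s : xcut <= s <= m -> 0 < s < 1.
  by move=> /andP[cs sm]; rewrite (lt_le_trans xcut_gt0 cs) (le_lt_trans sm).
have dH s : xcut <= s <= m -> is_derive s (1:R) (fun s => hcut s ^+ 2) (f s).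
  move=> /sub s01; have h := is_derive_lnln s01; have ls := lnn s01; have /andP[s0 _] := s01.
  apply: is_derive_eq; rewrite /GRing.scale/= /f /hcut.
  by field; rewrite -oppr_eq0 !gt_eqF.
have ch s : xcut <= s <= m -> {for s, continuous hcut}.
  move=> /sub s01; apply: cvgM; last exact: cvg_cst.
  apply: (@cvgB _ R^o); first exact: cvg_cst.
  exact: is_derive_continuous (is_derive_lnln s01).
have cf s : xcut <= s <= m -> {for s, continuous f}.
  move=> sm; have s01 := sub s sm.
  rewrite (_ : f = fun s => (2 / n%:R * hcut s) * (s * - ln s)^-1); last first.
    by apply/funext => y; rewrite /f invfM; ring.
  apply: cvgM; last exact: cont_inv.
  by apply: cvgM; [exact: cvg_cst|exact: ch].
have E := integral_is_derive (ltW cm) dH cf.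
have hc : hcut xcut = 0 by rewrite /hcut lnln_xcut subrr mul0r.
rewrite hc expr0n/= subr0 in E.
have hl : hcut l1 = 1 by rewrite /hcut addrAC subrr add0r divff// gt_eqF.
transitivity (hcut m ^+ 2)%:E.
  congr (_%:E); rewrite /m; case: (leP x l1) => // _.
  by rewrite hl expr1n.
have mf' : measurable_fun `]xcut, m[ f.
  have : measurable_fun `]xcut, m[ (fun s => (xcut < s <= l1)%R%:R * f s).
    exact: measurable_funTS.
  apply: eq_measurable_fun => s; rewrite inE/= in_itv/= => /andP[cs sm].
  by rewrite cs (ltW (lt_le_trans sm _)) ?mul1r// ge_min lexx orbT.
rewrite -E -integral_natr_itv//.
apply: ae_eq_integral => //.
- apply/measurable_EFinP.
  rewrite (_ : (fun s => _) = fun s => (s <= m)%R%:R * ((xcut < s <= l1)%R%:R * f s)).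
    by apply: measurable_funM => //; exact: measurable_le_natr.
  apply/funext => s; case: (leP s m) => sm; rewrite ?andbF ?mul0r// ?andbT mul1r.
  by rewrite (le_trans sm) ?andbT// ge_min lexx orbT.
- by apply/measurable_EFinP; apply: measurable_funM; [exact: measurable_lt_natr|case: bdd_kcut].
(* The conditions s <= min(x, l1) and s < x, s <= l1 differ only at s = x. *)
exists [set x]; split => //; first exact: lebesgue_measure_set1.
move=> s /= /not_implyP[_]; apply: contra_notP => /eqP sx; congr (_%:E).
rewrite /kcut -/(f s) mulrA; congr (_ * _).
by rewrite /m le_min [s <= x]le_eqVlt (negbTE sx)/= -natrM mulnb andbCA.
Qed.

(** The antiderivative is - lnln. This n, against the 1 / n^2 of [kapcut], produces the final rate 1
    / n. *)
Lemma integral_inv_log :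
  (\int[leb]_x ((xcut < x <= l1)%R%:R * (x * - ln x)^-1)%:E = n%:R%:E)%E.
Proof.
have sub s : xcut <= s <= l1 -> 0 < s < 1.
  by move=> /andP[cs sl]; rewrite (lt_le_trans xcut_gt0 cs) (le_lt_trans sl).
have dF s : xcut <= s <= l1 -> is_derive s (1:R) (fun s => - lnln s) (s * - ln s)^-1.
  by move=> /sub s01; have h := is_derive_lnln s01; apply: is_derive_eq; rewrite opprK.
have cf s : xcut <= s <= l1 -> {for s, continuous (fun s : R => (s * - ln s)^-1)}.
  by move=> /sub; exact: cont_inv.
rewrite integral_natr_itv.
- rewrite (integral_is_derive (ltW xcut_lt) dF cf) lnln_xcut; congr (_%:E); ring.
- apply: open_continuous_measurable_fun => // s.
  by rewrite inE/= in_itv/= => /andP[cs sl]; apply: cf; rewrite !ltW.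
Qed.

End cutoff.

(** * Posterior distribution of the mixing variable *)

Section posterior.
Context {R : realType}.
Local Notation leb := (@lebesgue_measure R).
Variable w : R -> R.
Hypothesis mw : measurable_fun setT w.
Hypothesis w_ge0 : forall x, 0 <= w x.
Hypothesis w_out : forall x, ~~ (0 < x < 1) -> w x = 0.
Hypothesis w_fin : (\int[leb]_x (w x)%:E < +oo)%E.

(** For a [bdd_meas] integrand the integral is finite and [fine] loses nothing, by [wintE]. *)
Definition wint (g : R -> R) : R := fine (\int[leb]_x (w x * g x)%:E)%E.

Lemma bdd_meas_integrable g : bdd_meas g -> leb.-integrable setT (fun x => (w x * g x)%:E).
Proof.
move=> [mg [B gB]]; apply/integrableP; split.
  by apply/measurable_EFinP; exact: measurable_funM.
apply: (@le_lt_trans _ _ (\int[leb]_x (`|B| * w x)%:E)%E).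
  under eq_integral do rewrite abse_EFin.
  apply: ge0_le_integral_EFin => //.
  - by apply: measurableT_comp => //; exact: measurable_funM.
  - exact: measurable_funM.
  - move=> x _; rewrite normrM (ger0_norm (w_ge0 x)) mulrC.
    have [/gB gx|/w_out ->] := boolP (0 < x < 1); last by rewrite !mulr0.
    by apply: ler_wpM2r => //; rewrite (le_trans gx)// ler_norm.
by rewrite ge0_integral_EFinZ// lte_mul_pinfty// ge0_fin_numE.
Qed.

Lemma wintE g : bdd_meas g -> (\int[leb]_x (w x * g x)%:E = (wint g)%:E)%E.
Proof.
by move=> bg; rewrite fineK//; apply: integrable_fin_num => //; exact: bdd_meas_integrable.
Qed.

Lemma wintD f g : bdd_meas f -> bdd_meas g ->
  wint (fun x => f x + g x) = wint f + wint g.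
Proof.
move=> bf bg; apply: EFin_inj; rewrite EFinD -!wintE//; last exact: bdd_measD.
under eq_integral do rewrite mulrDr EFinD.
by rewrite integralD//; exact: bdd_meas_integrable.
Qed.

Lemma wintZ c g : bdd_meas g -> wint (fun x => c * g x) = c * wint g.
Proof.
move=> bg; apply: EFin_inj; rewrite EFinM -!wintE//; last first.
  by apply: bdd_measM => //; exact: bdd_meas_cst.
under eq_integral do rewrite mulrCA EFinM.
by rewrite integralZl//; exact: bdd_meas_integrable.
Qed.

Lemma le_wint f g : bdd_meas f -> bdd_meas g -> (forall x, 0 < x < 1 -> f x <= g x) ->
  wint f <= wint g.
Proof.
move=> bf bg fg; rewrite -lee_fin -!wintE//.
apply: le_integral => //; try exact: bdd_meas_integrable.
move=> x _; rewrite lee_fin.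
have [/fg h|/w_out ->] := boolP (0 < x < 1); last by rewrite !mul0r.
exact: ler_wpM2l.
Qed.

Lemma eq_wint f g : (forall x, 0 < x < 1 -> f x = g x) -> wint f = wint g.
Proof.
move=> fg; congr fine; apply: eq_integral => x _.
by have [/fg ->//|/w_out ->] := boolP (0 < x < 1); rewrite !mul0r.
Qed.

Lemma wint_ge0 g : (forall x, 0 < x < 1 -> 0 <= g x) -> 0 <= wint g.
Proof.
move=> g0; apply/fine_ge0/integral_ge0 => x _; rewrite lee_fin.
have [/g0 h|/w_out ->] := boolP (0 < x < 1); last by rewrite !mul0r.
exact: mulr_ge0.
Qed.

Variables (l0 C1 C2 : R) (M : nat).
Hypothesis l0_gt0 : 0 < l0.
Hypothesis l0_lt1 : l0 < 1.
Hypothesis C1_gt0 : 0 < C1.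
Hypothesis C2_gt0 : 0 < C2.
Hypothesis w_gt0 : forall s, 0 < s <= l0 -> 0 < w s.
(** Regular variation of [w] at 0 enters in this form: an inequality of Karamata type to the left of
    s, and polynomial growth to the right of s. Both are later derived from Potter's bounds. *)
Hypothesis w_low : forall s, 0 < s <= l0 -> wint (fun x => (x <= s)%R%:R) <= C1 * s * w s.
Hypothesis w_high : forall s x, 0 < s <= l0 -> s <= x -> w x <= C2 * (x / s) ^+ M * w s.

(** With t = |z|^2 / 2 and the weight w * q, [tmass q t] is the marginal density at z and
    [tnum q t / tmass q t] the posterior mean of the mixing variable; [pmass] and [pmean] are the
    case q = 1. *)
Definition tmass q t : R := wint (fun x => q x * expR (- (t * x))).
Definition tnum q t : R := wint (fun x => q x * (x * expR (- (t * x)))).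

Definition pmass t : R := wint (fun x => expR (- (t * x))).
Definition pmean t : R := wint (fun x => x * expR (- (t * x))) / pmass t.

(** On ]s/2, s], [w_high] with base point x gives w(x) >= w(s) / (C2 2^M), and exp(- t x) >= exp(- t
    s); the interval has length s/2, whence the power M + 1. *)
Lemma w_le_wint t s : 0 <= t -> 0 < s <= l0 ->
  s * w s * expR (- (t * s)) <=
  2 ^+ M.+1 * C2 * wint (fun x => (s / 2 < x <= s)%R%:R * expR (- (t * x))).
Proof.
move=> t0 /andP[s0 sl].
have s2 : s / 2 <= s by lra.
have K0 : 0 <= w s / (C2 * 2 ^+ M) * expR (- (t * s)).
  by rewrite mulr_ge0 ?expR_ge0// divr_ge0// mulr_ge0 ?exprn_ge0// ltW.
have := integral_indic_le K0 s2.
set I := (\int[leb]_x _)%E => EI.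
have mb : measurable_fun setT (fun x => (s / 2 < x <= s)%R%:R : R).
  apply: measurable_natr.
  by apply: measurable_and; [exact: measurable_fun_ltr|exact: measurable_fun_ler].
have bb : bdd_meas (fun x => (s / 2 < x <= s)%R%:R * expR (- (t * x))).
  by apply: bdd_measM (bdd_meas_natr _) (bdd_meas_expR t);
    apply: measurable_and; [exact: measurable_fun_ltr|exact: measurable_fun_ler].
have : (I <= \int[leb]_x (w x * ((s / 2 < x <= s)%R%:R * expR (- (t * x))))%:E)%E.
  apply: ge0_le_integral_EFin => //.
  - exact: measurable_funM.
  - by apply: measurable_funM => //; case: bb.
  - by move=> x _; rewrite mulr_ge0.
  - move=> x _; case: (boolP (s / 2 < x <= s)) => [/andP[sx xs]|_]; last first.
      by rewrite !mul0r mulr0.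
    have x0 : 0 < x by rewrite (lt_trans _ sx)// divr_gt0.
    rewrite !mul1r ler_pM ?expR_ge0//.
    + by rewrite divr_ge0// mulr_ge0 ?exprn_ge0// ltW.
    + rewrite ler_pdivrMr ?mulr_gt0 ?exprn_gt0// mulrC.
      have x0l : 0 < x <= l0 by rewrite x0 (le_trans xs).
      apply: le_trans (w_high x0l xs) _; rewrite ler_wpM2r// ler_wpM2l ?(ltW C2_gt0)//.
      apply: lerXn2r; rewrite ?nnegrE ?divr_ge0 ?(ltW s0) ?(ltW x0)//.
      by rewrite ler_pdivrMr//; lra.
    + by rewrite ler_expR lerN2 ler_wpM2l.
rewrite EI wintE ?lee_fin// => h.
have -> : s * w s * expR (- (t * s)) =
    2 ^+ M.+1 * C2 * (w s / (C2 * 2 ^+ M) * expR (- (t * s)) * (s - s / 2)).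
  by rewrite exprS; field; rewrite gt_eqF// gt_eqF// exprn_gt0.
by rewrite ler_wpM2l// mulr_ge0 ?exprn_ge0// ltW.
Qed.

Lemma w_le_pmass t s : 0 <= t -> 0 < s <= l0 ->
  s * w s * expR (- (t * s)) <= 2 ^+ M.+1 * C2 * pmass t.
Proof.
move=> t0 sl; apply: le_trans (w_le_wint t0 sl) _.
rewrite ler_wpM2l ?mulr_ge0 ?exprn_ge0 ?(ltW C2_gt0)//.
apply: le_wint => [||x _].
- by apply: bdd_measM (bdd_meas_natr _) (bdd_meas_expR t);
    apply: measurable_and; [exact: measurable_fun_ltr|exact: measurable_fun_ler].
- exact: bdd_meas_expR.
- by case: (_ < x <= _); rewrite ?mul1r ?mul0r ?expR_ge0.
Qed.

Lemma pmass_gt0 t : 0 <= t -> 0 < pmass t.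
Proof.
move=> t0; have l00 : 0 < l0 <= l0 by rewrite l0_gt0 lexx.
have := w_le_pmass t0 l00; rewrite mulrC => h.
have : 0 < 2 ^+ M.+1 * C2 * pmass t.
  by apply: lt_le_trans h; rewrite !mulr_gt0 ?expR_gt0// w_gt0.
by rewrite pmulr_rgt0// mulr_gt0// exprn_gt0.
Qed.

Lemma pmean_ge0 t : 0 <= t -> 0 <= pmean t.
Proof.
move=> t0; rewrite divr_ge0 ?(ltW (pmass_gt0 t0))//.
by apply: wint_ge0 => x /andP[x0 _]; rewrite mulr_ge0 ?expR_ge0 ?ltW.
Qed.

Lemma pmean_le1 t : 0 <= t -> pmean t <= 1.
Proof.
move=> t0; rewrite ler_pdivrMr ?pmass_gt0// mul1r.
apply: le_wint => [||x /andP[x0 x1]].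
- by apply: bdd_measM; [exact: bdd_meas_id|exact: bdd_meas_expR].
- exact: bdd_meas_expR.
- by rewrite ler_piMl ?expR_ge0// ltW.
Qed.

(** If s t >= T then (M + 1) / s <= t / 2, so half of the exponential absorbs (x / s)^(M + 1) for x
    >= s. *)
Let T : R := 2 * M.+1%:R.
Let T_gt0 : 0 < T. Proof. by rewrite mulr_gt0. Qed.

(* Past T / t the exponential beats the polynomial growth of w. *)
Lemma wint_tail t s : 0 < t -> 0 < s <= l0 -> T <= s * t ->
  wint (fun x => (s < x)%R%:R * (x * expR (- (t * x)))) <=
  2 * C2 / t * (s * w s * expR (- (t * s))).
Proof.
move=> t0 /andP[s0 sl] Tst.
have bm : bdd_meas (fun x => (s < x)%R%:R * (x * expR (- (t * x)))).
  apply: bdd_measM; first exact: bdd_meas_gt.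
  by apply: bdd_measM; [exact: bdd_meas_id|exact: bdd_meas_expR].
have K0 : 0 <= C2 * w s * s * expR (- (t / 2 * s)).
  by rewrite !mulr_ge0 ?expR_ge0// ltW.
rewrite -lee_fin -wintE//.
apply: (@le_trans _ _ (\int[leb]_(x in `[s, +oo[)
    (C2 * w s * s * expR (- (t / 2 * s)) * expR (- (t / 2 * x)))%:E)%E); last first.
  rewrite ge0_integral_EFinZ//; last first.
    by apply: measurable_funTS; exact: (bdd_meas_expR (t / 2)).1.
  rewrite integral_expR_tail ?divr_gt0// -EFinM lee_fin le_eqVlt; apply/orP; left.
  have -> : expR (- (t * s)) = expR (- (t / 2 * s)) * expR (- (t / 2 * s)).
    by rewrite -expRD; congr expR; field.
  by apply/eqP; field; by rewrite gt_eqF.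
rewrite [leRHS]integral_mkcond; apply: ge0_le_integral => //.
- move=> x _; rewrite lee_fin; case: (ltP s x) => sx; last by rewrite mul0r mulr0.
  by rewrite !mulr_ge0 ?expR_ge0// ltW// (lt_trans s0).
- by apply/measurable_EFinP; apply: measurable_funM => //; case: bm.
- apply/(measurable_restrictT _ _).1 => //; apply/measurable_EFinP/measurable_funTS.
  apply: measurable_funM => //.
  exact: (bdd_meas_expR (t / 2)).1.
- move=> x _; rewrite patchE mem_setE in_itv/= andbT.
  case: (ltP s x) => [sx|xs]; last first.
    by rewrite mul0r mulr0; case: ifP => // _; rewrite lee_fin mulr_ge0 ?expR_ge0.
  have x0 : 0 < x by exact: lt_trans sx.
  rewrite (ltW sx) lee_fin mul1r.
  have xs1 : x / s <= expR (x / s - 1) by apply: le_trans (expR_ge1Dx _); lra.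
  (* The exponent M comes from [w_high] and one more from the factor x = s (x / s) of the
     integrand. *)
  have xsM : (x / s) ^+ M.+1 <= expR ((x - s) * t / 2).
    apply: (@le_trans _ _ (expR (x / s - 1) ^+ M.+1)).
      by apply: lerXn2r; rewrite ?nnegrE ?expR_ge0 ?divr_ge0 ?(ltW x0) ?(ltW s0).
    rewrite -expRM_natl ler_expR.
    have -> : x / s - 1 = (x - s) / s by field; by rewrite gt_eqF.
    rewrite mulrA ler_pdivrMr//.
    have -> : (x - s) * t / 2 * s = (x - s) * (s * t / 2) by ring.
    rewrite mulrC ler_wpM2l ?subr_ge0 ?(ltW sx)//.
    by move: Tst; rewrite /T; lra.
  have s0l : 0 < s <= l0 by rewrite s0.
  apply: (@le_trans _ _ (C2 * (x / s) ^+ M * w s * (x * expR (- (t * x))))).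
    by rewrite ler_wpM2r ?mulr_ge0 ?expR_ge0 ?(ltW x0)// w_high// ltW.
  have -> : C2 * (x / s) ^+ M * w s * (x * expR (- (t * x))) =
      C2 * w s * s * expR (- (t * x)) * (x / s) ^+ M.+1.
    by rewrite exprS; field; by rewrite gt_eqF.
  apply: (@le_trans _ _ (C2 * w s * s * expR (- (t * x)) * expR ((x - s) * t / 2))).
    by rewrite ler_wpM2l// !mulr_ge0 ?expR_ge0 ?(ltW C2_gt0) ?(ltW s0).
  have Ee : expR (- (t * x)) * expR ((x - s) * t / 2) =
      expR (- (t / 2 * s)) * expR (- (t / 2 * x)) by rewrite -!expRD; congr expR; field.
  by rewrite -[leLHS]mulrA Ee mulrA.
Qed.

Let CE : R := T / l0 + 2 * C2 * (2 ^+ M.+1 * C2).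

(** The part of the posterior below T / t contributes at most T / t; the part above is controlled by
    [wint_tail] at s = T / t, whose right-hand side [w_le_pmass] compares with the total mass. When
    t < T / l0 the point T / t lies beyond [l0], and then the mean is at most 1 <= (T / l0) / t. *)
Lemma pmean_le t : 0 < t -> pmean t <= CE / t.
Proof.
move=> t0; have t0' := ltW t0.
have C20 := ltW C2_gt0.
have P0 := pmass_gt0 t0'.
have B0 : 0 <= 2 * C2 * (2 ^+ M.+1 * C2) by rewrite !mulr_ge0// exprn_ge0.
have [tT|Tt] := leP (T / l0) t; last first.
  apply: le_trans (pmean_le1 t0') _; rewrite ler_pdivlMr// mul1r.
  by apply: le_trans (ltW Tt) _; rewrite /CE lerDl.
have s0 : 0 < T / t <= l0.
  by rewrite divr_gt0//= ler_pdivrMr// mulrC -ler_pdivrMr.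
have be : bdd_meas (fun x => expR (- (t * x))) by exact: bdd_meas_expR.
have bxe : bdd_meas (fun x => x * expR (- (t * x))) by exact: bdd_measM bdd_meas_id be.
rewrite /pmean ler_pdivrMr//.
have -> : wint (fun x => x * expR (- (t * x))) =
    wint (fun x => (x <= T / t)%R%:R * (x * expR (- (t * x)))) +
    wint (fun x => (T / t < x)%R%:R * (x * expR (- (t * x)))).
  rewrite -wintD.
  - apply: eq_wint => x _; case: leP => _; rewrite ?mul1r ?mul0r ?addr0 ?add0r//.
  - exact: bdd_measM (bdd_meas_le _) bxe.
  - exact: bdd_measM (bdd_meas_gt _) bxe.
have Tt : T <= T / t * t by rewrite divfK ?gt_eqF.
have h2 := wint_tail t0 s0 Tt.
have h3 := w_le_pmass t0' s0.
have h1 : wint (fun x => (x <= T / t)%R%:R * (x * expR (- (t * x)))) <= T / t * pmass t.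
  rewrite -wintZ//; apply: le_wint => [||x /andP[x0 _]].
  - exact: bdd_measM (bdd_meas_le _) bxe.
  - exact: bdd_measM (bdd_meas_cst _) be.
  - case: (leP x (T / t)) => h; rewrite ?mul0r ?mul1r ?ler_pM2r ?expR_gt0//.
    by rewrite mulr_ge0 ?expR_ge0// divr_ge0// ltW.
apply: le_trans (lerD h1 h2) _.
apply: le_trans (lerD (lexx _) (ler_wpM2l _ h3)) _; first by rewrite divr_ge0 ?mulr_ge0.
rewrite mulrA -mulrDl ler_pM2r//.
have -> : T / t + 2 * C2 / t * (2 ^+ M.+1 * C2) = (T + 2 * C2 * (2 ^+ M.+1 * C2)) / t.
  by field; by rewrite gt_eqF.
rewrite ler_pM2r ?invr_gt0// lerD2r ler_pdivlMr// ler_piMr// ltW//.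
Qed.

(* By Fubini, tnum q t - pmean t * tmass q t is the integral of q'(s) * pkernel t s. *)
Definition pkernel t s : R := wint (fun x => (s < x)%R%:R * ((x - pmean t) * expR (- (t * x)))).

Let bE t : bdd_meas (fun x => (x - pmean t) * expR (- (t * x))).
Proof.
apply: bdd_measM; last exact: bdd_meas_expR.
exact: bdd_measD bdd_meas_id (bdd_meas_cst _).
Qed.

Lemma wint_centered t : 0 <= t -> wint (fun x => (x - pmean t) * expR (- (t * x))) = 0.
Proof.
move=> t0; have be := bdd_meas_expR t.
transitivity (wint (fun x => x * expR (- (t * x)) + (- pmean t) * expR (- (t * x)))).
  by apply: eq_wint => x _; ring.
rewrite wintD//; last 2 first.
- exact: bdd_measM bdd_meas_id be.
- exact: bdd_measM (bdd_meas_cst _) be.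
by rewrite wintZ// -/(pmass t) /pmean mulNr divfK ?subrr// gt_eqF// pmass_gt0.
Qed.

Lemma pkernelE t s : 0 <= t ->
  pkernel t s = wint (fun x => (x <= s)%R%:R * ((pmean t - x) * expR (- (t * x)))).
Proof.
move=> t0; apply/eqP; rewrite -subr_eq0 -mulN1r -wintZ; last first.
  exact: bdd_measM (bdd_meas_le _) (bdd_measM (bdd_measB (bdd_meas_cst _) bdd_meas_id) (bdd_meas_expR t)).
rewrite /pkernel -wintD.
- rewrite -[X in _ == X](wint_centered t0); apply/eqP; apply: eq_wint => x _.
  by case: (leP x s) => _; rewrite ?mul0r ?mul1r; ring.
- exact: bdd_measM (bdd_meas_gt _) (bE t).
- apply: bdd_measM (bdd_meas_cst _) _.
  exact: bdd_measM (bdd_meas_le _) (bdd_measM (bdd_measB (bdd_meas_cst _) bdd_meas_id) (bdd_meas_expR t)).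
Qed.

(** Of the two forms of the kernel, over {x > s} and over {x <= s}, one has a nonnegative integrand,
    according to the side of the mean on which s lies. *)
Lemma pkernel_ge0 t s : 0 <= t -> 0 <= pkernel t s.
Proof.
move=> t0; have [sE|Es] := leP s (pmean t).
  rewrite pkernelE//; apply: wint_ge0 => x _; case: (leP x s) => xs; rewrite ?mul0r// mul1r.
  by rewrite mulr_ge0 ?expR_ge0// subr_ge0 (le_trans xs).
apply: wint_ge0 => x _; case: (ltP s x) => xs; rewrite ?mul0r// mul1r.
by rewrite mulr_ge0 ?expR_ge0// subr_ge0 ltW// (lt_trans Es).
Qed.

Let CK : R := CE * C1 * expR T + 2 * C2.

(** For s t >= T the mean is dropped and the tail bound applies. For s t < T the form over {x <= s}
    is at most the mean times the mass below s, that is (CE / t) C1 s w(s), and the missing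
    exponential costs a factor exp T. *)
Lemma pkernel_le t s : 0 < t -> 0 < s <= l0 ->
  pkernel t s <= CK / t * (s * w s * expR (- (t * s))).
Proof.
move=> t0 sl; have t0' := ltW t0; have /andP[s0 _] := sl.
have ws := w_gt0 sl.
have CE0 : 0 < CE by rewrite /CE ltr_wpDr ?divr_gt0// !mulr_ge0 ?exprn_ge0// ltW.
have X0 : 0 < s * w s * expR (- (t * s)) by rewrite !mulr_gt0 ?expR_gt0.
have be := bdd_meas_expR t.
have bxe : bdd_meas (fun x => x * expR (- (t * x))) by exact: bdd_measM bdd_meas_id be.
have [Ts|sT] := leP T (s * t).
  apply: (@le_trans _ _ (wint (fun x => (s < x)%R%:R * (x * expR (- (t * x)))))).
    apply: le_wint => [||x _].
    - exact: bdd_measM (bdd_meas_gt _) (bE t).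
    - exact: bdd_measM (bdd_meas_gt _) bxe.
    - by rewrite ler_wpM2l// ler_wpM2r ?expR_ge0// gerBl pmean_ge0.
  apply: le_trans (wint_tail t0 sl Ts) _.
  rewrite ler_pM2r// ler_pM2r ?invr_gt0// /CK lerDr !mulr_ge0 ?expR_ge0// ltW//.
rewrite pkernelE//.
apply: (@le_trans _ _ (wint (fun x => pmean t * (x <= s)%R%:R))).
  apply: le_wint => [||x /andP[x0 _]].
  - exact: bdd_measM (bdd_meas_le _) (bdd_measM (bdd_measB (bdd_meas_cst _) bdd_meas_id) be).
  - exact: bdd_measM (bdd_meas_cst _) (bdd_meas_le _).
  - case: (leP x s) => xs; rewrite ?mul0r ?mulr0// mul1r mulr1.
    apply: (@le_trans _ _ (pmean t * expR (- (t * x)))).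
      by rewrite ler_wpM2r ?expR_ge0// gerBl ltW.
    by rewrite ler_piMr ?pmean_ge0// -expR0 ler_expR oppr_le0 mulr_ge0// ltW.
rewrite wintZ; last exact: bdd_meas_le.
apply: (@le_trans _ _ (CE / t * (C1 * s * w s))).
  rewrite ler_pM ?pmean_ge0 ?pmean_le ?w_low//.
  by apply: wint_ge0.
apply: (@le_trans _ _ (CE * C1 * expR T / t * (s * w s * expR (- (t * s))))).
  have -> : CE * C1 * expR T / t * (s * w s * expR (- (t * s))) =
      CE / t * (C1 * s * w s) * (expR T * expR (- (t * s))) by ring.
  rewrite ler_peMr//; first by rewrite !mulr_ge0 ?invr_ge0 ?(ltW CE0) ?(ltW C1_gt0) ?(ltW s0).
  by rewrite -expRD -expR0 ler_expR subr_ge0 mulrC ltW.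
by rewrite ler_pM2r// ler_pM2r ?invr_gt0// lerDl mulr_ge0// ltW.
Qed.

(** * Shift of the posterior mean caused by a cutoff *)

Section layer_cake.
Variables (q k : R -> R).
Hypothesis bq : bdd_meas q.
Hypothesis bk : bdd_meas k.
Hypothesis k_ge0 : forall s, 0 <= k s.
Hypothesis k_out : forall s, ~~ (0 < s <= l0) -> k s = 0.
Hypothesis q_int : forall x, 0 < x < 1 -> (q x)%:E = (\int[leb]_s ((s < x)%R%:R * k s)%:E)%E.

Section nonneg.
Variable g : R -> R.
Hypothesis bg : bdd_meas g.
Hypothesis g_ge0 : forall x, 0 < x < 1 -> 0 <= g x.

Let F (u : R * R) : \bar R := (w u.1 * ((u.2 < u.1)%R%:R * g u.1))%:E.

Let F_ge0 u : (0 <= F u)%E.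
Proof.
rewrite lee_fin; have [u01|/w_out ->] := boolP (0 < u.1 < 1); last by rewrite mul0r.
by rewrite !mulr_ge0// g_ge0.
Qed.

Let mF : measurable_fun setT F.
Proof.
apply/measurable_EFinP; apply: measurable_funM; first exact: measurableT_comp mw _.
apply: measurable_funM; first by apply: measurable_lt_natr.
by apply: (measurableT_comp bg.1).
Qed.

Lemma measurable_wint_gt : measurable_fun [set: R] (fun s : R => wint (fun x => (s < x)%R%:R * g x)).
Proof.
apply/measurable_EFinP; have := measurable_fun_fubini_tonelli_G (m1 := leb) F mF F_ge0.
by apply: eq_measurable_fun => s _ /=; rewrite -wintE//; exact: bdd_measM (bdd_meas_gt _) bg.
Qed.

(** Write q(x) as the integral of k over {s < x} and apply Tonelli, which is why [g] is
    nonnegative. *)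
Lemma wint_layer :
  ((wint (fun x => q x * g x))%:E = \int[leb]_s (k s * wint (fun x => (s < x)%R%:R * g x))%:E)%E.
Proof.
rewrite -wintE; last exact: bdd_measM.
pose H (u : R * R) : \bar R := ((k u.2)%:E * F u)%E.
have H0 u : (0 <= H u)%E by rewrite mule_ge0// lee_fin.
have mH : measurable_fun setT H.
  apply: emeasurable_funM => //; apply/measurable_EFinP.
  exact: (measurableT_comp bk.1).
transitivity (\int[leb]_x \int[leb]_s H (x, s))%E.
  apply: eq_integral => x _; have [x01|/w_out wx] := boolP (0 < x < 1); last first.
    rewrite wx mul0r integral0_eq// => s _.
    by rewrite /H /F/= wx mul0r mule0.
  rewrite (_ : w x * (q x * g x) = (w x * g x) * q x); last by ring.
  rewrite EFinM q_int// -ge0_integral_EFinZ//.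
  - by apply: eq_integral => s _; rewrite /H /F/= -EFinM; congr (_%:E); ring.
  - by rewrite mulr_ge0 ?g_ge0.
  - by apply: measurable_funM; [exact: measurable_lt_natr|exact: bk.1].
  - by move=> s _; rewrite mulr_ge0.
rewrite fubini_tonelli//; apply: eq_integral => s _.
transitivity (\int[leb]_x ((k s)%:E * F (x, s)))%E; first by [].
rewrite ge0_integralZl//=.
- by rewrite EFinM -wintE//; exact: bdd_measM (bdd_meas_gt _) bg.
- exact: measurableT_comp mF (measurable_pair2 s).
- by rewrite lee_fin.
Qed.

End nonneg.

(** The centred integrand changes sign, so [wint_layer] is applied to its two nonnegative parts [A]
    and [B], whose combination is [pkernel]. The factor s w(s) exp(- t s) of [pkernel_le] turns the
    integral in s back into a [wint]. *)
Lemma posterior_shift t : 0 < t ->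
  0 <= tnum q t - pmean t * tmass q t <= CK / t * wint (fun x => k x * (x * expR (- (t * x)))).
Proof.
move=> t0.
pose X := wint (fun x => q x * (x * expR (- (t * x)))).
pose Y := wint (fun x => q x * expR (- (t * x))).
rewrite -[tnum q t]/X -[tmass q t]/Y; have t0' := ltW t0.
have be := bdd_meas_expR t.
have bxe : bdd_meas (fun x => x * expR (- (t * x))) by exact: bdd_measM bdd_meas_id be.
have e0 x : 0 < x < 1 -> 0 <= expR (- (t * x)) by rewrite expR_ge0.
have xe0 x : 0 < x < 1 -> 0 <= x * expR (- (t * x)).
  by move=> /andP[x0 _]; rewrite mulr_ge0 ?expR_ge0// ltW.
pose A s := wint (fun x => (s < x)%R%:R * (x * expR (- (t * x)))).
pose B s := wint (fun x => (s < x)%R%:R * expR (- (t * x))).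
have mA : measurable_fun setT A by exact: measurable_wint_gt.
have mB : measurable_fun setT B by exact: measurable_wint_gt.
have A0 s : 0 <= A s by apply: wint_ge0 => x x01; rewrite mulr_ge0// xe0.
have B0 s : 0 <= B s by apply: wint_ge0 => x x01; rewrite mulr_ge0// e0.
have AB s : pkernel t s = A s - pmean t * B s.
  rewrite /A /B -mulNr -wintZ; last exact: bdd_measM (bdd_meas_gt _) be.
  rewrite -wintD.
  - by apply: eq_wint => x _; ring.
  - exact: bdd_measM (bdd_meas_gt _) bxe.
  - exact: bdd_measM (bdd_meas_cst _) (bdd_measM (bdd_meas_gt _) be).
have E0 := pmean_ge0 t0'.
have XE : (X%:E = \int[leb]_s (k s * A s)%:E)%E by exact: wint_layer.
have YE : ((pmean t * Y)%:E = \int[leb]_s (pmean t * (k s * B s))%:E)%E.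
  rewrite ge0_integral_EFinZ//; first by rewrite -wint_layer.
  - by apply: measurable_funM => //; case: bk.
  - by move=> s _; rewrite mulr_ge0.
have mkA : measurable_fun setT (fun s => k s * A s) by apply: measurable_funM => //; case: bk.
have mkB : measurable_fun setT (fun s => pmean t * (k s * B s)).
  by apply: measurable_funM => //; apply: measurable_funM => //; case: bk.
apply/andP; split.
  rewrite subr_ge0 -lee_fin XE YE; apply: ge0_le_integral_EFin => //.
  - by move=> s _; apply: mulr_ge0 => //; exact: mulr_ge0.
  - by move=> s _; rewrite mulrCA ler_wpM2l// -subr_ge0 -AB pkernel_ge0.
have CK0 : 0 <= CK / t.
  rewrite divr_ge0// /CK /CE addr_ge0 ?mulr_ge0 ?expR_ge0 ?(ltW C1_gt0) ?(ltW C2_gt0)//.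
  by rewrite addr_ge0 ?divr_ge0 ?(ltW T_gt0) ?(ltW l0_gt0)// !mulr_ge0 ?exprn_ge0 ?(ltW C2_gt0).
have bkxe := bdd_measM bk bxe.
have wkx0 s : 0 <= w s * (k s * (s * expR (- (t * s)))).
  have [/xe0 h|/w_out ->] := boolP (0 < s < 1); last by rewrite mul0r.
  by apply: mulr_ge0 => //; exact: mulr_ge0.
rewrite lerBlDl -lee_fin EFinD YE XE EFinM -wintE//.
rewrite -ge0_integral_EFinZ//; last first.
  by apply: measurable_funM => //; case: bkxe.
rewrite -ge0_integral_EFinD//.
- apply: ge0_le_integral_EFin => //.
  + apply: measurable_funD => //; apply: measurable_funM => //; apply: measurable_funM => //.
    by case: bkxe.
  + by move=> s _; rewrite mulr_ge0.
  + move=> s _; have [sl|/k_out ->] := boolP (0 < s <= l0); last first.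
      by rewrite !(mul0r, mulr0) addr0.
    have := pkernel_le t0 sl; rewrite AB lerBlDl => /(ler_wpM2l (k_ge0 s)).
    by move/le_trans; apply; rewrite le_eqVlt; apply/orP; left; apply/eqP; ring.
- by apply: measurable_funM => //; apply: measurable_funM => //; case: bkxe.
- by move=> s _; apply: mulr_ge0 => //; exact: mulr_ge0.
- by move=> s _; exact: mulr_ge0.
Qed.

Variable kap : R -> R.
Hypothesis bkap : bdd_meas kap.
Hypothesis kap_ge0 : forall x, 0 <= kap x.
Hypothesis q_ge0 : forall x, 0 < x < 1 -> 0 <= q x.
Hypothesis kq : forall x, 0 < x < 1 -> (k x * x) ^+ 2 <= q x * kap x.

(** By [kq] and Cauchy-Schwarz, the square of the bound in [posterior_shift] is at most (CK / t)^2
    times [tmass q t] times the integral of [kap]; this [tmass] is the one left in the denominator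
    by the squared difference of means. *)
Lemma posterior_shift_sqr t : 0 < t ->
  0 < tmass q t ->
  (tnum q t / tmass q t - pmean t) ^+ 2 * tmass q t <= (CK / t) ^+ 2 * wint (fun x => kap x * expR (- (t * x))).
Proof.
move=> t0.
pose X := wint (fun x => q x * (x * expR (- (t * x)))).
pose Y := wint (fun x => q x * expR (- (t * x))).
rewrite -[tnum q t]/X -[tmass q t]/Y => Y0; have t0' := ltW t0.
have be := bdd_meas_expR t.
have bxe : bdd_meas (fun x => x * expR (- (t * x))) by exact: bdd_measM bdd_meas_id be.
have /andP[D0 D1] := posterior_shift t0; rewrite -[tnum q t]/X -[tmass q t]/Y in D0 D1.
set Z := wint _ in D1; set V := wint _.
have V0 : 0 <= V by apply: wint_ge0 => x _; rewrite mulr_ge0 ?expR_ge0.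
have Z0 : 0 <= Z.
  by apply: wint_ge0 => x /andP[x0 _]; rewrite !mulr_ge0 ?expR_ge0// ltW.
have bqe := bdd_measM bq be.
have bve := bdd_measM bkap be.
(* AM-GM; the choice a = Z / Y below turns it into Cauchy-Schwarz. *)
have amgm a : 0 < a -> 2 * Z <= a * Y + a^-1 * V.
  move=> a0; rewrite -!wintZ//; last exact: bdd_measM.
  rewrite -wintD; last 2 first.
  - exact: bdd_measM (bdd_meas_cst _) bqe.
  - exact: bdd_measM (bdd_meas_cst _) bve.
  apply: le_wint => [||x x01].
  - exact: bdd_measM (bdd_meas_cst _) (bdd_measM bk bxe).
  - by apply: bdd_measD; apply: bdd_measM (bdd_meas_cst _) _.
  have /andP[x0 x1] := x01.
  rewrite !mulrA -mulrDl ler_pM2r ?expR_gt0//.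
  have h1 : 0 <= a * q x + a^-1 * kap x by rewrite addr_ge0 ?mulr_ge0 ?invr_ge0 ?q_ge0 ?(ltW a0).
  have h2 : 0 <= 2 * k x * x by rewrite !mulr_ge0// ltW.
  rewrite -(ler_pXn2r (n := 2))//.
  have -> : (2 * k x * x) ^+ 2 = 4 * (k x * x) ^+ 2 by ring.
  apply: le_trans (ler_wpM2l _ (kq x01)) _ => //.
  rewrite -subr_ge0.
  have -> : (a * q x + a^-1 * kap x) ^+ 2 - 4 * (q x * kap x) = (a * q x - a^-1 * kap x) ^+ 2.
    by field; rewrite gt_eqF.
  exact: sqr_ge0.
have CS : Z ^+ 2 <= Y * V.
  have [->|Zn0] := eqVneq Z 0; first by rewrite expr0n/= mulr_ge0// ltW.
  have Zp : 0 < Z by rewrite lt_def Zn0.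
  have := amgm (Z / Y) (divr_gt0 Zp Y0).
  rewrite divfK ?gt_eqF// invf_div (_ : 2 * Z = Z + Z); last by ring.
  by rewrite lerD2l mulrAC ler_pdivlMr// expr2.
have -> : (X / Y - pmean t) ^+ 2 * Y = (X - pmean t * Y) ^+ 2 / Y.
  by field; rewrite gt_eqF.
rewrite ler_pdivrMr// -[leRHS]mulrA [V * Y]mulrC.
apply: (@le_trans _ _ ((CK / t * Z) ^+ 2)).
  by apply: lerXn2r => //; rewrite nnegrE// (le_trans D0).
by rewrite exprMn ler_wpM2l ?sqr_ge0.
Qed.

End layer_cake.

(** * Blyth's method *)

Section bayes_risk.
Variable p : nat.
Hypothesis p_ge3 : (3 <= p)%N.
Local Notation lebv := (lebesgue_vect R p).
Implicit Types z : vect R p.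

Definition hsq z : R := vsqn z / 2.

Lemma hsq_ge0 z : 0 <= hsq z. Proof. by rewrite divr_ge0 ?vsqn_ge0. Qed.

Lemma measurable_hsq : measurable_fun setT hsq.
Proof. by apply: measurable_funM => //; exact: measurable_vsqn. Qed.

Lemma expR_hsq x z : expR (- (x / 2 * vsqn z)) = expR (- (hsq z * x)).
Proof. by congr (expR (- _)); rewrite /hsq; ring. Qed.

Lemma measurable_wint_param (G : R -> R -> R) :
  measurable_fun [set: R * R] (fun u => G u.1 u.2) ->
  (forall t, bdd_meas (G t)) -> (forall t x, 0 < x < 1 -> 0 <= G t x) ->
  measurable_fun [set: R] (fun t => wint (G t)).
Proof.
move=> mG bG G0; pose F (u : R * R) : \bar R := (w u.2 * G u.1 u.2)%:E.
have F0 u : (0 <= F u)%E.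
  rewrite lee_fin; have [u01|/w_out ->] := boolP (0 < u.2 < 1); last by rewrite mul0r.
  by rewrite mulr_ge0 ?G0.
have mF : measurable_fun setT F.
  apply/measurable_EFinP; apply: measurable_funM; first exact: measurableT_comp mw _.
  exact: mG.
apply/measurable_EFinP; have := measurable_fun_fubini_tonelli_F (m2 := leb) F mF F0.
by apply: eq_measurable_fun => t _ /=; rewrite -wintE.
Qed.

Lemma measurable_expR_prod : measurable_fun [set: R * R] (fun u : R * R => expR (- (u.1 * u.2))).
Proof.
by apply: measurableT_comp => //; apply: measurableT_comp => //; exact: measurable_funM.
Qed.

Lemma measurable_wint_expR (f : R -> R) : bdd_meas f -> (forall x, 0 < x < 1 -> 0 <= f x) ->
  measurable_fun [set: R] (fun t => wint (fun x => f x * expR (- (t * x)))).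
Proof.
move=> bf f0; apply: measurable_wint_param.
- apply: measurable_funM; last exact: measurable_expR_prod.
  by apply: (measurableT_comp bf.1).
- by move=> t; exact: bdd_measM bf (bdd_meas_expR t).
- by move=> t x x01; rewrite mulr_ge0 ?f0 ?expR_ge0.
Qed.

Section weighted.
Variable q : R -> R.
Hypothesis bq : bdd_meas q.
Hypothesis q_ge0 : forall x, 0 < x < 1 -> 0 <= q x.

Definition tmean t : R := tnum q t / tmass q t.

(** Unnormalised posterior variance of the mixing variable; times |z|^2 it measures the spread of
    the component means (1 - x) z around the overall posterior mean. *)
Definition tvar t : R := wint (fun x => q x * ((x - tmean t) ^+ 2 * expR (- (t * x)))).

(* The Bayes estimator when the weight w is replaced by w * q. *)
Definition testim z : vect R p := vscale (1 - tmean (hsq z)) z.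

Let bqe t : bdd_meas (fun x => q x * expR (- (t * x))).
Proof. exact: bdd_measM bq (bdd_meas_expR t). Qed.

Let bqxe t : bdd_meas (fun x => q x * (x * expR (- (t * x)))).
Proof. exact: bdd_measM bq (bdd_measM bdd_meas_id (bdd_meas_expR t)). Qed.

Let bqxxe t : bdd_meas (fun x => q x * (x ^+ 2 * expR (- (t * x)))).
Proof. exact: bdd_measM bq (bdd_measM (bdd_measM bdd_meas_id bdd_meas_id) (bdd_meas_expR t)). Qed.

Lemma tmass_ge0 t : 0 <= tmass q t.
Proof. by apply: wint_ge0 => x x01; rewrite mulr_ge0 ?expR_ge0 ?q_ge0. Qed.

Lemma measurable_tmass : measurable_fun [set: R] (tmass q).
Proof. exact: measurable_wint_expR. Qed.

Lemma measurable_tnum : measurable_fun [set: R] (tnum q).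
Proof.
have := measurable_wint_expR (bdd_measM bq bdd_meas_id) _.
have h x : 0 < x < 1 -> 0 <= q x * x.
  by move=> x01; rewrite mulr_ge0 ?q_ge0//; case/andP: x01 => /ltW.
move=> /(_ h); apply: eq_measurable_fun => t _.
by apply: eq_wint => x _; rewrite mulrA.
Qed.

Lemma measurable_tmean : measurable_fun [set: R] tmean.
Proof.
apply: measurable_funM; first exact: measurable_tnum.
by apply: measurable_invr; exact: measurable_tmass.
Qed.

Lemma measurable_testim : measurable_fun [set: vect R p] testim.
Proof.
apply: measurable_vscale => //; apply: measurable_funB => //.
exact: (measurableT_comp measurable_tmean measurable_hsq).
Qed.

Lemma tvar_ge0 t : 0 <= tvar t.
Proof.
apply: wint_ge0 => x x01; apply: mulr_ge0; first exact: q_ge0.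
by apply: mulr_ge0; [exact: sqr_ge0|exact: expR_ge0].
Qed.

Lemma measurable_tvar : measurable_fun [set: R] tvar.
Proof.
apply: measurable_wint_param.
- apply: measurable_funM; first by apply: (measurableT_comp bq.1).
  apply: measurable_funM; last exact: measurable_expR_prod.
  apply: measurable_funX; apply: measurable_funB => //.
  exact: (measurableT_comp measurable_tmean).
- move=> t; have b1 : bdd_meas (fun x => x - tmean t) by exact: bdd_measD bdd_meas_id (bdd_meas_cst _).
  exact: bdd_measM bq (bdd_measM (bdd_measM b1 b1) (bdd_meas_expR t)).
- move=> t x x01; apply: mulr_ge0; first exact: q_ge0.
  by apply: mulr_ge0; [exact: sqr_ge0|exact: expR_ge0].
Qed.

Lemma tvarE t : 0 < tmass q t ->
  tvar t = wint (fun x => q x * (x ^+ 2 * expR (- (t * x)))) - tmean t ^+ 2 * tmass q t.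
Proof.
move=> m0; have E : tnum q t = tmean t * tmass q t by rewrite divfK// gt_eqF.
transitivity (wint (fun x => q x * (x ^+ 2 * expR (- (t * x))) +
   (- (2 * tmean t) * (q x * (x * expR (- (t * x)))) +
    tmean t ^+ 2 * (q x * expR (- (t * x)))))).
  by apply: eq_wint => x _; ring.
rewrite wintD//; last first.
  by apply: bdd_measD; apply: bdd_measM (bdd_meas_cst _) _.
rewrite wintD//; last 2 first.
- exact: bdd_measM (bdd_meas_cst _) _.
- exact: bdd_measM (bdd_meas_cst _) _.
have hX : wint (fun x => q x * (x * expR (- (t * x)))) = tnum q t by [].
have hY : wint (fun x => q x * expR (- (t * x))) = tmass q t by [].
by rewrite !wintZ// hX hY E; ring.
Qed.

(* Pythagoras: the posterior mean minimises the posterior expected loss. *)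
Lemma wint_vsqd d z : 0 < tmass q (hsq z) ->
  wint (fun x => q x * (expR (- (x / 2 * vsqn z)) * vsqd d (vscale (1 - x) z))) =
  vsqn z * tvar (hsq z) + tmass q (hsq z) * vsqd d (testim z).
Proof.
set t := hsq z => m0.
pose b0 := vsqd d z; pose b1 := \sum_(i < p) ((tnth d i : R) - tnth z i) * (tnth z i : R).
have vE y : vsqd d (vscale (1 - y) z) = b0 + 2 * y * b1 + y ^+ 2 * vsqn z.
  rewrite /vsqd /b0 /b1 /vsqn !mulr_sumr -!big_split/=; apply: eq_bigr => i _.
  by rewrite tnth_mktuple; ring.
transitivity (wint (fun x => b0 * (q x * expR (- (t * x))) +
   (2 * b1 * (q x * (x * expR (- (t * x)))) +
    vsqn z * (q x * (x ^+ 2 * expR (- (t * x))))))).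
  by apply: eq_wint => x _; rewrite vE expR_hsq -/t; ring.
rewrite wintD//; last 2 first.
- exact: bdd_measM (bdd_meas_cst _) _.
- by apply: bdd_measD; apply: bdd_measM (bdd_meas_cst _) _.
rewrite wintD//; last 2 first.
- exact: bdd_measM (bdd_meas_cst _) _.
- exact: bdd_measM (bdd_meas_cst _) _.
have hX : wint (fun x => q x * (x * expR (- (t * x)))) = tnum q t by [].
have hY : wint (fun x => q x * expR (- (t * x))) = tmass q t by [].
rewrite !wintZ// vE tvarE// hX hY -/t.
have -> : tnum q t = tmean t * tmass q t by rewrite divfK// gt_eqF.
ring.
Qed.

Hypothesis q_mass : forall z, 0 < tmass q (hsq z).
Variable x0 : R.
Hypothesis x0_gt0 : 0 < x0.
Hypothesis q_out : forall x, x <= x0 -> q x = 0.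

(** Since q vanishes up to [x0], the variance is at most a constant times exp(- x0 |z|^2 / 2). This
    finiteness is what the truncation buys: the term can be cancelled when two estimators are
    compared. *)
Lemma integral_tvar : (\int[lebv]_z (vsqn z * tvar (hsq z))%:E < +oo)%E.
Proof.
have [_ [B qB]] := bq.
pose c := wint (fun x => q x).
have c0 : 0 <= c by apply: wint_ge0.
apply: (@le_lt_trans _ _ (\int[lebv]_z (c * (vsqn z * expR (- (x0 / 2 * vsqn z))))%:E)%E).
  apply: ge0_le_integral_EFin => //.
  - apply: measurable_funM; first exact: measurable_vsqn.
    exact: (measurableT_comp measurable_tvar measurable_hsq).
  - apply: measurable_funM => //; apply: measurable_funM; first exact: measurable_vsqn.
    exact: measurable_expR_vsqn.
  - by move=> z _; rewrite mulr_ge0 ?vsqn_ge0 ?tvar_ge0.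
  - move=> z _; rewrite mulrCA ler_wpM2l ?vsqn_ge0// expR_hsq tvarE//.
    set t := hsq z; have t0 : 0 <= t by exact: hsq_ge0.
    apply: (@le_trans _ _ (wint (fun x => q x * (x ^+ 2 * expR (- (t * x)))))).
      by rewrite gerBl mulr_ge0 ?sqr_ge0 ?tmass_ge0.
    rewrite mulrC -wintZ//; apply: le_wint => // [|x x01].
      exact: bdd_measM (bdd_meas_cst _) bq.
    have [/q_out ->|x0x] := leP x x0; first by rewrite mul0r mulr0.
    rewrite mulrC ler_wpM2r ?q_ge0//.
    have /andP[xp x1] := x01.
    apply: (@le_trans _ _ (expR (- (t * x)))).
      by rewrite ler_piMl ?expR_ge0// expr_le1 ?ltW.
    by rewrite ler_expR lerN2 ler_wpM2l// ltW.
rewrite ge0_integral_EFinZ//.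
- rewrite lte_mul_pinfty ?lee_fin// ?integral_vsqn_expR//.
- apply: measurable_funM; [exact: measurable_vsqn|exact: measurable_expR_vsqn].
- by move=> z _; rewrite mulr_ge0 ?expR_ge0 ?vsqn_ge0.
Qed.

Lemma integral_wint_swap (F : R -> vect R p -> R) :
  measurable_fun [set: R * vect R p] (fun u => F u.1 u.2) ->
  (forall x z, 0 < x < 1 -> 0 <= F x z) -> (forall z, bdd_meas (F ^~ z)) ->
  (\int[leb]_x ((w x)%:E * \int[lebv]_z (F x z)%:E) = \int[lebv]_z (wint (F ^~ z))%:E)%E.
Proof.
move=> mF F0 bF; pose H (u : R * vect R p) : \bar R := (w u.1 * F u.1 u.2)%:E.
have H0 u : (0 <= H u)%E.
  rewrite lee_fin; have [u01|/w_out ->] := boolP (0 < u.1 < 1); last by rewrite mul0r.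
  by rewrite mulr_ge0 ?F0.
have mH : measurable_fun setT H.
  by apply/measurable_EFinP; apply: measurable_funM => //; exact: measurableT_comp mw _.
transitivity (\int[leb]_x \int[lebv]_z H (x, z))%E.
  apply: eq_integral => x _; have [x01|/w_out wx] := boolP (0 < x < 1); last first.
    by rewrite wx mul0e integral0_eq// => z _; rewrite /H/= wx mul0r.
  rewrite -ge0_integral_EFinZ//.
  - exact: measurableT_comp mF (measurable_pair1 x).
  - by move=> z _; exact: F0.
rewrite fubini_tonelli//; apply: eq_integral => z _.
by rewrite -wintE.
Qed.

(** [le_risk_mix] is integrated in x against w q and the order of integration exchanged; by
    [wint_vsqd] both sides then contain the same finite variance term, which cancels. *)
Lemma le_integral_testim (d d' : vect R p -> vect R p) :
  measurable_fun setT d -> measurable_fun setT d' ->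
  (forall mu, risk d' mu <= risk d mu)%E ->
  (\int[lebv]_z (tmass q (hsq z) * vsqd (d' z) (testim z))%:E <=
   \int[lebv]_z (tmass q (hsq z) * vsqd (d z) (testim z))%:E)%E.
Proof.
move=> md md' dd.
pose F (f : vect R p -> vect R p) x z :=
  q x * (expR (- (x / 2 * vsqn z)) * vsqd (f z) (vscale (1 - x) z)).
have mF f : measurable_fun setT f -> measurable_fun [set: R * vect R p] (fun u => F f u.1 u.2).
  move=> mf; apply: measurable_funM; first by apply: (measurableT_comp bq.1).
  apply: measurable_funM.
    apply: measurableT_comp => //; apply: measurableT_comp => //; apply: measurable_funM => //.
      exact: measurable_funM.
    exact: (measurableT_comp (@measurable_vsqn R p) measurable_snd).
  apply: measurable_vsqd; first exact: (measurableT_comp mf).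
  by apply: measurable_vscale => //; exact: measurable_funB.
have F0 f x z : 0 < x < 1 -> 0 <= F f x z.
  by move=> x01; rewrite !mulr_ge0 ?q_ge0 ?expR_ge0 ?vsqd_ge0.
have bF f z : bdd_meas (F f ^~ z).
  apply: bdd_measM bq _; apply: bdd_measM.
    by under eq_fun do rewrite expR_hsq; exact: bdd_meas_expR.
  (* As a function of x the loss is a polynomial of degree at most 2, hence bounded on ]0, 1[. *)
  under eq_fun => x.
    rewrite (_ : vsqd _ _ = vsqd (f z) z + (2 * \sum_(i < p) ((tnth (f z) i : R) - tnth z i) * (tnth z i : R)) * x
      + vsqn z * (x * x)); last first.
      rewrite /vsqd /vsqn mulr_sumr !mulr_suml -!big_split/=; apply: eq_bigr => i _.
      by rewrite tnth_mktuple; ring.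
    over.
  apply: bdd_measD; last exact: bdd_measM (bdd_meas_cst _) (bdd_measM bdd_meas_id bdd_meas_id).
  exact: bdd_measD (bdd_meas_cst _) (bdd_measM (bdd_meas_cst _) bdd_meas_id).
have mI f : measurable_fun setT f -> measurable_fun setT (fun z => vsqd (f z) (testim z)).
  by move=> mf; apply: measurable_vsqd => //; exact: measurable_testim.
have mm : measurable_fun setT (fun z => tmass q (hsq z)).
  exact: (measurableT_comp measurable_tmass measurable_hsq).
have mv : measurable_fun setT (fun z => vsqn z * tvar (hsq z)).
  apply: measurable_funM; first exact: measurable_vsqn.
  exact: (measurableT_comp measurable_tvar measurable_hsq).
have key f : measurable_fun setT f ->
    (\int[leb]_x ((w x)%:E * \int[lebv]_z (F f x z)%:E) =
     \int[lebv]_z (vsqn z * tvar (hsq z))%:E +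
     \int[lebv]_z (tmass q (hsq z) * vsqd (f z) (testim z))%:E)%E.
  move=> mf; rewrite (integral_wint_swap (mF f mf) (F0 f) (bF f)).
  rewrite -ge0_integral_EFinD//.
  - by apply: eq_integral => z _; rewrite wint_vsqd.
  - by apply: measurable_funM => //; exact: mI.
  - by move=> z _; rewrite mulr_ge0 ?vsqn_ge0 ?tvar_ge0.
  - by move=> z _; rewrite mulr_ge0 ?tmass_ge0 ?vsqd_ge0.
have Vfin : (\int[lebv]_z (vsqn z * tvar (hsq z))%:E)%E \is a fin_num.
  rewrite ge0_fin_numE ?integral_tvar//; apply: integral_ge0 => z _.
  by rewrite lee_fin mulr_ge0 ?vsqn_ge0 ?tvar_ge0.
rewrite -(leeD2lE _ _ Vfin) -(key d' md') -(key d md).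
have mFx f x : measurable_fun setT f -> measurable_fun setT (F f x).
  by move=> mf; exact: measurableT_comp (mF f mf) (measurable_pair1 x).
have mW f : measurable_fun setT f ->
    measurable_fun setT (fun x => (w x)%:E * \int[lebv]_z (F f x z)%:E)%E.
  (* [F] is known to be nonnegative only for 0 < x < 1; the absolute value makes Tonelli applicable,
     and [w] vanishes elsewhere. *)
  move=> mf; pose F' (u : R * vect R p) : \bar R := (`|F f u.1 u.2|)%:E.
  have mI' : measurable_fun [set: R] (fun x : R => \int[lebv]_z F' (x, z))%E.
    apply: measurable_fun_fubini_tonelli_F => //.
      by apply/measurable_EFinP; apply: measurableT_comp => //; exact: mF.
    by move=> u; rewrite lee_fin.
  have mwE : measurable_fun [set: R] (fun x : R => (w x)%:E) by exact/measurable_EFinP.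
  have := emeasurable_funM mwE mI'.
  apply: eq_measurable_fun => x _.
  have [x01|/w_out ->] := boolP (0 < x < 1); last by rewrite !mul0e.
  by congr (_ * _)%E; apply: eq_integral => z _; rewrite /F'/= ger0_norm// F0.
apply: ge0_le_integral => //.
- move=> x _; have [x01|/w_out ->] := boolP (0 < x < 1); last by rewrite mul0e.
  rewrite mule_ge0 ?lee_fin//; apply: integral_ge0 => z _; rewrite lee_fin; exact: F0.
- exact: mW.
- exact: mW.
move=> x _; have [x01|/w_out ->] := boolP (0 < x < 1); last by rewrite !mul0e.
apply: lee_wpmul2l; first by rewrite lee_fin.
have := le_risk_mix md md' dd x01.
have mE f : measurable_fun setT f -> measurable_fun setT
    (fun z => expR (- (x / 2 * vsqn z)) * vsqd (f z) (vscale (1 - x) z)).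
  move=> mf; apply: measurable_funM; first exact: measurable_expR_vsqn.
  by apply: measurable_vsqd => //; exact: measurable_vscale.
rewrite /F !ge0_integral_EFinZ ?q_ge0//; try exact: mE.
- by apply: lee_wpmul2l; rewrite lee_fin q_ge0.
- by move=> z _; rewrite mulr_ge0 ?expR_ge0 ?vsqd_ge0.
- by move=> z _; rewrite mulr_ge0 ?expR_ge0 ?vsqd_ge0.
Qed.

End weighted.

(** Coefficient of x^(1 - p/2) in the integral over u > 0 of (1/2) (2 pi / (x + u))^(p/2), which
    converges because p/2 > 1. *)
Definition inv_moment : R := (2 * pi) `^ (p%:R / 2) / 2 / (p%:R / 2 - 1).

Let p2_gt0 : 0 < p%:R / 2 - 1 :> R.
Proof. by have : (3 : R) <= p%:R by [rewrite ler_nat]; lra. Qed.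

Lemma inv_moment_ge0 : 0 <= inv_moment.
Proof. by rewrite !divr_ge0 ?powR_ge0// ltW. Qed.

(* |z|^-2 is a mixture of Gaussians, which avoids polar coordinates. *)
Lemma integral_inv_vsqn x : 0 < x ->
  (\int[lebv]_z ((vsqn z)^-1 * expR (- (x / 2 * vsqn z)))%:E <=
   (inv_moment * x `^ (1 - p%:R / 2))%:E)%E.
Proof.
move=> x0.
pose U : set R := `[0%R, +oo[%classic.
pose H (u : R * vect R p) : \bar R :=
  ((u.1 \in U)%:R * (2^-1 * expR (- ((x + u.1) / 2 * vsqn u.2))))%:E.
have H0 u : (0 <= H u)%E by rewrite lee_fin !mulr_ge0 ?expR_ge0.
have mU : measurable_fun setT (fun u : R * vect R p => u.1 \in U).
  rewrite (_ : (fun u => _) = (fun u : R * vect R p => 0 <= u.1)); last first.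
    by apply/funext => u; rewrite mem_setE in_itv/= andbT.
  exact: measurable_fun_ler.
have mH : measurable_fun setT H.
  apply/measurable_EFinP; apply: measurable_funM; first exact: measurable_natr.
  apply: measurable_funM => //; apply: measurableT_comp => //; apply: measurableT_comp => //.
  apply: measurable_funM; last exact: (measurableT_comp (@measurable_vsqn R p) measurable_snd).
  by apply: measurable_funM => //; exact: measurable_funD.
have mexp z : measurable_fun setT (fun u : R => expR (- ((x + u) / 2 * vsqn z))).
  apply: measurableT_comp => //; apply: measurableT_comp => //.
  by apply: measurable_funM => //; apply: measurable_funM => //; exact: measurable_funD.
apply: (@le_trans _ _ (\int[lebv]_z \int[leb]_u H (u, z))%E).
  apply: ge0_le_integral => //.
  - by move=> z _; rewrite lee_fin mulr_ge0 ?invr_ge0 ?vsqn_ge0 ?expR_ge0.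
  - apply/measurable_EFinP; apply: measurable_funM; last exact: measurable_expR_vsqn.
    by apply: measurable_invr; exact: measurable_vsqn.
  - exact: measurable_fun_fubini_tonelli_G.
  (* At z = 0 the inverse is 0 by convention whereas the mixture is infinite, hence an
     inequality. *)
  - move=> z _; have [->|z0] := eqVneq (vsqn z) 0.
      by rewrite invr0 mul0r; apply: integral_ge0 => u _; exact: H0.
    have zp : 0 < vsqn z by rewrite lt_def z0 vsqn_ge0.
    have z2 : 0 < vsqn z / 2 by rewrite divr_gt0.
    rewrite le_eqVlt; apply/orP; left; apply/eqP; apply/esym.
    transitivity (\int[leb]_(u in U) (2^-1 * expR (- (x / 2 * vsqn z)) *
        expR (- (vsqn z / 2 * u)))%:E)%E.
      rewrite [RHS]integral_mkcond; apply: eq_integral => u _.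
      rewrite /H/= patchE; case: ifP => _; last by rewrite mul0r.
      by rewrite mul1r -[in RHS]mulrA -expRD; congr (_ * expR _)%:E; field.
    have mU' : measurable U by exact: measurable_itv.
    have K0 : 0 <= 2^-1 * expR (- (x / 2 * vsqn z)) by rewrite mulr_ge0 ?expR_ge0.
    have me : measurable_fun U (fun u => expR (- (vsqn z / 2 * u))).
      by apply: measurable_funTS; exact: (bdd_meas_expR (vsqn z / 2)).1.
    rewrite (ge0_integral_EFinZ leb mU' K0 me); last by move=> u _; exact: expR_ge0.
    rewrite /U integral_expR_tail// -EFinM mulr0 oppr0 expR0; congr (_%:E).
    by field; rewrite gt_eqF.
rewrite -fubini_tonelli//.
pose r : R := p%:R / 2 - 1.
have K0 : 0 <= (2 * pi) `^ (p%:R / 2) / 2 :> R by rewrite divr_ge0// powR_ge0.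
rewrite (_ : (\int[leb]_u _)%E =
    (\int[leb]_(u in U) ((2 * pi) `^ (p%:R / 2) / 2 * (x + u) `^ (- (r + 1)))%:E)%E); last first.
  rewrite [RHS]integral_mkcond; apply: eq_integral => u _; rewrite patchE /H/=.
  case: ifPn => uU; last by rewrite integral0_eq// => z _; rewrite mul0r.
  have xu : 0 < x + u by move: uU; rewrite mem_setE in_itv/= andbT => u0; rewrite ltr_pwDl.
  under eq_integral do rewrite mul1r.
  rewrite ge0_integral_EFinZ//; last exact: measurable_expR_vsqn.
  rewrite integral_expR_vsqn// -EFinM; congr (_%:E).
  have -> : - (r + 1) = - 1 * (p%:R / 2) by rewrite /r; ring.
  rewrite [_ `^ (-1 * _)]powRrM powR_inv1 ?(ltW xu)// [in LHS]powRM ?mulr_ge0 ?pi_ge0 ?invr_ge0 ?(ltW xu)//.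
  ring.
have mP : measurable_fun U (fun u => (x + u) `^ (- (r + 1))).
  by apply: measurable_funTS; apply: measurable_powRT; exact: measurable_funD.
have mU' : measurable U by exact: measurable_itv.
rewrite (ge0_integral_EFinZ leb mU' K0 mP); last by move=> u _; exact: powR_ge0.
rewrite integral_powR_tail// -EFinM /inv_moment -/r lee_fin le_eqVlt; apply/orP; left; apply/eqP.
by rewrite (_ : 1 - p%:R / 2 = - r); [ring|rewrite /r; ring].
Qed.

Lemma vsqd_triangle (x y z : vect R p) : vsqd x y <= 2 * (vsqd x z + vsqd y z).
Proof.
rewrite /vsqd -big_split/= mulr_sumr; apply: ler_sum => i _.
rewrite -subr_ge0 (_ : _ - _ = ((tnth x i : R) + tnth y i - 2 * tnth z i) ^+ 2) ?sqr_ge0//.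
by ring.
Qed.

Lemma vsqd_eq0 (x y : vect R p) : vsqd x y = 0 -> x = y.
Proof.
move=> /eqP; rewrite /vsqd psumr_eq0 => [/allP h|i _]; last exact: sqr_ge0.
apply: eq_from_tnth => i; apply/eqP; rewrite -subr_eq0 -sqrf_eq0.
by apply: h; rewrite mem_index_enum.
Qed.

(** * Convergence of the truncated estimators and admissibility *)

Section conclusion.
Variable C3 : R.
Hypothesis C3_ge0 : 0 <= C3.
(** The growth condition on L seen from the weight: w(x) x^(1 - p/2) will be x^(a + 1) L(1/x). *)
Hypothesis w_tail : forall x, 0 < x <= l0 / 2 ->
  w x * x `^ (1 - p%:R / 2) <= C3 * (- ln x / x).

(** Half of [l0], so that [w_le_wint] at s = l0 bounds the mass of ]l1, l0] from below. *)
Let l1 : R := l0 / 2.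
Let l1_gt0 : 0 < l1. Proof. by rewrite divr_gt0. Qed.
Let l1_lt : l1 < l0. Proof. by rewrite /l1 ltr_pdivrMr// ltr_pMr// ltr1n. Qed.
Let l1_lt1 : l1 < 1. Proof. exact: lt_trans l1_lt l0_lt1. Qed.

Definition bayes_estim z : vect R p := vscale (1 - pmean (hsq z)) z.

Lemma measurable_bayes_estim : measurable_fun setT bayes_estim.
Proof.
apply: measurable_vscale => //; apply: measurable_funB => //.
have mm := measurable_tmean (bdd_meas_cst 1) (fun x _ => ler01).
have := measurableT_comp mm measurable_hsq.
apply: eq_measurable_fun => z _ /=; rewrite /tmean /pmean /tnum /tmass /pmass.
by congr (_ / _); apply: eq_wint => x _; rewrite mul1r.
Qed.

(** All cutoffs equal 1 beyond [l1], so this positive mass is a lower bound for every truncated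
    marginal, uniformly in n; it is the weight against which two estimators are finally compared. *)
Definition base_mass t : R := wint (fun x => (l1 < x <= l0)%R%:R * expR (- (t * x))).

Let bdd_base : bdd_meas (fun x => (l1 < x <= l0)%R%:R : R).
Proof.
apply: bdd_meas_natr.
by apply: measurable_and; [exact: measurable_fun_ltr|exact: measurable_fun_ler].
Qed.

Lemma base_mass_gt0 t : 0 <= t -> 0 < base_mass t.
Proof.
move=> t0; have l00 : 0 < l0 <= l0 by rewrite l0_gt0 lexx.
have := w_le_wint t0 l00; rewrite -/l1 -/(base_mass t) => h.
have : 0 < 2 ^+ M.+1 * C2 * base_mass t.
  by apply: lt_le_trans h; rewrite !mulr_gt0 ?expR_gt0// w_gt0.
by rewrite pmulr_rgt0// mulr_gt0// exprn_gt0.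
Qed.

Lemma tmass_ge_base n t : (0 < n)%N -> base_mass t <= tmass (qcut l1 n) t.
Proof.
move=> n0; apply: le_wint => [||x x01].
- exact: bdd_measM bdd_base (bdd_meas_expR t).
- by apply: bdd_measM (bdd_meas_expR t); exact: bdd_qcut.
- by rewrite ler_wpM2r ?expR_ge0// qcut_ge.
Qed.

Let q_mass n : (0 < n)%N -> forall z, 0 < tmass (qcut l1 n) (hsq z).
Proof.
by move=> n0 z; apply: lt_le_trans (tmass_ge_base _ n0); exact: base_mass_gt0 (hsq_ge0 z).
Qed.

(** Both estimators are multiples of z, so their squared distance is |z|^2 times a squared
    difference of means. With t = |z|^2 / 2, |z|^2 (CK / t)^2 = (2 CK)^2 / |z|^2; at z = 0 both
    sides are 0. *)
Lemma testim_diff n z : (0 < n)%N ->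
  tmass (qcut l1 n) (hsq z) * vsqd (bayes_estim z) (testim (qcut l1 n) z) <=
  (2 * CK) ^+ 2 * ((vsqn z)^-1 * wint (fun x => kapcut l1 n x * expR (- (hsq z * x)))).
Proof.
move=> n0; set q := qcut l1 n; set t := hsq z.
have V0 : 0 <= wint (fun x => kapcut l1 n x * expR (- (t * x))).
  by apply: wint_ge0 => x _; rewrite mulr_ge0 ?expR_ge0 ?kapcut_ge0.
rewrite vsqd_scale -/t.
have [z0|z0] := eqVneq (vsqn z) 0.
  by rewrite z0 !mulr0 invr0 mul0r mulr0.
have zp : 0 < vsqn z by rewrite lt_def z0 vsqn_ge0.
have t0 : 0 < t by rewrite /t /hsq divr_gt0.
have q0 x : 0 < x < 1 -> 0 <= q x by move=> _; exact: qcut_ge0.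
have bq : bdd_meas q by exact: bdd_qcut.
have bk : bdd_meas (kcut l1 n) by exact: bdd_kcut.
have k0 s : 0 <= kcut l1 n s by exact: kcut_ge0.
have bkap : bdd_meas (kapcut l1 n) by exact: bdd_kapcut.
have kap0 s : 0 <= kapcut l1 n s by exact: kapcut_ge0.
have qi x : 0 < x < 1 -> (q x)%:E = (\int[leb]_s ((s < x)%R%:R * kcut l1 n s)%:E)%E.
  exact: qcut_int.
have kq x : 0 < x < 1 -> (kcut l1 n x * x) ^+ 2 <= q x * kapcut l1 n x by exact: kq_cut.
have ko s : ~~ (0 < s <= l0) -> kcut l1 n s = 0.
  move=> h; apply: kcut_out => //; apply: contra h => /andP[-> sl]/=.
  exact: le_trans sl (ltW l1_lt).
have := posterior_shift_sqr bq bk k0 ko qi bkap kap0 q0 kq t0 (q_mass n0 z).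
rewrite -/(tmean q t) => h.
have -> : tmass q t * ((1 - pmean t - (1 - tmean q t)) ^+ 2 * vsqn z) =
   vsqn z * ((tmean q t - pmean t) ^+ 2 * tmass q t) by ring.
apply: le_trans (ler_wpM2l (ltW zp) h) _.
rewrite le_eqVlt; apply/orP; left; apply/eqP.
by rewrite /t /hsq; field; rewrite gt_eqF.
Qed.

Definition shift_const : R := (2 * CK) ^+ 2 * (inv_moment * (4 * C3)).

(** After exchanging integrals, [integral_inv_vsqn] and [w_tail] bound the integrand in x by a
    multiple of [kapcut] times (- ln x) / x, that is of 1 / (n^2 x (- ln x)) on the cut, whose
    integral is of order 1 / n. *)
Lemma integral_testim_diff n : (0 < n)%N ->
  (\int[lebv]_z (tmass (qcut l1 n) (hsq z) * vsqd (bayes_estim z) (testim (qcut l1 n) z))%:E <=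
   (shift_const / n%:R)%:E)%E.
Proof.
move=> n0; set q := qcut l1 n; set kap := kapcut l1 n.
have nR : 0 < n%:R :> R by rewrite ltr0n.
have bq : bdd_meas q by exact: bdd_qcut.
have q0 x : 0 < x < 1 -> 0 <= q x by move=> _; exact: qcut_ge0.
have bk : bdd_meas kap by exact: bdd_kapcut.
have k0 x : 0 <= kap x by exact: kapcut_ge0.
pose F x z := (vsqn z)^-1 * (kap x * expR (- (hsq z * x))).
have minv : measurable_fun setT (fun z : vect R p => (vsqn z)^-1).
  by apply: measurable_invr; exact: measurable_vsqn.
have mk : measurable_fun setT (fun z => wint (fun x => kap x * expR (- (hsq z * x)))).
  exact: (measurableT_comp (measurable_wint_expR bk (fun x _ => k0 x)) measurable_hsq).
have mF : measurable_fun [set: R * vect R p] (fun u => F u.1 u.2).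
  apply: measurable_funM; first exact: (measurableT_comp minv measurable_snd).
  apply: measurable_funM; first by apply: (measurableT_comp bk.1).
  apply: measurableT_comp => //; apply: measurableT_comp => //; apply: measurable_funM => //.
  exact: (measurableT_comp measurable_hsq measurable_snd).
have F0 x z : 0 < x < 1 -> 0 <= F x z.
  move=> _; apply: mulr_ge0; first by rewrite invr_ge0 vsqn_ge0.
  exact: mulr_ge0 (k0 x) (expR_ge0 _).
have bF z : bdd_meas (F ^~ z).
  exact: bdd_measM (bdd_meas_cst _) (bdd_measM bk (bdd_meas_expR _)).
have me := measurable_bayes_estim.
apply: (@le_trans _ _ (\int[lebv]_z ((2 * CK) ^+ 2 * wint (F ^~ z))%:E)%E).
  apply: ge0_le_integral_EFin => //.
  - apply: measurable_funM; first exact: (measurableT_comp (measurable_tmass bq q0) measurable_hsq).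
    by apply: measurable_vsqd => //; exact: measurable_testim.
  - apply: measurable_funM => //.
    rewrite (_ : (fun z => _) = fun z => (vsqn z)^-1 * wint (fun x => kap x * expR (- (hsq z * x)))).
      exact: measurable_funM.
    by apply/funext => z; rewrite wintZ//; exact: bdd_measM bk (bdd_meas_expR _).
  - by move=> z _; rewrite mulr_ge0 ?vsqd_ge0 ?(ltW (q_mass n0 z)).
  - move=> z _; rewrite [X in _ <= _ * X]wintZ; last exact: bdd_measM bk (bdd_meas_expR _).
    exact: testim_diff.
have mW : measurable_fun setT (fun z => wint (F ^~ z)).
  rewrite (_ : (fun z => _) = fun z => (vsqn z)^-1 * wint (fun x => kap x * expR (- (hsq z * x)))).
    exact: measurable_funM.
  by apply/funext => z; rewrite wintZ//; exact: bdd_measM bk (bdd_meas_expR _).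
rewrite (ge0_integral_EFinZ lebv measurableT (sqr_ge0 _) mW); last first.
  by move=> z _; apply: wint_ge0 => x x01; exact: F0.
rewrite -(integral_wint_swap mF F0 bF) /shift_const -mulrA [leRHS]EFinM.
apply: lee_wpmul2l; first by rewrite lee_fin sqr_ge0.
apply: (@le_trans _ _ (\int[leb]_x (inv_moment * (4 * C3) / n%:R ^+ 2 *
    ((xcut l1 n < x <= l1)%R%:R * (x * - ln x)^-1))%:E)%E); last first.
  have K0 : 0 <= inv_moment * (4 * C3) / n%:R ^+ 2.
    by rewrite divr_ge0 ?sqr_ge0// mulr_ge0 ?inv_moment_ge0// mulr_ge0.
  have ml : measurable_fun [set: R] (fun x => (xcut l1 n < x <= l1)%R%:R * (x * - ln x)^-1).
    apply: measurable_funM; first by apply: measurable_natr; exact: measurable_cut.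
    by apply: measurable_invr; apply: measurable_funM => //; exact: measurableT_comp.
  rewrite (ge0_integral_EFinZ leb measurableT K0 ml); last first.
    move=> x _; case: (boolP (_ < x <= l1)) => [/andP[cx xl]|_]; last by rewrite mul0r.
    have x0 : 0 < x by apply: lt_trans cx; exact: expR_gt0.
    by rewrite mul1r invr_ge0 mulr_ge0 ?(ltW x0)// oppr_ge0 ln_le0// (le_trans xl)// ltW.
  rewrite integral_inv_log// -EFinM lee_fin le_eqVlt; apply/orP; left; apply/eqP.
  by field; rewrite gt_eqF.
have F00 x z : 0 <= F x z.
  apply: mulr_ge0; first by rewrite invr_ge0 vsqn_ge0.
  exact: mulr_ge0 (k0 x) (expR_ge0 _).
have mI : measurable_fun [set: R] (fun x : R => \int[lebv]_z (F x z)%:E)%E.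
  apply: (@measurable_fun_fubini_tonelli_F _ _ _ _ _ lebv (fun u : R * vect R p => (F u.1 u.2)%:E)).
    exact/measurable_EFinP.
  by move=> u; rewrite lee_fin.
have mwE : measurable_fun [set: R] (fun x : R => (w x)%:E) by exact/measurable_EFinP.
apply: ge0_le_integral => //.
- by move=> x _; rewrite mule_ge0 ?lee_fin//; apply: integral_ge0 => z _; rewrite lee_fin.
- exact: emeasurable_funM.
- apply/measurable_EFinP; apply: measurable_funM => //.
  apply: measurable_funM; first by apply: measurable_natr; exact: measurable_cut.
  by apply: measurable_invr; apply: measurable_funM => //; exact: measurableT_comp.
move=> x _; case: (boolP (xcut l1 n < x <= l1)) => [/andP[cx xl]|nx]; last first.
  rewrite mul0r mulr0 integral0_eq ?mule0// => z _.
  by rewrite /F /kap /kapcut (negbTE nx) !(mul0r, mulr0).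
have x0 : 0 < x by apply: lt_trans cx; exact: expR_gt0.
have x1 : x < 1 by exact: le_lt_trans l1_lt1.
have lx : 0 < - ln x by rewrite oppr_gt0 ln_lt0// x0.
rewrite (_ : (\int[lebv]_z (F x z)%:E)%E =
    (kap x)%:E * \int[lebv]_z ((vsqn z)^-1 * expR (- (x / 2 * vsqn z)))%:E)%E; last first.
  rewrite -(ge0_integral_EFinZ lebv measurableT (k0 x)).
  - by apply: eq_integral => z _; rewrite /F expR_hsq; congr (_%:E); ring.
  - by apply: measurable_funM => //; exact: measurable_expR_vsqn.
  - by move=> z _; rewrite mulr_ge0 ?expR_ge0// invr_ge0 vsqn_ge0.
rewrite muleA -EFinM.
apply: (@le_trans _ _ ((w x * kap x)%:E * (inv_moment * x `^ (1 - p%:R / 2))%:E)%E).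
  by apply: lee_wpmul2l; [rewrite lee_fin mulr_ge0|exact: integral_inv_vsqn].
rewrite -EFinM lee_fin mul1r.
have xl' : 0 < x <= l0 / 2 by rewrite x0.
have -> : w x * kap x * (inv_moment * x `^ (1 - p%:R / 2)) =
    kap x * inv_moment * (w x * x `^ (1 - p%:R / 2)) by ring.
apply: le_trans (ler_wpM2l _ (w_tail xl')) _; first by rewrite mulr_ge0 ?inv_moment_ge0.
rewrite le_eqVlt; apply/orP; left; apply/eqP.
rewrite /kap /kapcut cx xl mul1r.
by field; rewrite -oppr_eq0 !gt_eqF.
Qed.

(** Both [d] and [bayes_estim] are within shift_const / n of the truncated Bayes estimator, the
    former by [le_integral_testim]. Since |x - y|^2 <= 2 (|x - z|^2 + |y - z|^2), their own
    distance, in a weight free of n, is at most 4 shift_const / n for every n, hence 0. *)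
Lemma le_risk_bayes_estim (d : vect R p -> vect R p) : measurable_fun setT d ->
  (forall mu, risk d mu <= risk bayes_estim mu)%E ->
  {ae lebv, forall z, d z = bayes_estim z}.
Proof.
move=> md dle; have mb := measurable_bayes_estim.
have S0 : 0 <= shift_const.
  by rewrite /shift_const mulr_ge0 ?sqr_ge0// mulr_ge0 ?inv_moment_ge0// mulr_ge0.
have bb0 x : 0 < x < 1 -> 0 <= (l1 < x <= l0)%R%:R :> R by [].
have mbase : measurable_fun setT (fun z => base_mass (hsq z)).
  exact: (measurableT_comp (measurable_wint_expR bdd_base bb0) measurable_hsq).
pose f z := base_mass (hsq z) * vsqd (d z) (bayes_estim z).
have b0 z : 0 < base_mass (hsq z) by exact: base_mass_gt0 (hsq_ge0 z).
have f0 z : 0 <= f z by rewrite mulr_ge0 ?vsqd_ge0 ?(ltW (b0 z)).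
have mf : measurable_fun setT f by apply: measurable_funM => //; exact: measurable_vsqd.
have Ile n : (0 < n)%N -> (\int[lebv]_z (f z)%:E <= (4 * shift_const / n%:R)%:E)%E.
  move=> n0; set q := qcut l1 n.
  have bq : bdd_meas q by exact: bdd_qcut.
  have q0 x : 0 < x < 1 -> 0 <= q x by move=> _; exact: qcut_ge0.
  have xc : 0 < xcut l1 n by exact: expR_gt0.
  have h1 := integral_testim_diff n0; rewrite -/q in h1.
  have h2 := le_integral_testim bq q0 (q_mass n0) xc (@qcut_out _ _ _) mb md dle.
  have mq : measurable_fun setT (fun z => tmass q (hsq z)).
    exact: (measurableT_comp (measurable_tmass bq q0) measurable_hsq).
  have mt := measurable_testim bq q0.
  have m1 : measurable_fun setT (fun z => tmass q (hsq z) * vsqd (d z) (testim q z)).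
    by apply: measurable_funM => //; exact: measurable_vsqd.
  have m2 : measurable_fun setT (fun z => tmass q (hsq z) * vsqd (bayes_estim z) (testim q z)).
    by apply: measurable_funM => //; exact: measurable_vsqd.
  have g1 z : [set: vect R p] z -> 0 <= tmass q (hsq z) * vsqd (d z) (testim q z).
    by rewrite mulr_ge0 ?vsqd_ge0 ?(ltW (q_mass n0 z)).
  have g2 z : [set: vect R p] z -> 0 <= tmass q (hsq z) * vsqd (bayes_estim z) (testim q z).
    by rewrite mulr_ge0 ?vsqd_ge0 ?(ltW (q_mass n0 z)).
  apply: (@le_trans _ _ (\int[lebv]_z (2 * (tmass q (hsq z) * vsqd (d z) (testim q z) +
     tmass q (hsq z) * vsqd (bayes_estim z) (testim q z)))%:E)%E).
    apply: ge0_le_integral_EFin => //.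
    - by apply: measurable_funM => //; exact: measurable_funD.
    - move=> z _; apply: (@le_trans _ _ (tmass q (hsq z) * vsqd (d z) (bayes_estim z))).
        by rewrite ler_wpM2r ?vsqd_ge0// tmass_ge_base.
      rewrite -mulrDr mulrCA ler_wpM2l ?(ltW (q_mass n0 z))//.
      exact: vsqd_triangle.
  rewrite (ge0_integral_EFinZ lebv measurableT (ler0n R 2) (measurable_funD m1 m2)); last first.
    by move=> z _; rewrite addr_ge0 ?g1 ?g2.
  rewrite (ge0_integral_EFinD lebv measurableT m1 m2 g1 g2).
  rewrite (_ : 4 * shift_const / n%:R = 2 * (shift_const / n%:R + shift_const / n%:R)); last by ring.
  rewrite EFinM; apply: lee_wpmul2l; first by rewrite lee_fin.
  by rewrite [leRHS]EFinD; apply: leeD => //; exact: le_trans h1.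
have I0 : (\int[lebv]_z (f z)%:E = 0)%E.
  apply/eqP; rewrite eq_le; apply/andP; split; last first.
    by apply: integral_ge0 => z _; rewrite lee_fin.
  apply/lee_addgt0Pr => e e0; rewrite add0e.
  pose n := (Num.bound (4 * shift_const / e)).+1.
  apply: le_trans (Ile n _) _ => //; rewrite lee_fin ler_pdivrMr ?ltr0n// [leRHS]mulrC -ler_pdivrMr//.
  have h : 0 <= 4 * shift_const / e by rewrite divr_ge0 ?(ltW e0)// mulr_ge0.
  by apply: ltW; apply: lt_le_trans (archi_boundP h) _; rewrite ler_nat.
have mfE : measurable_fun setT (EFin \o f) by exact/measurable_EFinP.
have /(ae_eq_integral_abs lebv measurableT mfE) : (\int[lebv]_z `|(EFin \o f) z| = 0)%E.
  by rewrite -[RHS]I0; apply: eq_integral => z _ /=; rewrite ger0_norm.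
apply: filterS => z /(_ I) /= [] /eqP; rewrite mulf_eq0 (gt_eqF (b0 z))/= => /eqP.
exact: vsqd_eq0.
Qed.

Theorem admissible_bayes_estim : admissible bayes_estim.
Proof.
split; first exact: measurable_bayes_estim.
move=> [d [md [dle [mu]]]]; rewrite ltNge => /negP; apply.
have ae := le_risk_bayes_estim md dle.
have mr f : measurable_fun setT f -> measurable_fun setT (fun z =>
    (vnorm (vsub (f z) mu) ^+ 2 * normal_density mu z)%:E).
  move=> mf; apply/measurable_EFinP; apply: measurable_funM.
    by under eq_fun do rewrite vnorm_vsub_sqr; exact: measurable_vsqd.
  exact: measurable_normal_density.
rewrite /risk le_eqVlt; apply/orP; left; apply/eqP.
apply: ge0_ae_eq_integral => //.
- by apply: mr; exact: measurable_bayes_estim.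
- exact: mr.
- by move=> z _; rewrite lee_fin mulr_ge0 ?sqr_ge0 ?normal_density_ge0.
- by move=> z _; rewrite lee_fin mulr_ge0 ?sqr_ge0 ?normal_density_ge0.
- by apply: filterS ae => z -> _.
Qed.

End conclusion.

End bayes_risk.
End posterior.

(** * The generalized Bayes estimator of a scale mixture *)

Section coordinate_moment.
Context {R : realType} (p : nat).
Local Notation leb := (@lebesgue_measure R).
Local Notation lebv := (lebesgue_vect R p).
Implicit Types (z mu d : vect R p) (l : R).

Definition mixker l z mu : R :=
  normal_density mu z * expR (- (l / (1 - l) * (vnorm mu ^+ 2 / 2))).

Lemma mixker_ge0 l z mu : 0 <= mixker l z mu.
Proof. by rewrite mulr_ge0 ?expR_ge0 ?normal_density_ge0. Qed.

Lemma measurable_mixker z :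
  measurable_fun [set: vect R p * R] (fun u => mixker u.2 z u.1).
Proof.
apply: measurable_funM; first exact: measurable_normal_density.
apply: measurableT_comp => //; apply: measurableT_comp => //.
apply: measurable_funM.
  apply: measurable_funM => //; apply: measurable_invr; exact: measurable_funB.
apply: measurable_funM => //.
by under eq_fun do rewrite vnorm_sqr; exact: (measurableT_comp (@measurable_vsqn R p)).
Qed.

Let mk l z : measurable_fun [set: vect R p] (mixker l z).
Proof. exact: (measurableT_comp (measurable_mixker z) (measurable_pair2 l)). Qed.

Lemma integrable_mixker_quad l z d : l < 1 ->
  lebv.-integrable setT (fun mu => (vsqd d mu * mixker l z mu)%:E).
Proof.
move=> l1; apply/integrableP; split.
  by apply/measurable_EFinP; apply: measurable_funM => //; exact: measurable_vsqd.
rewrite (eq_integral (fun mu => (vsqd d mu * mixker l z mu)%:E)); last first.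
  by move=> mu _; rewrite abse_EFin ger0_norm// mulr_ge0 ?vsqd_ge0 ?mixker_ge0.
by rewrite integral_mix_quad// ltry.
Qed.

Lemma integrable_mixker l z : l < 1 -> lebv.-integrable setT (fun mu => (mixker l z mu)%:E).
Proof.
move=> l1; apply/integrableP; split; first exact/measurable_EFinP.
under eq_integral do rewrite abse_EFin ger0_norm ?mixker_ge0//.
by rewrite integral_mix// ltry.
Qed.

Lemma normr_coord_le mu (i : 'I_p) :
  `|(tnth mu i : R)| <= 1 + vsqd ([tuple 0 | j < p] : vect R p) mu.
Proof.
apply: (@le_trans _ _ (1 + (tnth mu i : R) ^+ 2)).
  by rewrite -(real_normK (num_real (tnth mu i : R))); nra.
rewrite lerD2l /vsqd (bigD1 i)//= tnth_mktuple sub0r sqrrN lerDl.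
by apply: sumr_ge0 => j _; exact: sqr_ge0.
Qed.

Lemma integrable_mixker_coord l z (i : 'I_p) : l < 1 ->
  lebv.-integrable setT (fun mu => ((tnth mu i : R) * mixker l z mu)%:E).
Proof.
move=> l1; pose d0 : vect R p := [tuple 0 | j < p].
have := integrableD measurableT (integrable_mixker z l1) (integrable_mixker_quad z d0 l1).
apply: le_integrable => //.
  apply/measurable_EFinP; apply: measurable_funM => //; exact: measurable_tnth.
move=> mu _; have k0 := mixker_ge0 l z mu.
rewrite -EFinD !abse_EFin lee_fin normrM (ger0_norm k0).
rewrite (ger0_norm (addr_ge0 k0 (mulr_ge0 (vsqd_ge0 _ _) k0))).
rewrite -{2}[mixker _ _ _]mul1r -mulrDl ler_wpM2r ?mixker_ge0//.
exact: normr_coord_le.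
Qed.

(* Polarisation: a coordinate is a difference of squared distances. *)
Lemma integral_mixker_coord l z (i : 'I_p) : l < 1 ->
  (\int[lebv]_mu ((tnth mu i : R) * mixker l z mu)%:E =
   ((1 - l) `^ (p%:R / 2) * expR (- (l / 2 * vsqn z)) * ((1 - l) * (tnth z i : R)))%:E)%E.
Proof.
move=> l1; pose d0 : vect R p := [tuple 0 | j < p].
(* The opposite of the i-th basis vector: |mu + e_i|^2 - |mu|^2 = 2 mu_i + 1. *)
pose d1 : vect R p := [tuple if j == i then -1 else 0 | j < p].
have E mu : vsqd d1 mu = vsqd d0 mu + 2 * (tnth mu i : R) + 1.
  rewrite /vsqd (bigD1 i)//= [X in _ = X + _ + _](bigD1 i)//= !tnth_mktuple eqxx.
  rewrite (eq_bigr (fun j => ((tnth d0 j : R) - tnth mu j) ^+ 2)); first by ring.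
  by move=> j /negbTE ji; rewrite !tnth_mktuple ji.
have i1 := integrable_mixker_quad z d1 l1.
have i0 := integrable_mixker_quad z d0 l1.
have ik := integrable_mixker z l1.
transitivity (\int[lebv]_mu (2^-1%:E * ((vsqd d1 mu * mixker l z mu)%:E -
    ((vsqd d0 mu * mixker l z mu)%:E + (mixker l z mu)%:E))))%E.
  by apply: eq_integral => mu _; rewrite E; apply: (congr1 (@EFin R)) => /=; field.
rewrite integralZl//; last by apply: integrableB => //; exact: integrableD.
rewrite integralB//; last exact: integrableD.
rewrite integralD// !integral_mix_quad// integral_mix// E tnth_mktuple.
by apply: (congr1 (@EFin R)) => /=; field.
Qed.

(** A bound uniform in l, to be integrated against the weight; 8 is the 4 of [gauss_moment2_le]
    times 2, which majorises 2^(1/2). *)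
Lemma post_var_le l : 0 < l < 1 -> post_var p l <= p%:R * 8.
Proof.
move=> /andP[l0 l1]; rewrite /post_var ler_wpM2l//.
set c := (1 - l)^-1.
have c0 : 0 < c by rewrite invr_gt0 subr_gt0.
have c1 : 1 <= c by rewrite invf_ge1 ?subr_gt0// gerBl ltW.
have I0 : 0 < (2 * pi / c) `^ 2^-1 by rewrite powR_gt0// divr_gt0// mulr_gt0// pi_gt0.
rewrite ler_pdivrMr//; apply: le_trans (gauss_moment2_le c0) _.
apply: (@le_trans _ _ (4 * (2 * pi / (c / 2)) `^ 2^-1)).
  by rewrite ler_wpM2r ?powR_ge0// ler_piMr// invf_le1.
rewrite (_ : 2 * pi / (c / 2) = 2 * (2 * pi / c)); last by field; rewrite gt_eqF.
rewrite powRM ?divr_ge0 ?mulr_ge0 ?pi_ge0 ?(ltW c0)// mulrA ler_pM2r//.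
rewrite (_ : 8 = 4 * 2); last by ring.
by rewrite ler_pM2l// ler1_powR// ?ler1n// invf_le1 ?ler1n.
Qed.

End coordinate_moment.

Section generalized_bayes_mix.
Context {R : realType} (p : nat).
Local Notation leb := (@lebesgue_measure R).
Local Notation lebv := (lebesgue_vect R p).
Implicit Types (z mu : vect R p) (l : R).
Variables (a : R) (L : R -> R).
Hypothesis L_ge0 : forall y, 1 <= y -> 0 <= L y.
Hypothesis mL : measurable_fun [set: R] (fun l => (0 < l < 1)%R%:R * L l^-1).

(* G is the integral of prior_weight l * exp (- l / (1 - l) * r^2 / 2), and given z
   the density of l is proportional to post_weight l * exp (- l * hsq z). *)
Definition prior_weight l : R :=
  (0 < l < 1)%R%:R * ((l / (1 - l)) `^ (p%:R / 2) * l `^ a * L l^-1).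

Definition post_weight l : R := (0 < l < 1)%R%:R * (l `^ (p%:R / 2 + a) * L l^-1).

Lemma Linv_ge0 l : 0 < l < 1 -> 0 <= L l^-1.
Proof. by move=> /andP[l0 l1]; apply: L_ge0; rewrite invf_ge1// ltW. Qed.

Lemma prior_weight_ge0 l : 0 <= prior_weight l.
Proof.
rewrite /prior_weight; case: (boolP (0 < l < 1)) => [l01|_]; last by rewrite mul0r.
by rewrite mul1r !mulr_ge0 ?powR_ge0 ?Linv_ge0.
Qed.

Lemma post_weight_ge0 l : 0 <= post_weight l.
Proof.
rewrite /post_weight; case: (boolP (0 < l < 1)) => [l01|_]; last by rewrite mul0r.
by rewrite mul1r mulr_ge0 ?powR_ge0 ?Linv_ge0.
Qed.

Lemma measurable_prior_weight : measurable_fun [set: R] prior_weight.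
Proof.
rewrite (_ : prior_weight = fun l => (l / (1 - l)) `^ (p%:R / 2) * l `^ a *
  ((0 < l < 1)%R%:R * L l^-1)); last by apply/funext => l; rewrite /prior_weight; ring.
apply: measurable_funM => //; apply: measurable_funM; apply: measurable_powRT => //.
by apply: measurable_funM => //; apply: measurable_invr; exact: measurable_funB.
Qed.

Lemma measurable_post_weight : measurable_fun [set: R] post_weight.
Proof.
rewrite (_ : post_weight = fun l => l `^ (p%:R / 2 + a) *
  ((0 < l < 1)%R%:R * L l^-1)); last by apply/funext => l; rewrite /post_weight; ring.
by apply: measurable_funM => //; exact: measurable_powRT.
Qed.

Lemma post_weight_out l : ~~ (0 < l < 1) -> post_weight l = 0.
Proof. by rewrite /post_weight => /negbTE ->; rewrite mul0r. Qed.

(** Integrating mu out leaves (1 - l)^(p/2), which cancels the singularity of the prior weight at l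
    = 1. *)
Lemma post_weightE l : prior_weight l * (1 - l) `^ (p%:R / 2) = post_weight l.
Proof.
rewrite /prior_weight /post_weight; case: (boolP (0 < l < 1)) => [/andP[l0 l1]|_]; last first.
  by rewrite !mul0r.
have l1' : 0 < 1 - l by rewrite subr_gt0.
rewrite !mul1r powRD; last by rewrite (gt_eqF l0) implybT.
have -> : l `^ (p%:R / 2) = (l / (1 - l)) `^ (p%:R / 2) * (1 - l) `^ (p%:R / 2).
  by rewrite -powRM ?divr_ge0 ?(ltW l0) ?(ltW l1')// divfK// gt_eqF.
by ring.
Qed.

Lemma G_weight (r : R) :
  (G p r a L = \int[leb]_l (prior_weight l * expR (- (l / (1 - l) * (r ^+ 2 / 2))))%:E)%E.
Proof.
rewrite /G integral_mkcond; apply: eq_integral => l _.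
rewrite patchE mem_setE in_itv/= /prior_weight; case: ifP => _; last by rewrite !mul0r.
by rewrite mul1r; congr (_%:E); ring.
Qed.

Hypothesis w_fin : (\int[leb]_l (post_weight l)%:E < +oo)%E.

Local Notation w := post_weight.
Let mw := measurable_post_weight.
Let w0 := post_weight_ge0.
Let wo := post_weight_out.

Let F z (u : vect R p * R) : R := prior_weight u.2 * mixker u.2 z u.1.

Let F_ge0 z u : 0 <= F z u.
Proof. by rewrite mulr_ge0 ?mixker_ge0 ?prior_weight_ge0. Qed.

Let mF z : measurable_fun setT (F z).
Proof.
apply: measurable_funM; last exact: measurable_mixker.
exact: (measurableT_comp measurable_prior_weight).
Qed.

Lemma density_G z mu : ((normal_density mu z)%:E * G p (vnorm mu) a L =
  \int[leb]_l (F z (mu, l))%:E)%E.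
Proof.
rewrite G_weight -ge0_integral_EFinZ ?normal_density_ge0//.
- by apply: eq_integral => l _; congr (_%:E); rewrite /F /mixker/=; ring.
- apply: measurable_funM; first exact: measurable_prior_weight.
  apply: measurableT_comp => //; apply: measurableT_comp => //; apply: measurable_funM => //.
  by apply: measurable_funM => //; apply: measurable_invr; exact: measurable_funB.
- by move=> l _; rewrite mulr_ge0 ?expR_ge0 ?prior_weight_ge0.
Qed.

Lemma bayes_denominator z :
  (\int[lebv]_mu ((normal_density mu z)%:E * G p (vnorm mu) a L) =
   (pmass w (hsq z))%:E)%E.
Proof.
pose H (u : vect R p * R) : \bar R := (F z u)%:E.
transitivity (\int[lebv]_mu \int[leb]_l H (mu, l))%E.
  by apply: eq_integral => mu _; rewrite density_G.
have mH : measurable_fun setT H by apply/measurable_EFinP; exact: mF.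
rewrite (@fubini_tonelli _ _ _ _ _ lebv leb H); last 2 first.
- exact: mH.
- by move=> u; rewrite lee_fin.
rewrite /pmass -wintE//; last exact: bdd_meas_expR.
apply: eq_integral => l _; rewrite /H /F/=.
have [l01|l01] := boolP (0 < l < 1); last first.
  rewrite (wo l01) mul0r integral0_eq// => mu _.
  by rewrite /prior_weight (negbTE l01) !mul0r.
have /andP[l0 l1] := l01.
rewrite ge0_integral_EFinZ ?prior_weight_ge0//.
- by rewrite integral_mix// -EFinM mulrA post_weightE expR_hsq.
- exact: (measurableT_comp (measurable_mixker z) (measurable_pair2 l)).
- by move=> mu _; exact: mixker_ge0.
Qed.

(** A coordinate has no constant sign, so the numerator requires Fubini rather than Tonelli. The
    dominating function is 1 + |mu|^2, whose integral over mu is at most 1 + |z|^2 + 8 p times the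
    posterior weight. *)
Lemma integrable_coord z (i : 'I_p) :
  (lebv \x leb)%E.-integrable setT (fun u => ((tnth u.1 i : R) * F z u)%:E).
Proof.
have mt : measurable_fun [set: vect R p * R] (fun u => (tnth u.1 i : R) * F z u).
  apply: measurable_funM => //.
  exact: (measurableT_comp (measurable_tnth i) measurable_fst).
apply/integrable21ltyP; first exact/measurable_EFinP.
pose d0 : vect R p := [tuple 0 | j < p].
pose H (u : vect R p * R) : R := (1 + vsqd d0 u.1) * F z u.
have mH : measurable_fun setT H.
  apply: measurable_funM => //; apply: measurable_funD => //.
  exact: measurable_vsqd.
have H0 u : 0 <= H u by rewrite mulr_ge0// addr_ge0// vsqd_ge0.
pose K := 1 + (vsqn z + p%:R * 8).
apply: (@le_lt_trans _ _ (\int[leb]_l (K * w l)%:E)%E); last first.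
  rewrite ge0_integral_EFinZ//; last by rewrite !addr_ge0 ?vsqn_ge0 ?mulr_ge0.
  rewrite lte_mul_pinfty ?lee_fin ?addr_ge0 ?vsqn_ge0 ?mulr_ge0//.
apply: (@le_trans _ _ (\int[leb]_l \int[lebv]_mu (H (mu, l))%:E)%E).
  apply: ge0_le_integral => //.
  - by move=> l _; apply: integral_ge0.
  - apply: (measurable_fun_fubini_tonelli_G (m1 := lebv) (fun u => `|((tnth u.1 i : R) * F z u)%:E|%E)) => //.
    by apply: measurableT_comp => //; exact/measurable_EFinP.
  - apply: (measurable_fun_fubini_tonelli_G (m1 := lebv) (fun u => (H u)%:E)).
      exact/measurable_EFinP.
    by move=> u; rewrite lee_fin.
  - move=> l _; apply: ge0_le_integral => //.
    + apply: measurableT_comp => //; apply/measurable_EFinP.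
      exact: (measurableT_comp mt (measurable_pair2 l)).
    + by apply/measurable_EFinP; exact: (measurableT_comp mH (measurable_pair2 l)).
    + move=> mu _; rewrite abse_EFin lee_fin normrM (ger0_norm (F_ge0 _ _)) ler_wpM2r//=.
      exact: normr_coord_le.
apply: ge0_le_integral => //.
- by move=> l _; apply: integral_ge0 => mu _; rewrite lee_fin.
- apply: (measurable_fun_fubini_tonelli_G (m1 := lebv) (fun u => (H u)%:E)).
    exact/measurable_EFinP.
  by move=> u; rewrite lee_fin.
- by apply/measurable_EFinP; exact: measurable_funM.
move=> l _; have [l01|l01] := boolP (0 < l < 1); last first.
  rewrite (wo l01) mulr0 integral0_eq// => mu _.
  by rewrite /H /F/= /prior_weight (negbTE l01) !mul0r mulr0.
have /andP[l0 l1] := l01.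
have mk : measurable_fun setT (mixker l z).
  exact: (measurableT_comp (measurable_mixker z) (measurable_pair2 l)).
have mv : measurable_fun setT (fun mu => vsqd d0 mu * mixker l z mu).
  by apply: measurable_funM => //; exact: measurable_vsqd.
have k0 mu : [set: vect R p] mu -> 0 <= mixker l z mu by rewrite mixker_ge0.
have v0 mu : [set: vect R p] mu -> 0 <= vsqd d0 mu * mixker l z mu.
  by rewrite mulr_ge0 ?vsqd_ge0 ?mixker_ge0.
have -> : (\int[lebv]_mu (H (mu, l))%:E = (prior_weight l)%:E *
   \int[lebv]_mu (mixker l z mu + vsqd d0 mu * mixker l z mu)%:E)%E.
  rewrite -ge0_integral_EFinZ ?prior_weight_ge0//.
  - by apply: eq_integral => mu _; rewrite /H /F/=; congr (_%:E); ring.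
  - exact: measurable_funD.
  - by move=> mu _; rewrite addr_ge0 ?k0 ?v0.
rewrite (ge0_integral_EFinD lebv measurableT mk mv k0 v0) integral_mix// integral_mix_quad//.
rewrite -EFinD -EFinM lee_fin.
have -> : vsqd d0 (vscale (1 - l) z) = (1 - l) ^+ 2 * vsqn z.
  rewrite /vsqd /vsqn mulr_sumr; apply: eq_bigr => j _.
  by rewrite !tnth_mktuple; ring.
set e := expR _.
have -> : prior_weight l * ((1 - l) `^ (p%:R / 2) * e +
    (1 - l) `^ (p%:R / 2) * e * ((1 - l) ^+ 2 * vsqn z + post_var p l)) =
  (1 + ((1 - l) ^+ 2 * vsqn z + post_var p l)) * e * (prior_weight l * (1 - l) `^ (p%:R / 2)).
  by ring.
rewrite post_weightE ler_wpM2r ?w0//.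
have e1 : e <= 1.
  by rewrite -expR0 ler_expR oppr_le0 mulr_ge0 ?vsqn_ge0// divr_ge0// ltW.
have s1 : (1 - l) ^+ 2 <= 1 by rewrite expr_le1 ?subr_ge0 ?gerBl ?ltW.
have B0 : 0 <= 1 + ((1 - l) ^+ 2 * vsqn z + post_var p l).
  by rewrite addr_ge0// addr_ge0 ?post_var_ge0// mulr_ge0 ?sqr_ge0 ?vsqn_ge0.
apply: le_trans (ler_piMr B0 e1) _; rewrite lerD2l lerD ?post_var_le//.
by rewrite ler_piMl ?vsqn_ge0.
Qed.

Lemma bayes_numerator z (i : 'I_p) : 0 < pmass w (hsq z) ->
  (\int[lebv]_mu (((tnth mu i : R) * normal_density mu z)%:E * G p (vnorm mu) a L) =
   ((1 - pmean w (hsq z)) * (tnth z i : R) * pmass w (hsq z))%:E)%E.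
Proof.
move=> m0; have iF := integrable_coord z i.
transitivity (\int[lebv]_mu \int[leb]_l (fun u => ((tnth u.1 i : R) * F z u)%:E) (mu, l))%E.
  apply: eq_integral => mu _; rewrite EFinM -muleA density_G.
  have mFm : measurable_fun setT (fun l => F z (mu, l)).
    exact: (measurableT_comp (mF z) (measurable_pair1 mu)).
  (* [G] may be infinite at mu, so the coordinate is moved under the integral according to its sign
     and not by integrability. *)
  set c : R := tnth mu i; have [c0|c0] := leP 0 c.
    by rewrite -ge0_integral_EFinZ.
  have -> : (c%:E = - (- c)%:E)%E by rewrite -EFinN opprK.
  rewrite mulNe -ge0_integral_EFinZ ?oppr_ge0 ?(ltW c0)// -integral_ge0N.
    by apply: eq_integral => l _; rewrite -EFinN mulNr opprK.
  by move=> l _; rewrite lee_fin mulr_ge0// oppr_ge0 ltW.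
rewrite (Fubini iF) /=.
have be := bdd_meas_expR (R := R).
have bd : bdd_meas (fun l => (1 - l) * (tnth z i : R) * expR (- (hsq z * l))).
  exact: bdd_measM (bdd_measM (bdd_measB (bdd_meas_cst _) bdd_meas_id) (bdd_meas_cst _)) (be _).
transitivity (wint w (fun l => (1 - l) * (tnth z i : R) * expR (- (hsq z * l))))%:E.
  rewrite -wintE//; apply: eq_integral => l _.
  have [l01|l01] := boolP (0 < l < 1); last first.
    rewrite (wo l01) mul0r integral0_eq// => mu _.
    by rewrite /F/= /prior_weight (negbTE l01) !mul0r mulr0.
  have /andP[l0 l1] := l01.
  transitivity (\int[lebv]_mu ((prior_weight l)%:E * ((tnth mu i : R) * mixker l z mu)%:E))%E.
    by apply: eq_integral => mu _; rewrite -EFinM /F/=; congr (_%:E); ring.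
  rewrite integralZl//; last exact: integrable_mixker_coord.
  rewrite integral_mixker_coord// -EFinM expR_hsq; congr (_%:E).
  by rewrite -post_weightE; ring.
congr (_%:E).
transitivity (wint w (fun l => (tnth z i : R) * expR (- (hsq z * l)) +
    (- (tnth z i : R)) * (l * expR (- (hsq z * l))))).
  by apply: eq_wint => // l _; ring.
have bxe : bdd_meas (fun l => l * expR (- (hsq z * l))) by exact: bdd_measM bdd_meas_id (be _).
rewrite wintD//; last 2 first.
- exact: bdd_measM (bdd_meas_cst _) (be _).
- exact: bdd_measM (bdd_meas_cst _) bxe.
rewrite !wintZ// -/(pmass w (hsq z)).
by rewrite /pmean; field; rewrite gt_eqF.
Qed.

Lemma generalized_bayesE z : 0 < pmass w (hsq z) ->
  generalized_bayes (fun mu : vect R p => G p (vnorm mu) a L) z = bayes_estim w z.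
Proof.
move=> m0; apply: eq_from_tnth => i; rewrite !tnth_mktuple.
by rewrite bayes_numerator// bayes_denominator /= mulfK// gt_eqF.
Qed.

End generalized_bayes_mix.

(** * Slow variation *)

Section powR_integral.
Context {R : realType}.
Local Notation leb := (@lebesgue_measure R).

Lemma integral_powR_itv (c e s : R) : -1 < c -> 0 < e -> e <= s ->
  (\int[leb]_(x in `[e, s]) (x `^ c)%:E <= (s `^ (c + 1) / (c + 1))%:E)%E.
Proof.
move=> c1 e0 es; have c0 : 0 < c + 1 by rewrite -ltrBlDr sub0r.
have dF x : e <= x <= s -> is_derive x (1:R) (fun x => x `^ (c + 1) / (c + 1)) (x `^ c).
  move=> /andP[ex _]; have x0 : 0 < x by exact: lt_le_trans ex.
  have h := is_derive1_powR (c + 1) x0.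
  apply: is_derive_eq; rewrite /GRing.scale/= addrK; field; by rewrite gt_eqF.
have cf x : e <= x <= s -> {for x, continuous (fun x => x `^ c)}.
  move=> /andP[ex _]; have x0 : 0 < x by exact: lt_le_trans ex.
  exact: is_derive_continuous (is_derive1_powR c x0).
rewrite (integral_is_derive es dF cf) lee_fin gerBl.
by rewrite divr_ge0 ?powR_ge0// ltW.
Qed.

(** For c < 0 the power is unbounded at 0: ]0, s] is exhausted by the intervals [s / (n + 1), s] and
    monotone convergence concludes. *)
Lemma integral_powR_le (c s : R) : -1 < c -> 0 < s ->
  (\int[leb]_(x in `]0%R, s]) (x `^ c)%:E <= (s `^ (c + 1) / (c + 1))%:E)%E.
Proof.
move=> c1 s0; pose I n : set R := `[s / n.+1%:R, s]%classic.
have mI n : measurable (I n) by exact: measurable_itv.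
have ndI : nondecreasing_seq I.
  move=> m n mn; apply/subsetPset => x; rewrite /I/= !in_itv/= => /andP[h ->].
  rewrite andbT (le_trans _ h)// ler_wpM2l ?(ltW s0)// lef_pV2 ?posrE ?ltr0n//.
  by rewrite ler_nat.
have mp : measurable_fun setT (fun x : R => (x `^ c)%:E).
  by apply/measurable_EFinP; exact: measurable_powR.
have UI : `]0%R, s]%classic = \bigcup_n I n.
  apply/seteqP; split => x; rewrite /I/= in_itv/=.
    move=> /andP[x0 xs]; exists (Num.bound (s / x)) => //=; rewrite in_itv/= xs andbT.
    rewrite ler_pdivrMr ?ltr0n// mulrC -ler_pdivrMr//.
    have h : 0 <= s / x by rewrite divr_ge0// ltW.
    by apply: ltW; apply: lt_le_trans (archi_boundP h) _; rewrite ler_nat.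
  move=> [n _] /=; rewrite in_itv/= => /andP[h ->]; rewrite andbT.
  by apply: lt_le_trans h; rewrite divr_gt0.
rewrite UI.
have h : (\int[leb]_(x in I n) (x `^ c)%:E)%E @[n --> \oo] -->
    (\int[leb]_(x in \bigcup_n I n) (x `^ c)%:E)%E.
  apply: ge0_nondecreasing_set_cvg_integral => //.
    by move=> n; exact: measurable_funTS.
  by move=> n x _; rewrite lee_fin powR_ge0.
rewrite -(cvg_lim _ h)//; apply: lime_le; first exact: cvgP h.
apply: nearW => n; apply: integral_powR_itv => //; first by rewrite divr_gt0.
by rewrite ler_pdivrMr ?ltr0n// ler_peMr ?(ltW s0)// ler1n.
Qed.

End powR_integral.

Section slowly_varying_bounds.
Context {R : realType}.
Implicit Types (f L : R -> R) (x y eta : R).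

(** Iterate the doubling up to the least m with y <= 2^m x. By minimality 2^m is at most 2 y / x
    unless m = 0, which accounts for the factor 2^eta, and monotonicity compares f(y) with f(2^m
    x). *)
Lemma doubling_bound f (y1 eta : R) : 0 < y1 -> 0 <= eta ->
  (forall x y, y1 <= x -> x <= y -> f x <= f y) -> (forall x, y1 <= x -> 0 <= f x) ->
  (forall x, y1 <= x -> f (2 * x) <= 2 `^ eta * f x) ->
  forall x y, y1 <= x -> x <= y -> f y <= 2 `^ eta * (y / x) `^ eta * f x.
Proof.
move=> y10 eta0 fnd f0 f2 x y xy1 xy.
have x0 : 0 < x by exact: lt_le_trans xy1.
have fn n : f (2 ^+ n * x) <= (2 ^+ n) `^ eta * f x.
  elim: n => [|n ih]; first by rewrite expr0 powR1 !mul1r.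
  rewrite exprS -mulrA; apply: le_trans (f2 _ _) _.
    by apply: le_trans xy1 _; rewrite ler_peMl ?(ltW x0)// exprn_ege1// ler1n.
  by rewrite powRM ?exprn_ge0// -mulrA ler_wpM2l ?powR_ge0.
pose P n := y <= 2 ^+ n * x.
have exP : exists n, P n.
  exists (Num.bound (y / x)); rewrite /P -ler_pdivrMr//.
  have h : 0 <= y / x by rewrite divr_ge0 ?(ltW x0)// (le_trans _ xy)// ltW.
  apply: le_trans (ltW (archi_boundP h)) _.
  by rewrite -natrX ler_nat ltnW// ltn_expl.
have [m Pm mmin] := ex_minnP exP.
case: m Pm mmin => [|m] Pm mmin.
  have -> : y = x by apply/eqP; rewrite eq_le xy andbT; move: Pm; rewrite /P mul1r.
  by rewrite divff ?gt_eqF// powR1 mulr1 ler_peMl ?f0// -[leLHS](powRr0 2) ler_powR// ler1n.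
have ym : 2 ^+ m * x <= y.
  by rewrite leNgt; apply/negP => /ltW/mmin; rewrite ltnn.
apply: (@le_trans _ _ (f (2 ^+ m.+1 * x))); first by rewrite fnd// (le_trans xy1).
apply: le_trans (fn _) _; rewrite ler_wpM2r ?f0// exprS powRM ?exprn_ge0//.
rewrite ler_wpM2l ?powR_ge0// ge0_ler_powR ?nnegrE ?exprn_ge0//.
  by rewrite divr_ge0 ?(ltW x0)// (le_trans _ xy)// ltW.
by rewrite ler_pdivlMr.
Qed.

(** If L(y) = 0 then L(2 y) / L(y) is 0 by the convention on division, far from its limit 1. *)
Lemma slowly_varying_gt0 L : slowly_varying L -> (forall y, 1 <= y -> 0 <= L y) ->
  \forall y \near +oo, 0 < L y.
Proof.
move=> sL L0; have /cvgrPdist_lt/(_ 1 ltr01) h := sL 2 (ltr0n R 2).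
near=> y; rewrite lt_def L0 ?andbT; last by near: y; exact: nbhs_pinfty_ge.
apply/eqP => Ly; have : `|1 - L (2 * y) / L y| < 1 by near: y.
by rewrite Ly invr0 mulr0 subr0 normr1 ltxx.
Unshelve. all: by end_near. Qed.

Lemma slowly_varying_double L eta : slowly_varying L -> 0 < eta ->
  \forall y \near +oo, 2 `^ (- eta) <= L (2 * y) / L y <= 2 `^ eta.
Proof.
move=> sL eta0; have sL2 := sL 2 (ltr0n R 2).
have h1 : 1 < 2 `^ eta :> R.
  by rewrite -[ltLHS]expR0 /powR gt_eqF ?ltr0n// ltr_expR mulr_gt0// ln_gt0// ltr1n.
have h2 : 2 `^ (- eta) < 1 :> R by rewrite powRN invf_lt1// powR_gt0.
near=> y; apply/andP; split; apply: ltW; near: y.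
  exact: (cvgr_gt _ sL2).
exact: (cvgr_lt _ sL2).
Unshelve. all: by end_near. Qed.

(* Monotonicity reduces Potter's bounds to the case c = 2 of slow variation. *)
Lemma potter L eta : slowly_varying L -> ultimately_monotone L ->
  (forall y, 1 <= y -> 0 <= L y) -> 0 < eta ->
  \forall y1 \near +oo, forall x y, y1 <= x -> x <= y ->
    [/\ 0 < L x, L y <= 2 `^ eta * (y / x) `^ eta * L x &
        L x <= 2 `^ eta * (y / x) `^ eta * L y].
Proof.
move=> sL mL L0 eta0.
have [M1 [_ P1]] := slowly_varying_gt0 sL L0.
have [M2 [_ P2]] := slowly_varying_double sL eta0.
have c1 : 1 <= 2 `^ eta :> R by rewrite -[leLHS](powRr0 2) ler_powR ?ler1n// ltW.
(* The factor 2^eta (y / x)^eta is at least 1, which settles the inequality that monotonicity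
   already gives. *)
have triv (c x y y1 : R) : 0 < y1 -> y1 <= x -> x <= y -> 0 <= c ->
    c <= 2 `^ eta * (y / x) `^ eta * c.
  move=> y0 xy1 xy c0; have x0 : 0 < x by exact: lt_le_trans xy1.
  rewrite ler_peMl// -[leLHS]mulr1 ler_pM//.
  have -> : 1 = 1 `^ eta :> R by rewrite powR1.
  rewrite ge0_ler_powR ?nnegrE ?(ltW eta0)//.
    by rewrite divr_ge0 ?(ltW x0)// (le_trans _ xy)// ltW.
  by rewrite ler_pdivlMr// mul1r.
have [y0 mono] : exists y0, (forall x y, y0 <= x -> x <= y -> L x <= L y) \/
    (forall x y, y0 <= x -> x <= y -> L y <= L x).
  by case: mL => [] [y0 h]; exists y0; [left|right].
near=> y1 => x y xy1 xy.
have y10 : 0 < y1 by near: y1; exact: nbhs_pinfty_gt.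
have Mx z : y1 <= z -> [/\ y0 <= z, M1 < z & M2 < z].
  by move=> z1; split; [apply: le_trans z1|apply: lt_le_trans z1|apply: lt_le_trans z1];
    near: y1; [apply: nbhs_pinfty_ge|apply: nbhs_pinfty_gt|apply: nbhs_pinfty_gt];
    exact: num_real.
have Lpos z : y1 <= z -> 0 < L z by move=> /Mx[_ h _]; exact: P1.
have x1y : y1 <= y by exact: le_trans xy.
case: mono => mono; split; try exact: Lpos.
- apply: (@doubling_bound L y1 eta) => //; first exact: ltW.
  + by move=> u v uy1 uv; apply: mono => //; have [] := Mx u uy1.
  + by move=> u uy1; rewrite ltW// Lpos.
  + move=> u uy1; have [_ _ /P2/andP[_]] := Mx u uy1.
    by rewrite ler_pdivrMr// Lpos.
- apply: le_trans (triv _ _ _ _ y10 xy1 xy (ltW (Lpos _ x1y))).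
  by apply: mono => //; have [] := Mx x xy1.
- apply: le_trans (triv _ _ _ _ y10 xy1 xy (ltW (Lpos _ xy1))).
  by apply: mono => //; have [] := Mx x xy1.
(* When L is nonincreasing, the doubling argument applies to 1 / L. *)
- have h : (L y)^-1 <= 2 `^ eta * (y / x) `^ eta * (L x)^-1.
    apply: (@doubling_bound (fun z => (L z)^-1) y1 eta) => //; first exact: ltW.
    + move=> u v uy1 uv; have vy1 := le_trans uy1 uv.
      by rewrite lef_pV2 ?posrE ?Lpos//; apply: mono => //; have [] := Mx u uy1.
    + by move=> u uy1; rewrite invr_ge0 ltW// Lpos.
    + move=> u uy1; have [_ _ /P2/andP[+ _]] := Mx u uy1.
      have u2 : y1 <= 2 * u by rewrite (le_trans uy1)// ler_peMl ?ler1n// (le_trans _ uy1)// ltW.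
      rewrite ler_pdivlMr ?Lpos// powRN => h.
      rewrite -[leRHS]invrK invfM invrK lef_pV2 ?posrE ?Lpos//.
      by rewrite mulr_gt0 ?invr_gt0 ?powR_gt0// Lpos.
  have {}h := ler_wpM2r (ltW (mulr_gt0 (Lpos x xy1) (Lpos y x1y))) h.
  have Lx0 : L x != 0 by rewrite gt_eqF// Lpos.
  have Ly0 : L y != 0 by rewrite gt_eqF// Lpos.
  rewrite (_ : L x = (L y)^-1 * (L x * L y)); last by field.
  by apply: le_trans h _; rewrite le_eqVlt; apply/orP; left; apply/eqP; field.
Unshelve. all: by end_near. Qed.

Lemma right_continuous1 L :
  cvg (h^-1 * (L (1 + h) - L 1) @[h --> 0^'+]) -> L y @[y --> 1^'+] --> L 1.
Proof.
move=> /cvg_ex[/= l hl].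
have h0 : L (1 + h) @[h --> 0^'+] --> L 1.
  have : h * (h^-1 * (L (1 + h) - L 1)) + L 1 @[h --> 0^'+] --> 0 * l + L 1.
    apply: cvgD; last exact: cvg_cst.
    by apply: cvgM => //; apply: cvg_at_right_filter; exact: cvg_id.
  rewrite mul0r add0r; apply: cvg_trans; apply: near_eq_cvg; near=> h.
  have hp : 0 < h by [].
  by rewrite mulrA divff ?gt_eqF// mul1r subrK.
have sh : (fun y : R => y - 1) @ 1^'+ --> 0^'+.
  move=> A [e /= e0 eA]; exists e => //= y ye y1; apply: eA; rewrite /= ?subr_gt0//.
  by rewrite sub0r opprB.
have := cvg_comp _ _ sh h0; apply: cvg_trans; apply: near_eq_cvg; near=> y.
by rewrite /= addrC subrK.
Unshelve. all: by end_near. Qed.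

Lemma differentiable_on_continuous L y : differentiable_on_1oo L -> 1 < y ->
  {for y, continuous L}.
Proof.
by move=> [dL _] y1; apply: differentiable_continuous; exact/derivable1_diffP/dL.
Qed.

(** Potter's bounds only hold far out; on the compact interval [1, y1] continuity replaces them. *)
Lemma differentiable_on_bounded L y1 : differentiable_on_1oo L -> 1 < y1 ->
  exists B, forall y, 1 <= y <= y1 -> L y <= B.
Proof.
move=> dL y11.
have : {within `[1, y1], continuous L}.
  apply/continuous_within_itvP => //; split.
  - by move=> y; rewrite in_itv/= => /andP[h _]; exact: differentiable_on_continuous.
  - by apply: right_continuous1; case: dL.
  - by apply: cvg_at_left_filter; exact: differentiable_on_continuous.
move=> /(EVT_max (ltW y11))[c _ cB]; exists (L c) => y yy; apply: cB.
by rewrite in_itv.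
Qed.

Lemma measurable_Linv L : differentiable_on_1oo L ->
  measurable_fun [set: R] (fun l : R => (0 < l < 1)%R%:R * L l^-1).
Proof.
move=> dL.
have mo : measurable (`]0%R, 1%R[%classic : set R) by exact: measurable_itv.
have mf : measurable_fun (`]0%R, 1%R[%classic : set R) (fun l : R => L l^-1).
  apply: open_continuous_measurable_fun => // l.
  rewrite inE/= in_itv/= => /andP[l0 l1].
  apply: (cvg_comp (fun l => l^-1) L); first by apply: cvgV; [rewrite gt_eqF|exact: cvg_id].
  by apply: differentiable_on_continuous => //; rewrite invf_gt1.
have /(measurable_restrictT _ mo) := mf.
apply: eq_measurable_fun => l _; rewrite patchE mem_setE in_itv/=.
by case: ifP => _; rewrite ?mul1r ?mul0r.
Qed.

End slowly_varying_bounds.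

(** * Comparison of the posterior weight at different scales *)

Section post_weight_bounds.
Context {R : realType}.
Local Notation leb := (@lebesgue_measure R).
Variables (p : nat) (a : R) (L : R -> R) (eta y1 B : R).
Local Notation b := (p%:R / 2 + a).
Local Notation l0 := (y1^-1).
Local Notation w := (post_weight p a L).
Local Notation K := (2 `^ eta).

Hypothesis b_gt : -1 < b - eta.
Hypothesis eta_gt0 : 0 < eta.
Hypothesis L_ge0 : forall y, 1 <= y -> 0 <= L y.
Hypothesis mL : measurable_fun [set: R] (fun l : R => (0 < l < 1)%R%:R * L l^-1).
Hypothesis y1_gt1 : 1 < y1.
Hypothesis L_potter : forall x y, y1 <= x -> x <= y ->
    [/\ 0 < L x, L y <= K * (y / x) `^ eta * L x & L x <= K * (y / x) `^ eta * L y].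
Hypothesis L_le : forall y, 1 <= y <= y1 -> L y <= B.

Let y1_gt0 : 0 < y1. Proof. exact: lt_trans y1_gt1. Qed.
Let l0_gt0 : 0 < l0. Proof. by rewrite invr_gt0. Qed.
Let l0_lt1 : l0 < 1. Proof. by rewrite invf_lt1. Qed.
Let b1_gt0 : 0 < b - eta + 1. Proof. by rewrite -ltrBlDr sub0r. Qed.
Let Ly1_gt0 : 0 < L y1. Proof. by have [] := L_potter (lexx y1) (lexx y1). Qed.
Let K_gt0 : 0 < K. Proof. exact: powR_gt0. Qed.

Let inv_ge s : 0 < s <= l0 -> y1 <= s^-1.
Proof. by move=> /andP[s0 sl]; rewrite -[leLHS]invrK lef_pV2 ?posrE. Qed.

Let B_ge1 : 1 <= B / L y1.
Proof. by rewrite ler_pdivlMr// mul1r; apply: L_le; rewrite lexx andbT ltW. Qed.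

Let KB_gt0 : 0 < K * (B / L y1).
Proof. by rewrite mulr_gt0// (lt_le_trans _ B_ge1). Qed.

Let weight_in s : 0 < s < 1 -> w s = s `^ b * L s^-1.
Proof. by rewrite /post_weight => ->; rewrite mul1r. Qed.

Let head_in s : 0 < s <= l0 -> 0 < s < 1.
Proof. by move=> /andP[-> sl]; exact: le_lt_trans l0_lt1. Qed.

Lemma post_weight_gt0 s : 0 < s <= l0 -> 0 < w s.
Proof.
move=> sl; rewrite weight_in ?head_in//; have /andP[s0 _] := sl.
by rewrite mulr_gt0 ?powR_gt0//; have [] := L_potter (inv_ge sl) (lexx _).
Qed.

Lemma post_weight_head s x : 0 < s <= l0 -> 0 < x <= s ->
  w x <= K * s `^ eta * L s^-1 * x `^ (b - eta).
Proof.
move=> sl /andP[x0 xs]; have /andP[s0 sl0] := sl.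
rewrite weight_in; last by rewrite head_in// x0 (le_trans xs).
have xs' : s^-1 <= x^-1 by rewrite lef_pV2 ?posrE.
have [_ h _] := L_potter (inv_ge sl) xs'.
apply: le_trans (ler_wpM2l (powR_ge0 x b) h) _.
rewrite powRB ?(gt_eqF x0) ?implybT// le_eqVlt; apply/orP; left; apply/eqP.
rewrite (_ : x^-1 / s^-1 = s / x) ?invrK 1?mulrC//.
rewrite powRM ?invr_ge0 ?(ltW s0) ?(ltW x0)// -(powR_inv1 (ltW x0)) -powRrM mulN1r powRN.
ring.
Qed.

(** Potter's bound reduces the integral to that of x^(b - eta), with exponent above -1. It is stated
    in the extended reals because the integrability of the weight is itself deduced from it. *)
Lemma integral_post_weight_head s : 0 < s <= l0 ->
  (\int[leb]_x (w x * (x <= s)%R%:R)%:E <= (K / (b - eta + 1) * s * w s)%:E)%E.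
Proof.
move=> sl; have /andP[s0 sl0] := sl; set c := K * s `^ eta * L s^-1.
have Ls : 0 < L s^-1 by have [] := L_potter (inv_ge sl) (lexx _).
have c0 : 0 <= c by rewrite !mulr_ge0 ?powR_ge0// ltW.
have mi : measurable (`]0%R, s] : set R) by exact: measurable_itv.
apply: (@le_trans _ _ (\int[leb]_(x in `]0%R, s]) (c * x `^ (b - eta))%:E)%E).
  rewrite [leRHS]integral_mkcond/=; apply: ge0_le_integral => //=.
  - by move=> x _; rewrite lee_fin mulr_ge0 ?post_weight_ge0.
  - apply/measurable_EFinP; apply: measurable_funM; first exact: measurable_post_weight.
    exact: measurable_le_natr.
  - apply/(measurable_restrictT _ mi)/measurable_EFinP.
    by apply: measurable_funTS; apply: measurable_funM => //; exact: measurable_powR.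
  - move=> x _; rewrite patchE mem_setE in_itv/=.
    have [x0|x0] := ltP 0 x; last first.
      by rewrite (_ : w x = 0) ?mul0r//; apply: post_weight_out; rewrite ltNge x0.
    have [xs|xs] := leP x s; last by rewrite mulr0.
    by rewrite mulr1 lee_fin post_weight_head// x0.
rewrite ge0_integral_EFinZ//; last 2 first.
- by apply: measurable_funTS; exact: measurable_powR.
- by move=> x _; exact: powR_ge0.
apply: le_trans (lee_wpmul2l _ (integral_powR_le b_gt s0)) _; first by rewrite lee_fin.
rewrite -EFinM lee_fin le_eqVlt; apply/orP; left; apply/eqP.
rewrite weight_in ?head_in// /c powRD ?(gt_eqF s0) ?implybT// powRr1 ?(ltW s0)//.
rewrite powRB ?(gt_eqF s0) ?implybT//; field.
apply/andP; split; last by rewrite gt_eqF ?powR_gt0.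
by apply/eqP => h; have := b1_gt0; lra.
Qed.

(** For x <= l0 this is Potter's bound. For larger x, L(1/x) is at most B, a multiple of L(y1), and
    Potter's bound between y1 and 1/s gives the power of l0 / s <= x / s. *)
Lemma slowly_varying_le s x : 0 < s <= l0 -> s <= x -> x < 1 ->
  L x^-1 <= K * (B / L y1) * (x / s) `^ eta * L s^-1.
Proof.
move=> sl sx x1; have /andP[s0 sl0] := sl; have x0 := lt_le_trans s0 sx.
have Ls : 0 < L s^-1 by have [] := L_potter (inv_ge sl) (lexx _).
have [xl|xl] := leP x l0.
  have [||_ _] := L_potter (x := x^-1) (y := s^-1).
  - by rewrite inv_ge// x0.
  - by rewrite lef_pV2 ?posrE.
  rewrite invrK mulrC -mulrA => h; apply: le_trans h _.
  rewrite [leRHS](_ : _ = B / L y1 * (K * (x / s) `^ eta * L s^-1)); last by ring.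
  by rewrite [leLHS](_ : _ = K * (x / s) `^ eta * L s^-1) ?ler_peMl ?mulr_ge0 ?powR_ge0 ?(ltW Ls)//;
    rewrite [s^-1 * x]mulrC; ring.
have h1 : L x^-1 <= B / L y1 * L y1.
  rewrite divfK ?gt_eqF//; apply: L_le.
  by rewrite invf_ge1// (ltW x1)/= -[leRHS]invrK lef_pV2 ?posrE// ltW.
apply: le_trans h1 _; have [_ _ h] := L_potter (lexx y1) (inv_ge sl).
have B0 : 0 <= B / L y1 by exact: le_trans B_ge1.
apply: le_trans (ler_wpM2l B0 h) _.
rewrite [leLHS](_ : _ = K * (B / L y1) * (s^-1 / y1) `^ eta * L s^-1); last by ring.
rewrite ler_wpM2r ?(ltW Ls)// ler_wpM2l ?(ltW KB_gt0)//.
rewrite ge0_ler_powR ?nnegrE ?(ltW eta_gt0)//.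
- by rewrite divr_ge0 ?invr_ge0 ?(ltW s0)// ltW.
- by rewrite divr_ge0 ?(ltW s0) ?(ltW x0).
- by rewrite mulrC ler_wpM2r ?invr_ge0 ?(ltW s0)// ltW.
Qed.

(** The real exponent b + eta is rounded up to a natural number, which is harmless since x / s >= 1
    and suits the exponential estimate of the tail. *)
Lemma post_weight_le s x : 0 < s <= l0 -> s <= x ->
  w x <= K * (B / L y1) * (x / s) ^+ Num.bound `|b + eta| * w s.
Proof.
move=> sl sx; have /andP[s0 sl0] := sl; have x0 := lt_le_trans s0 sx.
have xs1 : 1 <= x / s by rewrite ler_pdivlMr// mul1r.
have [x1|x1] := ltP x 1; last first.
  rewrite post_weight_out; last by rewrite x0/= -leNgt.
  rewrite mulr_ge0 ?post_weight_ge0// mulr_ge0 ?(ltW KB_gt0)// exprn_ge0//.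
  by rewrite (le_trans _ xs1).
rewrite (weight_in (head_in sl)) (@weight_in x) ?x0//.
apply: le_trans (ler_wpM2l (powR_ge0 x b) (slowly_varying_le sl sx x1)) _.
have -> : x `^ b = (x / s) `^ b * s `^ b.
  by rewrite -powRM ?(le_trans _ xs1) ?(ltW s0)// divfK// gt_eqF.
have Ls : 0 < L s^-1 by have [] := L_potter (inv_ge sl) (lexx _).
rewrite [leLHS](_ : _ = K * (B / L y1) * ((x / s) `^ b * (x / s) `^ eta) * (s `^ b * L s^-1)); last by ring.
rewrite ler_wpM2r ?mulr_ge0 ?powR_ge0 ?(ltW Ls)// ler_wpM2l ?(ltW KB_gt0)//.
rewrite -powRD; last by rewrite (gt_eqF (lt_le_trans ltr01 xs1)) implybT.
rewrite -powR_mulrn ?(le_trans _ xs1)// ler_powR//.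
by rewrite (le_trans (ler_norm _))// ltW// archi_boundP.
Qed.

(** Below [l0] the head estimate applies; above it the weight is bounded by its value at [l0] up to
    a constant, and vanishes from 1 on. *)
Lemma integral_post_weight_lty : (\int[leb]_x (w x)%:E < +oo)%E.
Proof.
have l0l : 0 < l0 <= l0 by rewrite lexx andbT.
have mw := measurable_post_weight p a mL.
have w0 := post_weight_ge0 p a L_ge0.
set c := K * (B / L y1) * (1 / l0) ^+ Num.bound `|b + eta| * w l0.
have c0 : 0 <= c.
  by rewrite mulr_ge0// mulr_ge0 ?exprn_ge0 ?divr_ge0 ?(ltW l0_gt0)// ltW.
have ml (s : R) : measurable_fun [set: R] (fun x : R => (x <= s)%R%:R : R).
  exact: measurable_le_natr.
have mi : measurable_fun [set: R] (fun x : R => (0 < x <= 1)%R%:R : R).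
  by apply: measurable_natr; apply: measurable_and; [exact: measurable_fun_ltr|exact: measurable_fun_ler].
have m1 : measurable_fun [set: R] (fun x : R => w x * (x <= l0)%R%:R) by exact: measurable_funM.
have m2 : measurable_fun [set: R] (fun x : R => (0 < x <= 1)%R%:R * c) by exact: measurable_funM.
apply: (@le_lt_trans _ _ (\int[leb]_x (w x * (x <= l0)%R%:R + (0 < x <= 1)%R%:R * c)%:E)%E).
  apply: ge0_le_integral_EFin => //.
    exact: measurable_funD.
  move=> x _; have [xl|xl] := leP x l0.
    by rewrite mulr1 lerDl mulr_ge0.
  rewrite mulr0 add0r; have [x1|x1] := leP x 1; last first.
    have -> : w x = 0 by apply: post_weight_out; rewrite negb_and -!leNgt (ltW x1) orbT.
    by rewrite mulr_ge0.
  rewrite (lt_trans l0_gt0 xl) mul1r; apply: le_trans (post_weight_le l0l (ltW xl)) _.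
  rewrite /c ler_wpM2r// ler_wpM2l ?(ltW KB_gt0)//.
  apply: lerXn2r; rewrite ?nnegrE ?divr_ge0 ?(ltW l0_gt0) ?(ltW (lt_trans l0_gt0 xl))//.
  by rewrite ler_wpM2r// invr_ge0 ltW.
rewrite ge0_integral_EFinD//.
- rewrite integral_indic_le// lte_add_pinfty ?ltry//.
  by apply: le_lt_trans (integral_post_weight_head l0l) (ltry _).
- by move=> x _; rewrite mulr_ge0.
- by move=> x _; rewrite mulr_ge0.
Qed.

Lemma wint_post_weight_head s : 0 < s <= l0 ->
  wint w (fun x => (x <= s)%R%:R) <= K / (b - eta + 1) * s * w s.
Proof.
move=> sl; have h := integral_post_weight_head sl.
rewrite -lee_fin /wint fineK// ge0_fin_numE; first exact: le_lt_trans h (ltry _).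
by apply: integral_ge0 => x _; rewrite lee_fin mulr_ge0// post_weight_ge0.
Qed.

(** The bound on L starts at 2 y1 because [w_tail] concerns x <= l0 / 2 = 1 / (2 y1). *)
Lemma admissible_generalized_bayes C3 : (3 <= p)%N -> 0 <= C3 ->
  (forall y, 2 * y1 <= y -> L y <= C3 * (y `^ (a + 2) * ln y)) ->
  admissible (generalized_bayes (fun mu : vect R p => G p (vnorm mu) a L)).
Proof.
move=> p3 C30 Lt.
have mw := measurable_post_weight p a mL.
have w0 := post_weight_ge0 p a L_ge0.
have wo := @post_weight_out R p a L.
rewrite (_ : generalized_bayes _ = @bayes_estim R w p); last first.
  apply/funext => z; apply: generalized_bayesE => //; first exact: integral_post_weight_lty.
  apply: (pmass_gt0 mw w0 wo integral_post_weight_lty l0_gt0 KB_gt0 post_weight_gt0 post_weight_le).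
  exact: hsq_ge0.
have C10 : 0 < K / (b - eta + 1) by rewrite divr_gt0.
apply: (admissible_bayes_estim mw w0 wo integral_post_weight_lty l0_gt0 l0_lt1 C10 KB_gt0
  post_weight_gt0 wint_post_weight_head post_weight_le p3 C30) => x /andP[x0 xl].
have xl0 : x <= l0 by apply: le_trans xl _; rewrite ler_pdivrMr// ler_peMr ?(ltW l0_gt0)// ler1n.
rewrite weight_in ?head_in ?x0//.
have y2 : 2 * y1 <= x^-1.
  by rewrite -[leLHS]invrK lef_pV2 ?posrE ?invr_gt0 ?mulr_gt0// invfM mulrC.
have := Lt _ y2; rewrite lnV ?posrE// => h.
rewrite mulrAC -powRD ?(gt_eqF x0) ?implybT// (_ : b + _ = a + 1); last by ring.
apply: le_trans (ler_wpM2l (powR_ge0 x (a + 1)) h) _.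
rewrite le_eqVlt; apply/orP; left; apply/eqP.
rewrite -(powR_inv1 (ltW x0)) -powRrM mulrCA (mulrA (x `^ (a + 1))) -powRD ?(gt_eqF x0) ?implybT//.
by rewrite (_ : a + 1 + _ = -1) 1?[X in C3 * X]mulrC//; ring.
Qed.

End post_weight_bounds.

(** * Growth of L in the two cases *)

Section conclusion.
Context {R : realType}.
Variables (p : nat) (a : R) (L : R -> R).
Hypothesis p_ge3 : (3 <= p)%N.
Hypothesis a_gt : 0 < p%:R / 2 + a + 1.
Hypothesis L_ge0 : forall y : R, 1 <= y -> 0 <= L y.
Hypothesis L_sv : slowly_varying L.
Hypothesis L_mono : ultimately_monotone L.
Hypothesis L_diff : differentiable_on_1oo L.

Lemma slowly_varying_admissible (C : R) : 0 <= C ->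
  (\forall y0 \near +oo, forall y, y0 <= y -> L y <= C * (y `^ (a + 2) * ln y)) ->
  admissible (generalized_bayes (fun mu : vect R p => G p (vnorm mu) a L)).
Proof.
(* Half of the available slack: p/2 + a - eta = eta - 1 stays above -1. *)
move=> C0 Lle; pose eta := (p%:R / 2 + a + 1) / 2.
have eta0 : 0 < eta by rewrite divr_gt0.
have : \forall y1 \near +oo, 1 < y1 /\
    (forall x y, y1 <= x -> x <= y ->
    [/\ 0 < L x, L y <= 2 `^ eta * (y / x) `^ eta * L x &
        L x <= 2 `^ eta * (y / x) `^ eta * L y]) /\
    forall y, y1 <= y -> L y <= C * (y `^ (a + 2) * ln y).
  near=> y1; split; first by near: y1; exact: nbhs_pinfty_gt.
  by split; near: y1; [exact: potter|].
move=> [M [_ hM]].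
have [y11 [Lp Ly]] := hM (M + 1) (ltr_pwDr ltr01 (lexx M)).
have [B LB] := differentiable_on_bounded L_diff y11.
apply: (@admissible_generalized_bayes R p a L eta (M + 1) B _ eta0 L_ge0
  (measurable_Linv L_diff) y11 Lp LB C p_ge3 C0).
  by rewrite /eta; have := a_gt; lra.
by move=> y y2; apply: Ly; rewrite (le_trans _ y2)// ler_peMl ?ler1n// ltW// (lt_trans ltr01).
Unshelve. all: by end_near. Qed.

(** Potter's bound with eta = a + 2 from a fixed point gives L(y) <= C y^(a + 2), and ln y >= 1 once
    y >= e. *)
Lemma slowly_varying_le_powR : - 2 < a -> exists2 C, 0 <= C &
  \forall y0 \near +oo, forall y, y0 <= y -> L y <= C * (y `^ (a + 2) * ln y).
Proof.
move=> a2; have a0 : 0 < a + 2 by lra.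
have [M [_ hM]] := potter L_sv L_mono L_ge0 a0.
pose y1 := Num.max 1 (M + 1).
have y1_gt0 : 0 < y1 by rewrite lt_max ltr01.
have Lp y : M < y1 -> y1 <= y -> _ := fun My => hM y1 My y1 y (lexx y1).
have My1 : M < y1 by rewrite lt_max ltrDl ltr01 orbT.
have Ly1 : 0 < L y1 by have [] := Lp y1 My1 (lexx y1).
exists (2 `^ (a + 2) * y1^-1 `^ (a + 2) * L y1).
  by rewrite !mulr_ge0 ?powR_ge0// ltW.
near=> y0 => y y0y.
have y1y : y1 <= y by rewrite (le_trans _ y0y)//; near: y0; apply: nbhs_pinfty_ge; exact: num_real.
have ln1 : 1 <= ln y.
  rewrite -[leLHS]expRK ler_ln ?posrE ?expR_gt0 ?(lt_le_trans y1_gt0)//.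
  by rewrite (le_trans _ y0y)//; near: y0; apply: nbhs_pinfty_ge; exact: num_real.
have [_ h _] := Lp y My1 y1y; apply: le_trans h _.
have yy : 0 <= y by rewrite (le_trans _ y1y)// ltW.
rewrite powRM ?invr_ge0 ?(ltW y1_gt0)//.
rewrite [leRHS](_ : _ = 2 `^ (a + 2) * (y `^ (a + 2) * y1^-1 `^ (a + 2)) * L y1 * ln y); last by ring.
by rewrite ler_peMr// !mulr_ge0 ?powR_ge0// ltW.
Unshelve. all: by end_near. Qed.

(** Here y^(a + 2) = 1, and ln y1 / L(y1) <= ln y / L(y) is the claim with C = L(y1) / ln y1; [y1]
    is at least 2 to make ln y1 positive. *)
Lemma slowly_varying_le_ln : a = - 2 -> ultimately_nondecreasing (fun y => ln y / L y) ->
  exists2 C, 0 <= C &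
  \forall y0 \near +oo, forall y, y0 <= y -> L y <= C * (y `^ (a + 2) * ln y).
Proof.
move=> -> [z0 mono]; have [M [_ LM]] := slowly_varying_gt0 L_sv L_ge0.
pose y1 := Num.max 2 (Num.max z0 (M + 1)).
have y1_gt1 : 1 < y1 by rewrite lt_max ltr1n.
have zy1 : z0 <= y1 by rewrite !le_max lexx orbT.
have My1 : M < y1 by rewrite !lt_max ltrDl ltr01 !orbT.
have Ly1 := LM _ My1; have ln1 := ln_gt0 y1_gt1.
exists (L y1 / ln y1); first by rewrite divr_ge0 ?ltW.
near=> y0 => y y0y.
have y1y : y1 <= y by rewrite (le_trans _ y0y)//; near: y0; apply: nbhs_pinfty_ge; exact: num_real.
have := mono _ _ zy1 y1y; rewrite ler_pdivlMr ?LM// ?(lt_le_trans My1)// => h.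
rewrite addNr powRr0 mul1r mulrAC ler_pdivlMr// -ler_pdivrMl//.
by rewrite (_ : _ * _ = ln y1 / L y1 * L y) //; ring.
Unshelve. all: by end_near. Qed.

End conclusion.

Theorem theorem3p1 (R : realType) (p : nat) (a : R) (L : R -> R)
  (p_ge3 : (3 <= p)%N)
  (a_gt : 0 < p%:R / 2 + a + 1)
  (L_ge0 : forall y : R, 1 <= y -> 0 <= L y)
  (L1 : slowly_varying L)
  (L2 : ultimately_monotone L)
  (L3 : differentiable_on_1oo L /\ ultimately_monotone (derive1 L)) :
  (- 2 < a ->
     admissible (generalized_bayes (fun mu : vect R p => G p (vnorm mu) a L)))
  /\
  (a = - 2 -> ultimately_nondecreasing (fun y => ln y / L y) ->
     admissible (generalized_bayes (fun mu : vect R p => G p (vnorm mu) a L))).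
Proof.
have [Ldiff _] := L3; split.
  move=> a2; have [C C0 LC] := slowly_varying_le_powR L_ge0 L1 L2 a2.
  exact: slowly_varying_admissible LC.
move=> a2 mono; have [C C0 LC] := slowly_varying_le_ln L_ge0 L1 a2 mono.
exact: slowly_varying_admissible LC.
Qed.
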